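(* Let $\Gamma$ be a torsion-free uniform lattice of $\operatorname{PSL}(2;\mathbb{R})$, let $\rho>0$, let $x\in\mathbb{H}^2$, and let $\ell$ be a geodesic on $\mathbb{H}^2$. Let $\Sigma=\Gamma\backslash\mathbb{H}^2$, and let $x_0=\Gamma x\in\Sigma$. Let $p_\ell:E_\ell\to\ell$ be the orthogonal projection from the open tubular neighbourhood $E_\ell$ of $\ell$ of radius $\rho$, and let $S_\ell=p_\ell(E_\ell\cap\Gamma x)$, regarded as a subset of $\mathbb{R}$ via an arc-length parametrisation of $\ell$. Assume that the orbit of the geodesic flow consisting of the unit tangent vectors of the projection of $\ell$ to $\Sigma$ is dense in the unit tangent bundle $S^1(T\Sigma)$, and that $d(\ell,y)\neq\rho$ for every $y\in\Gamma x$. Then $S_\ell$ is Delone if and only if both of the following conditions hold: (A) $\rho<\operatorname{inj}(\Sigma,x_0)$, where $\operatorname{inj}(\Sigma,x_0)=\frac12\min\{d(y,z)\mid y,z\in\Gamma x,\ y\neq z\}$ is the injectivity radius of $\Sigma$ at $x_0$. (B) Any geodesic on $\Sigma$ intersects the closed disk $\Delta$ of radius $\rho$ centred at $x_0$, and there exists no geodesic on $\Sigma$ with one-sided tangency with $\partial\Delta$. Moreover, if $S_\ell$ is Delone, then it is chaotic.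
   Context: Geodesics are complete geodesics $\mathbb{R}\to\mathbb{H}^2$ or $\mathbb{R}\to\Sigma$ parametrised by arc-length. Given a closed disk $D$ on $\Sigma$, a geodesic $\sigma$ on $\Sigma$ has one-sided tangency with $\partial D$ if $\sigma$ is tangent to $\partial D$ at every point of $\sigma\cap\partial D$, and one can choose an orientation of the normal bundle of $\sigma$ so that the outward vector of $\partial D$ at every point of tangency is positive. A subset $S\subset\mathbb{R}$ is $(\epsilon,\delta)$-Delone ($\epsilon,\delta>0$) if every $t\in\mathbb{R}$ is at distance at most $\epsilon$ from some point of $S$, and distinct points of $S$ are at distance at least $\delta$; $S$ is Delone if it is $(\epsilon,\delta)$-Delone for some $\epsilon,\delta>0$. The set $\operatorname{Del}_{\epsilon,\delta}$ of $(\epsilon,\delta)$-Delone subsets of $\mathbb{R}$ carries the local rubber topology, induced by the uniformity with base of entourages $$N_{U,U'}=\{(S,S')\mid S\cap U\subset S'+U',\ S'\cap U\subset S+U'\},$$ with $U,U'$ open neighbourhoods of $0$ and $U$ precompact; it is compact and metrisable. $\mathbb{R}$ acts continuously on it by $(v,S)\mapsto S-v$. Denote by $[S]$ the orbit of $S$ and by $\overline{[S]}$ its closure. A Delone set is periodic if its orbit is compact (such an orbit is a periodic orbit). $S$ is almost chaotic if the union of the periodic orbits contained in $\overline{[S]}$ is dense in $\overline{[S]}$; it is aperiodic if $S-v\neq S$ for all $v\neq 0$; it is chaotic if it is almost chaotic and aperiodic. *)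

(* Defs.v *)
From HB Require Import structures.
From mathcomp Require Import all_boot all_order all_algebra.
From mathcomp Require Import all_classical all_reals all_analysis.
From mathcomp Require Import ring lra.
From mathcomp.real_closed Require Import complex.

Set Implicit Arguments.
Unset Strict Implicit.
Unset Printing Implicit Defensive.

Import Order.TTheory GRing.Theory Num.Theory.
Import numFieldNormedType.Exports.

Local Open Scope classical_set_scope.
Local Open Scope ring_scope.
Local Open Scope quotient_scope.

(* Orbit spaces.  A point of [orbit_space act A] is literally an orbit, i.e.  *)
(* a subset of T; the orbits partition T as soon as A is a subgroup of G and  *)
(* act is an action.  The topology is the quotient topology.                  *)
Definition act_orbit {G T : Type} (act : G -> T -> T) (A : set G) (x : T) :
    set T :=
  [set act g x | g in A].

Definition orbit_space {G : Type} {T : choiceType} (act : G -> T -> T)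
    (A : set G) : Type :=
  {P : set T | P \in range (act_orbit act A)}.

Section OrbitSpace.
Context {G : Type} {T : choiceType} (act : G -> T -> T) (A : set G).
Local Notation Q := (orbit_space act A).

HB.instance Definition _ := SubChoice.on Q.

Definition orbit_pi (x : T) : Q :=
  exist _ (act_orbit act A x) (mem_set (imageT _ x)).

Definition orbit_repr (P : Q) : T := sval (cid2 (set_mem (svalP P))).

Lemma orbit_reprK : cancel orbit_repr orbit_pi.
Proof.
move=> P; apply: eq_sig_hprop => [? ? ?|]; first exact: bool_irrelevance.
by rewrite /orbit_repr /=; case: cid2.
Qed.

HB.instance Definition _ := isQuotient.Build T Q orbit_reprK.

Lemma val_pi_orbit (x : T) : sval (\pi_Q x) = act_orbit act A x.
Proof. by rewrite unlock. Qed.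

End OrbitSpace.

Section OrbitSpaceTopology.
Context {G : Type} {T : topologicalType} (act : G -> T -> T) (A : set G).
Local Notation Q := (orbit_space act A).

Definition orbit_space_open (U : set Q) : Prop := open (\pi_Q @^-1` U).

Lemma orbit_space_openT : orbit_space_open setT.
Proof. by rewrite /orbit_space_open preimage_setT; exact: openT. Qed.

Lemma orbit_space_openI (U V : set Q) :
  orbit_space_open U -> orbit_space_open V -> orbit_space_open (U `&` V).
Proof. exact: openI. Qed.

Lemma orbit_space_open_bigU (I : Type) (F : I -> set Q) :
  (forall i, orbit_space_open (F i)) -> orbit_space_open (\bigcup_i F i).
Proof. by move=> oF; apply: bigcup_open => i _; exact: oF. Qed.

HB.instance Definition _ := isOpenTopological.Build Q
  orbit_space_openT orbit_space_openI orbit_space_open_bigU.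

End OrbitSpaceTopology.

Section PSL2.
Variable R : realType.

Record SL2 := MkSL2 { sl_mx :> 'M[R]_2; sl_mxP : \det sl_mx == 1 }.

HB.instance Definition _ := [isSub for sl_mx].
HB.instance Definition _ := [Choice of SL2 by <:].
HB.instance Definition _ := Topological.copy SL2 (initial_topology sl_mx).

Lemma sl_one_subproof : \det (1%:M : 'M[R]_2) == 1.
Proof. by rewrite det1. Qed.

Lemma sl_mul_subproof (g h : SL2) : \det (g *m h) == 1.
Proof. by rewrite det_mulmx (eqP (sl_mxP g)) (eqP (sl_mxP h)) mulr1. Qed.

Lemma sl_inv_subproof (g : SL2) : \det (invmx g) == 1.
Proof. by rewrite det_inv (eqP (sl_mxP g)) invr1. Qed.

Lemma sl_opp_subproof (g : SL2) : \det (- sl_mx g) == 1.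
Proof. by rewrite -scaleN1r detZ (eqP (sl_mxP g)) mulr1 sqrrN expr1n. Qed.

Definition sl_one := MkSL2 sl_one_subproof.
Definition sl_mul g h := MkSL2 (sl_mul_subproof g h).
Definition sl_inv g := MkSL2 (sl_inv_subproof g).
Definition sl_opp g := MkSL2 (sl_opp_subproof g).

Lemma sl_unit (g : SL2) : (g : 'M[R]_2) \in unitmx.
Proof. by rewrite unitmxE (eqP (sl_mxP g)) unitr1. Qed.

Lemma sl_mulA : associative sl_mul.
Proof. by move=> f g h; apply: val_inj; rewrite /= mulmxA. Qed.
Lemma sl_mul1 : left_id sl_one sl_mul.
Proof. by move=> g; apply: val_inj; rewrite /= mul1mx. Qed.
Lemma sl_1mul : right_id sl_one sl_mul.
Proof. by move=> g; apply: val_inj; rewrite /= mulmx1. Qed.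
Lemma sl_mulV : left_inverse sl_one sl_inv sl_mul.
Proof. by move=> g; apply: val_inj; rewrite /= mulVmx// sl_unit. Qed.
Lemma sl_Vmul : right_inverse sl_one sl_inv sl_mul.
Proof. by move=> g; apply: val_inj; rewrite /= mulmxV// sl_unit. Qed.

HB.instance Definition _ :=
  isGroup.Build SL2 sl_mulA sl_mul1 sl_1mul sl_mulV sl_Vmul.

(* PSL(2;R) = SL(2;R)/{1,-1}: an element is a pair {g, -g}.                   *)
Definition PSL2 : Type :=
  orbit_space (fun g h : SL2 => g * h)%g [set sl_one; sl_opp sl_one].

HB.instance Definition _ := Quotient.on PSL2.
HB.instance Definition _ := Topological.on PSL2.

Lemma sl_oppK : involutive sl_opp.
Proof. by move=> g; apply: val_inj; rewrite /= opprK. Qed.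

Lemma sl_oppE (g : SL2) : sl_mul (sl_opp sl_one) g = sl_opp g.
Proof. by apply: val_inj; rewrite /= mulNmx mul1mx. Qed.

Lemma PSL2_val (g : SL2) : sval (\pi_PSL2 g) = [set g; sl_opp g].
Proof.
transitivity (act_orbit (fun g h : SL2 => g * h)%g
  [set sl_one; sl_opp sl_one] g).
  exact: val_pi_orbit.
apply/seteqP; split=> [_ [h [->|->] <-]|h [->|->]].
- by left; exact: mul1g.
- by right; exact: sl_oppE.
- by exists sl_one; [left|exact: mul1g].
- by exists (sl_opp sl_one); [right|exact: sl_oppE].
Qed.

Lemma PSL2_piN (g : SL2) : \pi_PSL2 (sl_opp g) = \pi_PSL2 g.
Proof. by apply: val_inj; rewrite /= !PSL2_val sl_oppK setUC. Qed.

Lemma PSL2_pi_eq (g h : SL2) :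
  \pi_PSL2 g = \pi_PSL2 h -> g = h \/ g = sl_opp h.
Proof.
move=> /(congr1 sval); rewrite !PSL2_val => gh.
by have : [set h; sl_opp h] g by rewrite -gh; left.
Qed.

Lemma PSL2_repr (g : SL2) :
  repr (\pi_PSL2 g) = g \/ repr (\pi_PSL2 g) = sl_opp g.
Proof. by apply: PSL2_pi_eq; rewrite reprK. Qed.

Definition psl_one : PSL2 := \pi_PSL2 sl_one.
Definition psl_mul (p q : PSL2) : PSL2 := \pi_PSL2 (repr p * repr q)%g.
Definition psl_inv (p : PSL2) : PSL2 := \pi_PSL2 (repr p)^-1%g.

Lemma psl_mul_pi (g h : SL2) :
  psl_mul (\pi_PSL2 g) (\pi_PSL2 h) = \pi_PSL2 (g * h)%g.
Proof.
rewrite /psl_mul; have NL a b : (sl_opp a * b)%g = sl_opp (a * b)%g.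
  by apply: val_inj; rewrite /= mulNmx.
have NR a b : (a * sl_opp b)%g = sl_opp (a * b)%g.
  by apply: val_inj; rewrite /= mulmxN.
by case: (PSL2_repr g) => ->; case: (PSL2_repr h) => ->;
  rewrite ?NL ?NR ?PSL2_piN.
Qed.

Lemma psl_inv_pi (g : SL2) : psl_inv (\pi_PSL2 g) = \pi_PSL2 (g^-1)%g.
Proof.
rewrite /psl_inv; have NV a : ((sl_opp a)^-1)%g = sl_opp (a^-1)%g.
  by apply: val_inj; exact: (invrN (sl_mx a : 'M[R]_2)).
by case: (PSL2_repr g) => ->; rewrite ?NV ?PSL2_piN.
Qed.

Lemma psl_mulA : associative psl_mul.
Proof.
move=> p q r; rewrite -[p]reprK -[q]reprK -[r]reprK.
by rewrite (psl_mul_pi (repr q) (repr r)) (psl_mul_pi (repr p) (repr q))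
  !psl_mul_pi mulgA.
Qed.
Lemma psl_mul1 : left_id psl_one psl_mul.
Proof. by move=> p; rewrite -[p]reprK psl_mul_pi mul1g. Qed.
Lemma psl_1mul : right_id psl_one psl_mul.
Proof. by move=> p; rewrite -[p]reprK psl_mul_pi mulg1. Qed.
Lemma psl_mulV : left_inverse psl_one psl_inv psl_mul.
Proof.
by move=> p; rewrite -[p]reprK (psl_inv_pi (repr p)) psl_mul_pi mulVg.
Qed.
Lemma psl_Vmul : right_inverse psl_one psl_inv psl_mul.
Proof.
by move=> p; rewrite -[p]reprK (psl_inv_pi (repr p)) psl_mul_pi mulgV.
Qed.

HB.instance Definition _ :=
  isGroup.Build PSL2 psl_mulA psl_mul1 psl_1mul psl_mulV psl_Vmul.

Definition subgroup (G : groupType) (A : set G) : Prop :=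
  [/\ A 1%g, forall g h, A g -> A h -> A (g * h)%g & forall g, A g -> A g^-1%g].

Definition torsion_free (G : groupType) (A : set G) : Prop :=
  forall (g : G) (n : nat), A g -> (0 < n)%N -> (g ^+ n = 1)%g -> g = 1%g.

(* A subgroup is discrete when all its points are isolated; a discrete        *)
(* subgroup with compact quotient is a (uniform) lattice.                     *)
Definition uniform_lattice (Gamma : set PSL2) : Prop :=
  [/\ subgroup Gamma, isolated Gamma = Gamma
    & compact [set: orbit_space (fun g h : PSL2 => g * h)%g Gamma]].

End PSL2.

Section HyperbolicPlane.
Variable R : realType.
Local Open Scope complex_scope.
Local Notation Re := (@complex.Re _).
Local Notation Im := (@complex.Im _).

Record H2 := MkH2 { h2_val :> R[i]; h2_gt0 : 0 < Im h2_val }.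

HB.instance Definition _ := [isSub for h2_val].
HB.instance Definition _ := [Choice of H2 by <:].
HB.instance Definition _ := Topological.copy H2
  (initial_topology (fun z : H2 => (Re z, Im z) : R * R)).

Definition arcosh (u : R) : R := ln (u + Num.sqrt (u ^+ 2 - 1)).

Definition hdist (z w : H2) : R :=
  arcosh (1 + ((Re z - Re w) ^+ 2 + (Im z - Im w) ^+ 2) / (2 * Im z * Im w)).

(* Every tangent space of H2 is identified with R[i]; the Riemannian metric   *)
(* is (dx^2 + dy^2) / y^2.                                                    *)
Definition riem (z : H2) (u v : R[i]) : R :=
  (Re u * Re v + Im u * Im v) / Im z ^+ 2.

Record UT := MkUT {
  ut_base : H2; ut_vec : R[i]; ut_norm : riem ut_base ut_vec ut_vec == 1 }.

Definition ut_pair (u : UT) : H2 * R[i] := (ut_base u, ut_vec u).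
Definition ut_of_pair (p : H2 * R[i]) : option UT :=
  if @idP (riem p.1 p.2 p.2 == 1) is ReflectT h then Some (MkUT h) else None.
Lemma ut_pairK : pcancel ut_pair ut_of_pair.
Proof.
case=> z v h; rewrite /ut_of_pair /ut_pair /=; case: {-}_ / idP => // h'.
by rewrite (bool_irrelevance h h').
Qed.

HB.instance Definition _ := Choice.copy UT (pcan_type ut_pairK).
HB.instance Definition _ := Topological.copy UT
  (initial_topology (fun u : UT =>
     ((Re (ut_base u), Im (ut_base u)), (Re (ut_vec u), Im (ut_vec u)))
     : (R * R) * (R * R))).

Definition moebius_num (g : SL2 R) (z : R[i]) : R[i] :=
  (g 0 0)%:C * z + (g 0 1)%:C.
Definition moebius_den (g : SL2 R) (z : R[i]) : R[i] :=
  (g 1 0)%:C * z + (g 1 1)%:C.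

Lemma sl_det (g : SL2 R) : g 0 0 * g 1 1 - g 0 1 * g 1 0 = 1.
Proof.
rewrite -(eqP (sl_mxP g)) (expand_det_row _ 0) !big_ord_recl big_ord0 addr0.
rewrite /cofactor !det_mx11 !mxE /= expr0 expr1 mul1r mulN1r mulrN.
by congr (g _ _ * g _ _ - g _ _ * g _ _); apply: val_inj.
Qed.

Definition moebius_normd (g : SL2 R) (z : R[i]) : R :=
  (g 1 0 * Re z + g 1 1) ^+ 2 + (g 1 0 * Im z) ^+ 2.

Lemma moebius_normd_gt0 (g : SL2 R) (z : H2) : 0 < moebius_normd g z.
Proof.
case: z => -[x y] /= y0; rewrite /moebius_normd /=.
have [c0|c0] := eqVneq (g 1 0) 0.
  rewrite c0 !mul0r add0r expr0n addr0 exprn_even_gt0 //=.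
  apply/eqP => d0; have /eqP := sl_det g.
  by rewrite c0 d0 !mulr0 subrr eq_sym oner_eq0.
by rewrite ltr_wpDl ?sqr_ge0// exprn_even_gt0 //= mulf_neq0 // gt_eqF.
Qed.

Lemma Im_moebius (g : SL2 R) (z : H2) :
  Im (moebius_num g z / moebius_den g z) = Im z / moebius_normd g z.
Proof.
have := moebius_normd_gt0 g z; case: z => -[x y] /= y0.
rewrite /moebius_num /moebius_den /moebius_normd /=; simpc => N0.
transitivity ((g 0 0 * g 1 1 - g 0 1 * g 1 0) * y /
    ((g 1 0 * x + g 1 1) ^+ 2 + (g 1 0 * y) ^+ 2)).
  by field; rewrite gt_eqF.
by rewrite sl_det mul1r.
Qed.

Lemma moebius_subproof (g : SL2 R) (z : H2) :
  0 < Im (moebius_num g z / moebius_den g z).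
Proof. by rewrite Im_moebius divr_gt0 ?moebius_normd_gt0// h2_gt0. Qed.

Definition moebius (g : SL2 R) (z : H2) : H2 := MkH2 (moebius_subproof g z).

(* The derivative of z |-> (a z + b) / (c z + d) is 1 / (c z + d)^2.          *)
Definition dmoebius (g : SL2 R) (z : H2) (v : R[i]) : R[i] :=
  v / moebius_den g z ^+ 2.

Lemma dmoebius_riem (g : SL2 R) (z : H2) (u v : R[i]) :
  riem (moebius g z) (dmoebius g z u) (dmoebius g z v) = riem z u v.
Proof.
rewrite /riem [Im (moebius g z)]Im_moebius.
have := moebius_normd_gt0 g z; case: z u v => -[x y] /= y0 [u1 u2] [v1 v2].
rewrite /dmoebius /moebius_den /moebius_normd /= expr2; simpc.
set p := g 1 0 * x + g 1 1; set q := g 1 0 * y => N0.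
have -> : (p * p - q * q) ^+ 2 + (p * q + q * p) ^+ 2 = (p * p + q ^+ 2) ^+ 2.
  by ring.
by field; rewrite !gt_eqF.
Qed.

Lemma tmoebius_subproof (g : SL2 R) (u : UT) :
  riem (moebius g (ut_base u)) (dmoebius g (ut_base u) (ut_vec u))
    (dmoebius g (ut_base u) (ut_vec u)) == 1.
Proof. by rewrite dmoebius_riem; exact: ut_norm. Qed.

Definition tmoebius (g : SL2 R) (u : UT) : UT := MkUT (tmoebius_subproof g u).

(* The actions of PSL(2;R); [psl_actE] and [psl_tactE] show that the choice   *)
(* of representative is irrelevant.                                           *)
Definition psl_act (p : PSL2 R) (z : H2) : H2 := moebius (repr p) z.
Definition psl_tact (p : PSL2 R) (u : UT) : UT := tmoebius (repr p) u.

Lemma moebius_denN (g : SL2 R) (z : R[i]) :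
  moebius_den (sl_opp g) z = - moebius_den g z.
Proof. by rewrite /moebius_den /= !mxE !rmorphN mulNr opprD. Qed.

Lemma moebius_numN (g : SL2 R) (z : R[i]) :
  moebius_num (sl_opp g) z = - moebius_num g z.
Proof. by rewrite /moebius_num /= !mxE !rmorphN mulNr opprD. Qed.

Lemma moebiusN (g : SL2 R) (z : H2) : moebius (sl_opp g) z = moebius g z.
Proof.
by apply: val_inj; rewrite /= moebius_numN moebius_denN invrN mulrNN.
Qed.

Lemma tmoebiusN (g : SL2 R) (u : UT) : tmoebius (sl_opp g) u = tmoebius g u.
Proof.
apply: (pcan_inj ut_pairK); rewrite /ut_pair /=; congr (_, _).
  exact: moebiusN.
by rewrite /dmoebius moebius_denN sqrrN.
Qed.

Lemma psl_actE (g : SL2 R) (z : H2) : psl_act (\pi_(PSL2 R) g) z = moebius g z.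
Proof. by rewrite /psl_act; case: (PSL2_repr g) => ->; rewrite ?moebiusN. Qed.

Lemma psl_tactE (g : SL2 R) (u : UT) :
  psl_tact (\pi_(PSL2 R) g) u = tmoebius g u.
Proof. by rewrite /psl_tact; case: (PSL2_repr g) => ->; rewrite ?tmoebiusN. Qed.

Lemma moebius_den_neq0 (g : SL2 R) (z : H2) : moebius_den g z != 0.
Proof.
have := moebius_normd_gt0 g z; apply: contraTneq => den0.
have re0 : g 1 0 * Re z + g 1 1 = 0.
  move: den0; rewrite /moebius_den; case: z => -[a b] /= _; simpc.
  by case.
have im0 : g 1 0 * Im z = 0.
  move: den0; rewrite /moebius_den; case: z {re0} => -[a b] /= _; simpc.
  by case.
by rewrite /moebius_normd re0 im0 expr0n addr0 ltxx.
Qed.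

Lemma sl_mulE (g h : SL2 R) i j :
  (g * h)%g i j = g i 0 * h 0 j + g i 1 * h 1 j.
Proof.
rewrite [LHS]mxE !big_ord_recl big_ord0 addr0.
by congr (g _ _ * h _ _ + g _ _ * h _ _); apply: val_inj.
Qed.

Lemma moebius_denM (g h : SL2 R) (z : H2) :
  moebius_den (g * h)%g z = moebius_den g (moebius h z) * moebius_den h z.
Proof.
have := moebius_den_neq0 h z.
rewrite {1 2}/moebius_den /= mulrDl -mulrA => /divfK ->.
rewrite /moebius_num /moebius_den !sl_mulE !rmorphD !rmorphM /=; ring.
Qed.

Lemma moebius_numM (g h : SL2 R) (z : H2) :
  moebius_num (g * h)%g z = moebius_num g (moebius h z) * moebius_den h z.
Proof.
have := moebius_den_neq0 h z.
rewrite {1 2}/moebius_num /= mulrDl -mulrA => /divfK ->.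
rewrite /moebius_num /moebius_den !sl_mulE !rmorphD !rmorphM /=; ring.
Qed.

Lemma moebiusM (g h : SL2 R) (z : H2) :
  moebius (g * h)%g z = moebius g (moebius h z).
Proof.
apply: val_inj; rewrite /= moebius_numM moebius_denM.
by rewrite -mulf_div divff ?mulr1// moebius_den_neq0.
Qed.

Lemma tmoebiusM (g h : SL2 R) (u : UT) :
  tmoebius (g * h)%g u = tmoebius g (tmoebius h u).
Proof.
apply: (pcan_inj ut_pairK); rewrite /ut_pair /=; congr (_, _).
  exact: moebiusM.
by rewrite /dmoebius moebius_denM exprMn invfM mulrA mulrAC.
Qed.

Lemma moebius1 (z : H2) : moebius (sl_one R) z = z.
Proof.
apply: val_inj; rewrite /= /moebius_num /moebius_den !mxE /= rmorph1 rmorph0.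
by rewrite mul1r mul0r addr0 add0r divr1.
Qed.

Lemma psl_act1 (z : H2) : psl_act 1%g z = z.
Proof. by rewrite [LHS]psl_actE moebius1. Qed.

Lemma psl_actM (p q : PSL2 R) (z : H2) :
  psl_act (p * q)%g z = psl_act p (psl_act q z).
Proof. by rewrite [LHS]psl_actE moebiusM. Qed.

Lemma psl_tact1 (u : UT) : psl_tact 1%g u = u.
Proof.
rewrite [LHS]psl_tactE; apply: (pcan_inj ut_pairK); rewrite /ut_pair /=.
congr (_, _); first exact: moebius1.
by rewrite /dmoebius /moebius_den !mxE /= rmorph1 rmorph0 mul0r add0r expr1n divr1.
Qed.

Lemma psl_tactM (p q : PSL2 R) (u : UT) :
  psl_tact (p * q)%g u = psl_tact p (psl_tact q u).
Proof. by rewrite [LHS]psl_tactE tmoebiusM. Qed.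

Definition geodesic (l : R -> H2) : Prop :=
  forall s t, hdist (l s) (l t) = `|s - t|.

Definition velocity (l : R -> H2) (t : R) : R[i] :=
  derive1 (fun s => Re (l s)) t +i* derive1 (fun s => Im (l s)) t.

Definition flow_orbit (l : R -> H2) : set UT :=
  [set u | exists t, ut_base u = l t /\ ut_vec u = velocity l t].

Definition dist_to (l : R -> H2) (z : H2) : R :=
  inf (range (fun t => hdist (l t) z)).

(* [orth_proj l z t] means that l t is the orthogonal projection of z on l:   *)
(* some geodesic through z meets l orthogonally at l t.                       *)
Definition orth_proj (l : R -> H2) (z : H2) (t : R) : Prop :=
  exists g : R -> H2, [/\ geodesic g, g 0 = l t,
    riem (l t) (velocity g 0) (velocity l t) = 0 & exists r, g r = z].

Definition tube (l : R -> H2) (rho : R) : set H2 := [set z | dist_to l z < rho].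

Definition proj_set (Gamma : set (PSL2 R)) (rho : R) (x : H2) (l : R -> H2) :
    set R :=
  [set t | exists2 y, (tube l rho `&` act_orbit psl_act Gamma x) y
                    & orth_proj l y t].

Variable Gamma : set (PSL2 R).

(* For torsion-free Gamma the projection H2 -> surface is a Riemannian        *)
(* covering, and the unit tangent bundle of the surface is the quotient of    *)
(* that of H2.                                                                *)
Definition surface : Type := orbit_space psl_act Gamma.
Definition surface_UT : Type := orbit_space psl_tact Gamma.

HB.instance Definition _ := Quotient.on surface.
HB.instance Definition _ := Topological.on surface.
HB.instance Definition _ := Quotient.on surface_UT.
HB.instance Definition _ := Topological.on surface_UT.

Definition sdist (P Q : surface) : R :=
  inf [set hdist y z | y in sval P & z in sval Q].

(* The infimum is a minimum, since an orbit of a discrete group is discrete.  *)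
Definition inj_radius (P : surface) : R :=
  inf [set r | exists y z, [/\ sval P y, sval P z, y <> z & r = hdist y z]] / 2.

Definition closed_disk (c : surface) (rho : R) : set surface :=
  [set P | sdist c P <= rho].

Definition disk_boundary (c : surface) (rho : R) : set surface :=
  [set P | sdist c P = rho].

(* The geodesics of the quotient are the projections of the geodesics of H2.  *)
Definition lifts (s : R -> H2) (sigma : R -> surface) : Prop :=
  geodesic s /\ sigma = \pi_surface \o s.

Definition surface_geodesic (sigma : R -> surface) : Prop :=
  exists s, lifts s sigma.

(* An orientation of the normal bundle of s is given by a nowhere vanishing   *)
(* continuous normal field along s.                                           *)
Definition normal_field (s : R -> H2) (nu : R -> R[i]) : Prop :=
  [/\ continuous (fun t => Re (nu t)), continuous (fun t => Im (nu t)),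
      forall t, nu t != 0 & forall t, riem (s t) (nu t) (velocity s t) = 0].

(* n is the outward unit normal at w of a circle of radius rho centred at a   *)
(* point of the orbit c: the final velocity of the radius ending at w.        *)
Definition outward_normal (c : surface) (rho : R) (w : H2) (n : R[i]) : Prop :=
  exists g : R -> H2,
    [/\ geodesic g, sval c (g 0), g rho = w & n = velocity g rho].

(* One-sided tangency of sigma with the boundary of the closed disk of centre *)
(* c and radius rho, expressed on a lift of sigma.                            *)
Definition one_sided_tangency (c : surface) (rho : R) (sigma : R -> surface) :
    Prop :=
  exists s nu, [/\ lifts s sigma, normal_field s nu &
    forall t, disk_boundary c rho (sigma t) ->
      exists n, [/\ outward_normal c rho (s t) n,
        riem (s t) n (velocity s t) = 0 & 0 < riem (s t) n (nu t)]].

End HyperbolicPlane.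

Section Delone.
Variable R : realType.
Local Open Scope relation_scope.

Definition delone (e d : R) (S : set R) : Prop :=
  [/\ 0 < e, 0 < d,
      forall t, exists2 s, S s & `|t - s| <= e
    & forall s s', S s -> S s' -> s <> s' -> d <= `|s - s'|].

Definition is_delone (S : set R) : Prop := exists e d, delone e d S.

Definition translate (v : R) (S : set R) : set R := [set s - v | s in S].

Definition Del (e d : R) : Type := {S : set R | delone e d S}.

Section Topology.
Variables e d : R.

HB.instance Definition _ := gen_eqMixin (Del e d).
HB.instance Definition _ := gen_choiceMixin (Del e d).

Definition msum (S U : set R) : set R := [set s + u | s in S & u in U].

Definition rubber (U U' : set R) : set (Del e d * Del e d) :=
  [set SS | sval SS.1 `&` U `<=` msum (sval SS.2) U' /\
            sval SS.2 `&` U `<=` msum (sval SS.1) U'].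

Definition rubber_base : set (set R * set R) :=
  [set UU | [/\ open UU.1, UU.1 0, precompact UU.1, open UU.2 & UU.2 0]].

(* The uniformity with base the sets [rubber U U'] (local rubber topology).   *)
Definition rubber_ent : set_system (Del e d * Del e d) :=
  filter_from rubber_base (fun UU => rubber UU.1 UU.2).

Lemma precompact_ball (r : R) : precompact (ball (0 : R) r).
Proof.
apply: (@precompact_subset _ _ `[- r, r]%classic).
  by move=> t; rewrite /ball /= sub0r normrN in_itv /= -ler_norml => /ltW.
rewrite precompact_closed; [exact: segment_compact|exact: itv_closed].
Qed.

Lemma rubber_base_ball (r r' : R) :
  0 < r -> 0 < r' -> rubber_base (ball (0 : R) r, ball (0 : R) r').
Proof.
move=> r0 r'0; split=> /=; try exact: ball_open; try exact: ballxx.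
exact: precompact_ball.
Qed.

Lemma rubberS (U U' V V' : set R) :
  U `<=` V -> V' `<=` U' -> rubber V V' `<=` rubber U U'.
Proof.
move=> UV VU' [S S'] [/= SS' S'S]; split=> t [St Ut] /=.
- have [|s S's [u /VU' U'u <-]] := SS' t; first by split=> //; exact: UV.
  by exists s => //; exists u.
- have [|s S's [u /VU' U'u <-]] := S'S t; first by split=> //; exact: UV.
  by exists s => //; exists u.
Qed.

Lemma rubber_filter : Filter rubber_ent.
Proof.
apply: filter_from_filter.
  by exists (ball 0 1, ball 0 1); exact: rubber_base_ball.
move=> [U U'] [V V'] [/= oU U0 cU oU' U'0] [/= oV V0 cV oV' V'0].
exists (U `|` V, U' `&` V').
  split=> //=; [exact: openU|by left| |exact: openI].
  by rewrite precompactE closureU; apply: compactU; rewrite -precompactE.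
by move=> SS' h; split; move: SS' h; apply: rubberS => t; [left|case|right|case].
Qed.

Lemma rubber_refl A : rubber_ent A -> diagonal `<=` A.
Proof.
case=> -[U U'] [/= oU U0 cU oU' U'0] UA [S S'] /= SS'; apply: UA.
have -> : S = S' by [].
by split=> t [St _]; exists t => //; exists 0; rewrite ?addr0.
Qed.

Lemma rubber_inv A : rubber_ent A -> rubber_ent A^-1.
Proof.
case=> UU bUU UA; exists UU => // -[S S'] /= [SS' S'S].
by apply: UA; split.
Qed.

Lemma rubber_split A : rubber_ent A -> exists2 B, rubber_ent B & B \; B `<=` A.
Proof.
case=> -[U U'] [/= oU U0 cU oU' U'0] UA.
have /nbhs_ballP[r /= r0 rU'] : nbhs (0 : R) U' by exact: open_nbhs_nbhs.
have [M [_ MU]] : bounded_set (closure U).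
  by apply: compact_bounded; rewrite -precompactE.
have {}MU t : U t -> `|t| <= `|M| + 1.
  move=> Ut; apply: (MU (`|M| + 1)); last exact: subset_closure.
  by rewrite (le_lt_trans (ler_norm M))// ltrDl.
have r20 : 0 < r / 2 by rewrite divr_gt0.
pose V : set R := ball 0 (`|M| + 1 + r / 2); pose V' : set R := ball 0 (r / 2).
have step (S1 S2 S3 : set R) : S1 `&` V `<=` msum S2 V' ->
    S2 `&` V `<=` msum S3 V' -> S1 `&` U `<=` msum S3 U'.
  move=> S12 S23 t [S1t Ut].
  have [|s S2s [u]] := S12 t.
    split=> //; rewrite /V /ball /= sub0r normrN.
    by rewrite (le_lt_trans (MU t Ut))// ltrDl.
  rewrite /V' /ball /= sub0r normrN => ur tE.
  have [|s' S3s' [u']] := S23 s.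
    split=> //; rewrite /V /ball /= sub0r normrN.
    have -> : s = t - u by rewrite -tE addrK.
    by rewrite (le_lt_trans (ler_normB _ _))// ler_ltD// MU.
  rewrite /V' /ball /= sub0r normrN => u'r sE.
  exists s' => //; exists (u' + u); last by rewrite addrA sE.
  apply: rU'; rewrite /ball /= sub0r normrN (le_lt_trans (ler_normD _ _))//.
  by rewrite [ltRHS]splitr ltrD.
exists (rubber V V').
  exists (V, V') => //; apply: rubber_base_ball => //.
  by rewrite addr_gt0// ltr_wpDl.
move=> [S1 S3] [S2 [/= S12 S21] [/= S23 S32]]; apply: UA; split=> /=.
- exact: (step _ _ _ S12 S23).
- exact: (step _ _ _ S32 S21).
Qed.

HB.instance Definition _ := isUniform.Build (Del e d)
  rubber_filter rubber_refl rubber_inv rubber_split.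

Lemma translate_delone (v : R) (S : Del e d) :
  delone e d (translate v (sval S)).
Proof.
case: S => S [/= e0 d0 Se Sd]; split=> // [t|_ _ [s Ss <-] [s' Ss' <-] ss'].
  by have [s Ss ts] := Se (t + v); exists (s - v); [exists s|rewrite opprB addrA].
have -> : s - v - (s' - v) = s - s' by ring.
by apply: Sd => // ss; apply: ss'; rewrite ss.
Qed.

Definition Del_act (v : R) (S : Del e d) : Del e d :=
  exist _ _ (translate_delone v S).

Definition Del_orbit (S : Del e d) : set (Del e d) := range (Del_act^~ S).

Definition periodic (S : Del e d) : Prop := compact (Del_orbit S).

Definition almost_chaotic (S : Del e d) : Prop :=
  closure (Del_orbit S) `<=`
  closure (\bigcup_(T in [set T | periodic T /\
             Del_orbit T `<=` closure (Del_orbit S)]) Del_orbit T).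

Definition aperiodic (S : Del e d) : Prop :=
  forall v, v != 0 -> Del_act v S <> S.

Definition chaotic (S : Del e d) : Prop := almost_chaotic S /\ aperiodic S.

End Topology.
End Delone.

(* Main.v *)
Require Import Defs.
From mathcomp Require Import all_boot all_order all_algebra.
From mathcomp Require Import all_classical all_reals all_analysis.
From mathcomp Require Import ring lra.
From mathcomp.real_closed Require Import complex.

Set Implicit Arguments.
Unset Strict Implicit.
Unset Printing Implicit Defensive.

Import Order.TTheory GRing.Theory Num.Theory.
Import numFieldNormedType.Exports.

Local Open Scope classical_set_scope.
Local Open Scope ring_scope.
Local Open Scope quotient_scope.
Local Open Scope complex_scope.

(** A matrix u of SL(2;R) is used as a chart of the geodesic u^-1 (i e^t): a point y
    has in it the coordinates T = [Tc u y], the time at which it projects to the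
    geodesic, and W = [Wc u y], the hyperbolic sine of its signed distance to it. With
    K = sinh rho, the set of the chart u consists of the T of the points of the
    orbit with |W| < K. The lattice acts on charts on the right, the geodesic flow on
    the left; both change the set of a chart at most by a translation. By hypothesis
    the charts obtained in this way from the chart of the given geodesic are dense in
    SL(2;R) ([orbit_dense]), and by cocompactness any chart is moved by the lattice to
    a fixed compact set. The whole argument takes place with these charts.

    Suppose that the set is Delone. Relative density passes to limits, so every
    geodesic meets a disk within a bounded time ([delone_meets]). If a geodesic touched
    on one and the same side all the disks that it meets, a parabolic motion, which
    changes all the W in the same direction, would push it off all of them
    ([delone_not_one_sided]). If two points of the orbit were at distance at most
    2 rho, geodesics close to the perpendicular bisector of their segment would see
    them at distinct but arbitrarily close times ([delone_separated]).

    Conversely, condition (A) separates the projections ([strip_separated]). If they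
    were not relatively dense, the longer and longer gaps would accumulate to
    geodesics that enter no open disk. A minimal closed family of these contains one, h,
    that is forward recurrent ([recurrent_limit_gap]). It touches disks on both sides, at
    arbitrarily large times: if the contacts on one side stopped, some limit of
    translates of h would have contacts on the other side only, in contradiction
    with (B) ([recurrent_touches]). So h touches three disks on alternate sides.
    During a long gap the given geodesic comes very close to h and passes these
    disks on the same sides, without entering them. The signed distance of two
    geodesics has the form A e^t + B e^-t, and this forces the two geodesics to
    coincide ([three_point]); then the given geodesic touches a disk, which is
    excluded by hypothesis.

    Suppose again that the set is Delone. A period would be the difference of the
    projections of two fixed points on all geodesics of an open set, which parabolic
    motions exclude ([strip_aperiodic]). For the density of periodic orbits, two
    visits of the dense geodesic to a small open set of charts differ by a long
    translation and a matrix close to 1, so there is a closed geodesic nearby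
    ([closing_matrix], [periodic_near]). Its set approximates the given one, but as it
    may touch disks, it need not be in the closure of the orbit. This is cured by adding
    the contacts of one side, that is by the condition - K < W <= K: a small parabolic
    motion turns these contacts into transverse intersections and undoes the
    others, and a geodesic without contacts is approximated, with its set, by the
    dense one ([half_limit], [strip_chaotic]). *)

(** * Hyperbolic functions and coordinates of the half-plane *)

Section Hyp.
Context {R : realType}.
Implicit Types (z w p y : H2 R) (g u : SL2 R) (t s r : R).

Definition ch t : R := (expR t + expR (- t)) / 2.
Definition sh t : R := (expR t - expR (- t)) / 2.

Lemma expRNK t : expR t * expR (- t) = 1.
Proof. by rewrite -expRD subrr expR0. Qed.

Lemma ch_sh t : ch t ^+ 2 = 1 + sh t ^+ 2.
Proof.
apply/eqP; rewrite -subr_eq0; have := expRNK t; rewrite /ch /sh => h.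
rewrite [X in X == 0](_ : _ = expR t * expR (- t) - 1); last by field.
by rewrite h subrr.
Qed.

Lemma chN t : ch (- t) = ch t.
Proof. by rewrite /ch opprK addrC. Qed.

Lemma shN t : sh (- t) = - sh t.
Proof. by rewrite /sh opprK; field. Qed.

Lemma ch0 : ch 0 = 1.
Proof. by rewrite /ch oppr0 expR0; field. Qed.

Lemma sh0 : sh 0 = 0.
Proof. by rewrite /sh oppr0 expR0; field. Qed.

Lemma sh_lt : {mono sh : s t / s < t}.
Proof.
apply: leW_mono; apply: le_mono => s t st; rewrite /sh.
have h1 : expR s < expR t by rewrite ltr_expR.
have h2 : expR (- t) < expR (- s) by rewrite ltr_expR ltrN2.
lra.
Qed.

Lemma sh_inj : injective sh.
Proof.
move=> s t e; apply/eqP.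
by rewrite eq_le !leNgt -[s < t]sh_lt -[t < s]sh_lt e ltxx.
Qed.

Lemma sh_gt0 t : (0 < sh t) = (0 < t).
Proof. by rewrite -[in LHS]sh0 sh_lt. Qed.

Lemma ch_gt0 t : 0 < ch t.
Proof. by rewrite /ch divr_gt0 // addr_gt0 // expR_gt0. Qed.

Lemma ch_ge1 t : 1 <= ch t.
Proof.
have := ch_gt0 t; have := ch_sh t; have := sqr_ge0 (sh t); nra.
Qed.

Lemma chD s t : ch (s + t) = ch s * ch t + sh s * sh t.
Proof. by rewrite /ch /sh opprD !expRD; field. Qed.

Lemma ch_norm t : ch `|t| = ch t.
Proof. by case: (ger0P t) => // _; rewrite chN. Qed.

Lemma ch_lt_norm s t : (ch s < ch t) = (`|s| < `|t|).
Proof.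
rewrite -(ch_norm s) -(ch_norm t).
have := normr_ge0 s; have := normr_ge0 t; move: `|s| `|t| => {}s {}t t0 s0.
have h r r' : 0 <= r -> r < r' -> ch r < ch r'.
  move=> r0 rr'; have r1 : 0 <= sh r by rewrite leNgt -[X in _ < X]sh0 sh_lt -leNgt.
  have r2 : sh r < sh r' by rewrite sh_lt.
  have := ch_sh r; have := ch_sh r'.
  have := ch_gt0 r; have := ch_gt0 r'; nra.
case: (ltrgtP s t) => st; first by rewrite h.
- by apply/negbTE; rewrite -leNgt ltW // h.
- by rewrite st ltxx.
Qed.

Lemma ch_lt s t : 0 <= s -> 0 <= t -> (ch s < ch t) = (s < t).
Proof. by move=> s0 t0; rewrite ch_lt_norm !ger0_norm. Qed.

Lemma ch_le s t : 0 <= s -> 0 <= t -> (ch s <= ch t) = (s <= t).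
Proof. by move=> s0 t0; rewrite !leNgt ch_lt. Qed.

Lemma ch_inj s t : 0 <= s -> 0 <= t -> ch s = ch t -> s = t.
Proof. by move=> s0 t0 e; apply/le_anti; rewrite -(ch_le s0 t0) -(ch_le t0 s0) e lexx. Qed.

Lemma arcoshK x : 1 <= x -> ch (arcosh x) = x /\ 0 <= arcosh x.
Proof.
move=> x1; rewrite /arcosh; set r := Num.sqrt _.
have r0 : 0 <= r by exact: sqrtr_ge0.
have r2 : r ^+ 2 = x ^+ 2 - 1 by rewrite sqr_sqrtr //; nra.
split; last by rewrite ln_ge0 //; lra.
have p : 0 < x + r by lra.
rewrite /ch expRN lnK ?posrE //.
have -> : (x + r)^-1 = x - r.
  by apply: (mulfI (lt0r_neq0 p)); rewrite mulfV ?gt_eqF //; nra.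
by field.
Qed.

Definition hx z : R := complex.Re (h2_val z).
Definition hy z : R := complex.Im (h2_val z).
Definition hn z : R := hx z ^+ 2 + hy z ^+ 2.

Lemma hy_gt0 z : 0 < hy z. Proof. exact: h2_gt0. Qed.

Lemma hn_gt0 z : 0 < hn z.
Proof. by rewrite /hn ltr_wpDl ?sqr_ge0 // exprn_gt0 // hy_gt0. Qed.

Lemma h2_eq z w : hx z = hx w -> hy z = hy w -> z = w.
Proof.
case: z w => -[a b] hz [[c d] hw]; rewrite /hx /hy /= => e1 e2.
by apply: val_inj; rewrite /= e1 e2.
Qed.

Lemma h2_of_subproof (a b : R) : 0 < b -> 0 < complex.Im (a +i* b).
Proof. by []. Qed.

Definition h2_of (a b : R) (b0 : 0 < b) : H2 R := MkH2 (h2_of_subproof a b0).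

Lemma hx_of a b b0 : hx (@h2_of a b b0) = a. Proof. by []. Qed.
Lemma hy_of a b b0 : hy (@h2_of a b b0) = b. Proof. by []. Qed.

(** The argument of [arcosh] in [hdist], hence the hyperbolic cosine of the
    distance: a rational function of the coordinates. *)
Definition hcosh z w : R :=
  1 + ((hx z - hx w) ^+ 2 + (hy z - hy w) ^+ 2) / (2 * hy z * hy w).

Lemma hcosh_ge1 z w : 1 <= hcosh z w.
Proof.
rewrite /hcosh lerDl divr_ge0 ?addr_ge0 ?sqr_ge0 //.
by rewrite !mulr_ge0 // ltW // hy_gt0.
Qed.

Lemma hcoshE z w :
  hcosh z w = (hn z + hn w - 2 * hx z * hx w) / (2 * hy z * hy w).
Proof.
by rewrite /hcosh /hn; field; rewrite !gt_eqF ?hy_gt0.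
Qed.

Lemma hcoshC z w : hcosh z w = hcosh w z.
Proof. by rewrite !hcoshE [hn z + _]addrC; congr (_ / _); ring. Qed.

Lemma hdistE z w : hdist z w = arcosh (hcosh z w).
Proof. by []. Qed.

Lemma hdist_ge0 z w : 0 <= hdist z w.
Proof. by rewrite hdistE; case: (arcoshK (hcosh_ge1 z w)). Qed.

Lemma ch_hdist z w : ch (hdist z w) = hcosh z w.
Proof. by rewrite hdistE; case: (arcoshK (hcosh_ge1 z w)). Qed.

Lemma hdistC z w : hdist z w = hdist w z.
Proof. by rewrite !hdistE hcoshC. Qed.

Lemma hdist_le z w r : 0 <= r -> (hdist z w <= r) = (hcosh z w <= ch r).
Proof. by move=> r0; rewrite -ch_hdist ch_le ?hdist_ge0. Qed.

Lemma hdist_lt z w r : 0 <= r -> (hdist z w < r) = (hcosh z w < ch r).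
Proof. by move=> r0; rewrite -ch_hdist ch_lt ?hdist_ge0. Qed.

Lemma hdist_eq z w r : 0 <= r -> hcosh z w = ch r -> hdist z w = r.
Proof. by move=> r0; rewrite -ch_hdist => /ch_inj; apply=> //; exact: hdist_ge0. Qed.

Lemma hcosh_eq1 z w : hcosh z w = 1 -> z = w.
Proof.
rewrite /hcosh => /eqP; rewrite -subr_eq0 addrC addKr mulf_eq0 invr_eq0.
have : 0 < 2 * hy z * hy w by rewrite !mulr_gt0 ?hy_gt0.
move=> /lt0r_neq0/negbTE ->; rewrite orbF paddr_eq0 ?sqr_ge0 // !sqrf_eq0.
by rewrite !subr_eq0 => /andP[/eqP ? /eqP ?]; exact: h2_eq.
Qed.

(** The coordinates of a point with respect to the geodesic from 0 to oo:
    [T] is the arc-length parameter of its projection, [W] is the hyperbolic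
    sine of its signed distance. *)
Definition W z : R := hx z / hy z.
Definition T z : R := ln (hn z) / 2.

Definition axis t : H2 R := h2_of 0 (expR_gt0 t).

Lemma expT z : expR (T z) ^+ 2 = hn z.
Proof.
rewrite /T expr2 -expRD (_ : _ + _ = ln (hn z)); last by field.
by rewrite lnK // posrE hn_gt0.
Qed.

Lemma hn_axis t : hn (axis t) = expR t ^+ 2.
Proof. by rewrite /hn /hx /hy /= expr0n add0r. Qed.

Lemma T_axis t : T (axis t) = t.
Proof.
by rewrite /T hn_axis lnXn ?expR_gt0 // expRK -mulr_natl; field.
Qed.

Lemma T_eq z t : hn z = expR t ^+ 2 -> T z = t.
Proof. by move=> e; rewrite -[RHS]T_axis /T hn_axis e. Qed.

(** The hyperbolic cosine of the distance to the axis. *)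
Definition cw z : R := expR (T z) / hy z.

Lemma cw_gt0 z : 0 < cw z.
Proof. by rewrite /cw divr_gt0 ?expR_gt0 ?hy_gt0. Qed.

Lemma cwE z : cw z ^+ 2 = 1 + W z ^+ 2.
Proof.
rewrite /cw expr_div_n expT /hn /W; field; exact: lt0r_neq0 (hy_gt0 z).
Qed.

(** The point (cw ch T, cw sh T, W) lies on the hyperboloid, since
    cw ^ 2 = 1 + W ^ 2, and the formula is its Lorentz form. *)
Lemma hcosh_chart z w :
  hcosh z w = cw z * cw w * ch (T z - T w) - W z * W w.
Proof.
rewrite hcoshE -!expT /cw /W /ch opprB !expRD !expRN.
field; rewrite !gt_eqF ?hy_gt0 ?expR_gt0 //.
Qed.

Lemma cw_axis t : cw (axis t) = 1.
Proof. by rewrite /cw T_axis divff // gt_eqF ?expR_gt0. Qed.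

Lemma W_axis t : W (axis t) = 0.
Proof. by rewrite /W /hx /= mul0r. Qed.

Lemma hcosh_axis t z : hcosh (axis t) z = cw z * ch (t - T z).
Proof. by rewrite hcosh_chart cw_axis W_axis T_axis mul1r mul0r subr0. Qed.

Lemma chart_inj z w : T z = T w -> W z = W w -> z = w.
Proof.
move=> eT eW; apply: hcosh_eq1; rewrite hcosh_chart eT eW subrr ch0 mulr1.
have -> : cw z = cw w.
  apply/eqP; rewrite -(eqrXn2 (n := 2)) // ?ltW ?cw_gt0 //.
  by rewrite !cwE eW.
by rewrite -[_ * cw w]expr2 cwE; ring.
Qed.

Lemma cw_lt z r : (cw z < ch r) = (`|W z| < `|sh r|).
Proof.
rewrite -[RHS]ltr_sqr ?nnegrE ?normr_ge0 // !real_normK ?num_real //.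
have c1 := ltW (cw_gt0 z); have c2 := ltW (ch_gt0 r).
by rewrite -[LHS]ltr_sqr ?nnegrE // cwE ch_sh ltrD2l.
Qed.

Lemma cw_le z r : (cw z <= ch r) = (`|W z| <= `|sh r|).
Proof.
rewrite -[RHS]ler_sqr ?nnegrE ?normr_ge0 // !real_normK ?num_real //.
have c1 := ltW (cw_gt0 z); have c2 := ltW (ch_gt0 r).
by rewrite -[LHS]ler_sqr ?nnegrE // cwE ch_sh lerD2l.
Qed.

End Hyp.

(** * Homographies *)

Section Moeb.
Context {R : realType}.
Implicit Types (z w y : H2 R) (g u : SL2 R) (t s r : R).

Lemma I2_cases (k : 'I_2) : k = 0 \/ k = 1.
Proof. by case: k => -[|[|//]] ?; [left|right]; apply: val_inj. Qed.

Lemma sl_eq g u : g 0 0 = u 0 0 -> g 0 1 = u 0 1 -> g 1 0 = u 1 0 ->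
  g 1 1 = u 1 1 -> g = u.
Proof.
move=> h1 h2 h3 h4; apply: val_inj; apply/matrixP => i j.
by case: (I2_cases i) => ->; case: (I2_cases j) => ->.
Qed.

Definition mx2 (a b c d : R) : 'M[R]_2 :=
  \matrix_(i, j) if i == 0 then if j == 0 then a else b
                 else if j == 0 then c else d.

Lemma det_mx2 (a b c d : R) : a * d - b * c = 1 -> \det (mx2 a b c d) == 1.
Proof.
move=> h; rewrite (expand_det_row _ 0) !big_ord_recl big_ord0 addr0.
rewrite /cofactor !det_mx11 !mxE /= expr0 expr1 mul1r mulN1r mulrN.
by rewrite h.
Qed.

Definition sl2 a b c d (h : a * d - b * c = 1) : SL2 R := MkSL2 (det_mx2 h).

Lemma sl2E a b c d h : let g := @sl2 a b c d h in
  [/\ g 0 0 = a, g 0 1 = b, g 1 0 = c & g 1 1 = d].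
Proof. by split; rewrite /= mxE. Qed.

Lemma sl2_00 a b c d h : @sl2 a b c d h 0 0 = a. Proof. by case: (sl2E h). Qed.
Lemma sl2_01 a b c d h : @sl2 a b c d h 0 1 = b. Proof. by case: (sl2E h). Qed.
Lemma sl2_10 a b c d h : @sl2 a b c d h 1 0 = c. Proof. by case: (sl2E h). Qed.
Lemma sl2_11 a b c d h : @sl2 a b c d h 1 1 = d. Proof. by case: (sl2E h). Qed.
Arguments sl2 : simpl never.
Definition sl2C := (sl2_00, sl2_01, sl2_10, sl2_11).

Lemma sl_invE g : [/\ (g^-1)%g 0 0 = g 1 1, (g^-1)%g 0 1 = - g 0 1,
  (g^-1)%g 1 0 = - g 1 0 & (g^-1)%g 1 1 = g 0 0].
Proof.
have h : g 1 1 * g 0 0 - (- g 0 1) * (- g 1 0) = 1.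
  by rewrite mulrNN mulrC sl_det.
have -> : (g^-1)%g = sl2 h; last by rewrite !sl2C.
rewrite -[LHS]mulg1; apply: canLR (mulKg _) _.
by apply: sl_eq; rewrite sl_mulE !sl2C !mxE /= -?(sl_det g); ring.
Qed.

(** The squared moduli of the denominator and of the numerator of the
    homography. *)
Definition bot g z : R := (g 1 0 * hx z + g 1 1) ^+ 2 + (g 1 0 * hy z) ^+ 2.
Definition top g z : R := (g 0 0 * hx z + g 0 1) ^+ 2 + (g 0 0 * hy z) ^+ 2.

Lemma bot_gt0 g z : 0 < bot g z. Proof. exact: moebius_normd_gt0. Qed.

Lemma hy_moebius g z : hy (moebius g z) = hy z / bot g z.
Proof. exact: Im_moebius. Qed.

Lemma hx_moebius g z : hx (moebius g z) =
  (g 0 0 * g 1 0 * hn z + (g 0 0 * g 1 1 + g 0 1 * g 1 0) * hx z +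
   g 0 1 * g 1 1) / bot g z.
Proof.
have := bot_gt0 g z; rewrite /hn; case: z => -[x y] /= y0.
rewrite /hx /hy /bot /= /moebius_num /moebius_den /=; rewrite /hx /hy /=; simpc => N0 /=.
by field; rewrite gt_eqF.
Qed.

Lemma hn_moebius g z : hn (moebius g z) = top g z / bot g z.
Proof.
rewrite {1}/hn hx_moebius hy_moebius.
have N0 := bot_gt0 g z.
apply: (mulIf (lt0r_neq0 N0)); apply: (mulIf (lt0r_neq0 N0)).
rewrite mulfVK ?lt0r_neq0 //.
have -> (a b d : R) : 0 < d ->
    ((a / d) ^+ 2 + (b / d) ^+ 2) * d * d = a ^+ 2 + b ^+ 2.
  by move=> d0; field; rewrite gt_eqF.
  2: by [].
rewrite /top /bot /hn; move: (sl_det g) {N0}.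
move: (g 0 0) (g 0 1) (g 1 0) (g 1 1) (hx z) (hy z) => a b c d x y D.
rewrite -[X in _ + X = _]mulr1 -[X in _ + _ * X = _](expr1n _ 2) -D; ring.
Qed.

Lemma top_gt0 g z : 0 < top g z.
Proof.
have := hn_gt0 (moebius g z); rewrite hn_moebius pmulr_lgt0 //.
by rewrite invr_gt0 bot_gt0.
Qed.

Lemma W_moebius g z : W (moebius g z) =
  (g 0 0 * g 1 0 * hn z + (g 0 0 * g 1 1 + g 0 1 * g 1 0) * hx z +
   g 0 1 * g 1 1) / hy z.
Proof.
rewrite /W hx_moebius hy_moebius; field.
by rewrite !gt_eqF ?bot_gt0 ?hy_gt0.
Qed.

Lemma hcosh_moebius g z w : hcosh (moebius g z) (moebius g w) = hcosh z w.
Proof.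
rewrite !hcoshE !hn_moebius !hx_moebius !hy_moebius.
have := bot_gt0 g z; have := bot_gt0 g w; have := hy_gt0 z; have := hy_gt0 w.
move=> hw hz bw bz.
set n1 := (X in X * _ = _); set n2 := (X in _ = X * _).
have -> : n1 = n2 / (bot g z * bot g w); last first.
  by field; rewrite !gt_eqF.
rewrite {}/n1 {}/n2.
apply: (mulIf (lt0r_neq0 bz)); apply: (mulIf (lt0r_neq0 bw)).
rewrite [RHS](_ : _ = hn z + hn w - 2 * hx z * hx w); last first.
  by field; rewrite !gt_eqF.
rewrite [LHS](_ : _ = top g z * bot g w + top g w * bot g z -
  2 * (g 0 0 * g 1 0 * hn z + (g 0 0 * g 1 1 + g 0 1 * g 1 0) * hx z +
   g 0 1 * g 1 1) * (g 0 0 * g 1 0 * hn w + (g 0 0 * g 1 1 + g 0 1 * g 1 0) * hx w +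
   g 0 1 * g 1 1)); last by field; rewrite !gt_eqF.
rewrite /top /bot /hn; have D := sl_det g; move: D.
move: (g 0 0) (g 0 1) (g 1 0) (g 1 1) (hx z) (hy z) (hx w) (hy w) => a b c d x1 y1 x2 y2 D.
transitivity ((a * d - b * c) ^+ 2 *
  (x1 ^+ 2 + y1 ^+ 2 + (x2 ^+ 2 + y2 ^+ 2) - 2 * x1 * x2)); first by ring.
by rewrite D expr1n mul1r.
Qed.

Lemma hdist_moebius g z w : hdist (moebius g z) (moebius g w) = hdist z w.
Proof. by rewrite !hdistE hcosh_moebius. Qed.

Lemma moebiusK g : cancel (moebius g) (moebius g^-1%g).
Proof. by move=> z; rewrite -moebiusM mulVg moebius1. Qed.

Lemma moebiusVK g : cancel (moebius g^-1%g) (moebius g).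
Proof. by move=> z; rewrite -moebiusM mulgV moebius1. Qed.

(** As left factors of a chart: [flow t] adds t to the coordinate [T]; [parab b]
    adds to the coordinate [W] of every point a quantity of the sign of b, so
    that it pushes a geodesic off all the disks that touch it on one side. *)
Lemma flow_subproof t : expR (t / 2) * expR (- (t / 2)) - 0 * 0 = 1 :> R.
Proof. by rewrite expRNK mulr0 subr0. Qed.
Definition flow t : SL2 R := sl2 (flow_subproof t).

Lemma rot_subproof (p q : R) : p ^+ 2 + q ^+ 2 = 1 -> p * p - q * (- q) = 1.
Proof. by move=> <-; ring. Qed.
Definition rotation p q (h : p ^+ 2 + q ^+ 2 = 1) : SL2 R := sl2 (rot_subproof h).

Lemma parab_subproof (b : R) : 1 * 1 - b * 0 = 1 :> R.
Proof. by ring. Qed.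
Definition parab b : SL2 R := sl2 (parab_subproof b).

Arguments flow : simpl never.
Arguments rotation : simpl never.
Arguments parab : simpl never.

Lemma expR2_half t : expR (t / 2) * expR (t / 2) = expR t.
Proof. by rewrite -expRD; congr expR; field. Qed.

Lemma hx_flow t z : hx (moebius (flow t) z) = expR t * hx z.
Proof.
rewrite hx_moebius /bot !sl2C -(expR2_half t) expRN; field.
by rewrite gt_eqF ?expR_gt0.
Qed.

Lemma hy_flow t z : hy (moebius (flow t) z) = expR t * hy z.
Proof.
rewrite hy_moebius /bot !sl2C -(expR2_half t) expRN; field.
by rewrite gt_eqF ?expR_gt0.
Qed.

Lemma T_flow t z : T (moebius (flow t) z) = T z + t.
Proof.
apply: T_eq; rewrite expRD exprMn expT /hn hx_flow hy_flow.
by move: (hx z) (hy z) => a b; ring.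
Qed.

Lemma W_flow t z : W (moebius (flow t) z) = W z.
Proof.
by rewrite /W hx_flow hy_flow; field; rewrite !gt_eqF ?expR_gt0 ?hy_gt0.
Qed.

Lemma flow_axis t s : moebius (flow t) (axis s) = axis (s + t).
Proof. by apply: chart_inj; rewrite ?T_flow ?W_flow ?T_axis ?W_axis. Qed.

Lemma flowD s t : (flow s * flow t)%g = flow (s + t).
Proof.
apply: sl_eq; rewrite sl_mulE !sl2C ?(mul0r, mulr0, addr0, add0r) // -expRD;
  by congr expR; field.
Qed.

Lemma flow0 : flow 0 = 1%g :> SL2 R.
Proof.
by apply: sl_eq; rewrite !sl2C !mxE //= mul0r ?oppr0 expR0.
Qed.

Lemma hx_parab b z : hx (moebius (parab b) z) = hx z + b.
Proof. rewrite hx_moebius /bot !sl2C; by field. Qed.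

Lemma hy_parab b z : hy (moebius (parab b) z) = hy z.
Proof. rewrite hy_moebius /bot !sl2C; by field. Qed.

Lemma W_parab b z : W (moebius (parab b) z) = W z + b / hy z.
Proof. by rewrite /W hx_parab hy_parab mulrDl. Qed.

Lemma half_angle (C S : R) : C ^+ 2 + S ^+ 2 = 1 ->
  exists p q, [/\ p ^+ 2 + q ^+ 2 = 1, p ^+ 2 - q ^+ 2 = C & 2 * p * q = S].
Proof.
move=> h; have [eC|C1] := eqVneq C (-1).
  have /eqP : S ^+ 2 = 0 by move: h; rewrite eC; lra.
  by rewrite sqrf_eq0 => /eqP ->; exists 0, 1; rewrite eC; split; ring.
have C2 : 0 < 1 + C.
  rewrite lt_neqAle eq_sym addrC addr_eq0 C1 /=.
  by have := sqr_ge0 S; nra.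
have pe : Num.sqrt ((1 + C) / 2) ^+ 2 = (1 + C) / 2 by rewrite sqr_sqrtr //; lra.
have p0 : 0 < Num.sqrt ((1 + C) / 2) by rewrite sqrtr_gt0; lra.
move: (Num.sqrt _) pe p0 => p pe p0.
have qe : (S / (2 * p)) ^+ 2 = (1 - C) / 2.
  rewrite expr_div_n exprMn pe.
  have -> : S ^+ 2 = (1 - C) * (1 + C) by nra.
  by field; rewrite gt_eqF.
exists p, (S / (2 * p)); split; rewrite ?qe ?pe; [by field|by field|].
by field; rewrite gt_eqF.
Qed.

Lemma rot_axis0 p q (h : p ^+ 2 + q ^+ 2 = 1) : moebius (rotation h) (axis 0) = axis 0.
Proof.
have e : (- q * 0 + p) ^+ 2 + (- q * 1) ^+ 2 = 1 by rewrite -[RHS]h; ring.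
apply: h2_eq; rewrite ?hx_moebius ?hy_moebius /bot ?hn_axis !sl2C /hx /hy /= expR0 e.
  by field.
by rewrite divr1.
Qed.

(** The matrix of the rotation has half the angle whose cosine and sine are
    proportional to (|z|^2 - 1) / 2 and Re z; D normalises them. *)
Lemma rot_to_axis z : exists g s,
  [/\ 0 <= s, moebius g (axis 0) = axis 0 & moebius g z = axis s].
Proof.
have [->|z1] := eqVneq z (axis 0); first by exists 1%g, 0; rewrite !moebius1.
set N := hn z; set x := hx z.
pose D := Num.sqrt ((N - 1) ^+ 2 / 4 + x ^+ 2).
have D2 : D ^+ 2 = (N - 1) ^+ 2 / 4 + x ^+ 2.
  by rewrite sqr_sqrtr // addr_ge0 ?divr_ge0 ?sqr_ge0.
have D0 : 0 < D.
  rewrite sqrtr_gt0 lt_neqAle eq_sym addr_ge0 ?divr_ge0 ?sqr_ge0 // andbT.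
  rewrite paddr_eq0 ?divr_ge0 ?sqr_ge0 // mulf_eq0 invr_eq0 !sqrf_eq0.
  rewrite pnatr_eq0 orbF subr_eq0; apply: contra z1 => /andP[/eqP eN /eqP ex].
  apply/eqP/h2_eq; first by rewrite -/x ex.
  move: eN; rewrite /N /hn -/x ex expr0n add0r => /eqP.
  by rewrite sqrf_eq1 [RHS]expR0 => /orP[/eqP //|/eqP]; have := hy_gt0 z; lra.
have [|p [q [h hC hS]]] := @half_angle ((N - 1) / 2 / D) (x / D).
  rewrite !expr_div_n -mulrDl D2 [X in X / _](_ : _ = (N - 1) ^+ 2 / 4 + x ^+ 2).
    by rewrite divff // -D2 gt_eqF ?exprn_gt0.
  by field.
have hp : p ^+ 2 = (1 + (N - 1) / 2 / D) / 2 by lra.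
have hq : q ^+ 2 = (1 - (N - 1) / 2 / D) / 2 by lra.
have hpq : p * q = x / D / 2 by lra.
have eb : bot (rotation h) z = (N + 1) / 2 - D.
  rewrite /bot !sl2C -/x.
  rewrite [LHS](_ : _ = q ^+ 2 * N - 2 * (p * q) * x + p ^+ 2); last first.
    by rewrite /N /hn -/x; ring.
  rewrite hp hq hpq.
  rewrite [LHS](_ : _ = (N + 1) / 2 - ((N - 1) ^+ 2 / 4 + x ^+ 2) / D); last first.
    by field; rewrite gt_eqF.
  by rewrite -D2 expr2 mulfK ?gt_eqF.
have yy : hy z ^+ 2 = ((N + 1) / 2 - D) * ((N + 1) / 2 + D).
  rewrite [RHS](_ : _ = ((N + 1) / 2) ^+ 2 - D ^+ 2); last by ring.
  by rewrite D2 /N /hn -/x; field.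
have b0 : 0 < (N + 1) / 2 - D by rewrite -eb bot_gt0.
have y1 : 1 <= hy z / ((N + 1) / 2 - D).
  have y0 := ltW (hy_gt0 z); have b1 := ltW b0.
  rewrite ler_pdivlMr // mul1r -ler_sqr ?nnegrE //.
  rewrite yy expr2 ler_pM2l //; lra.
exists (rotation h), (ln (hy z / ((N + 1) / 2 - D))); split.
- by rewrite ln_ge0.
- exact: rot_axis0.
- apply: h2_eq; rewrite ?hx_moebius ?hy_moebius eb; last first.
    by rewrite /hy /= lnK // posrE; lra.
  rewrite !sl2C -/N -/x [hx _]/= [X in X / _](_ : _ = 0) ?mul0r //.
  rewrite [LHS](_ : _ = (p ^+ 2 - q ^+ 2) * x - p * q * (N - 1)); last by ring.
  rewrite hC hpq; by field; rewrite gt_eqF.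
Qed.

Lemma move_to_axis0 z : exists g, moebius g z = axis 0.
Proof.
exists (flow (- ln (hy z)) * parab (- hx z))%g.
rewrite moebiusM; apply: h2_eq.
  by rewrite hx_flow hx_parab addrN mulr0.
by rewrite hy_flow hy_parab expRN lnK ?posrE ?hy_gt0 // mulVf ?gt_eqF ?hy_gt0 // /hy /= expR0.
Qed.

Lemma two_point_chart z w : exists g,
  moebius g z = axis 0 /\ moebius g w = axis (hdist z w).
Proof.
have [g gz] := move_to_axis0 z.
have [k [s [s0 k0 ks]]] := rot_to_axis (moebius g w).
exists (k * g)%g; rewrite !moebiusM gz k0; split=> //.
rewrite ks; congr axis; apply: ch_inj => //; first exact: hdist_ge0.
rewrite ch_hdist -(hcosh_moebius g) -(hcosh_moebius k) gz k0 ks.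
by rewrite hcosh_axis cw_axis mul1r T_axis sub0r chN.
Qed.

(** With p moved to i and w to the axis, both sides are given by the addition
    formula, and |cw z * sh (T z)| is at most the hyperbolic sine of the distance
    from z to p. *)
Lemma hdist_triangle (p : H2 R) z w : hdist z w <= hdist z p + hdist p w.
Proof.
have [g [gp gw]] := two_point_chart p w.
move: (hdist p w) (hdist_ge0 p w) gw => s s0 gw.
have r0 := hdist_ge0 z p.
rewrite hdist_le ?addr_ge0 // -(hcosh_moebius g) gw hcoshC hcosh_axis.
have := ch_hdist z p; rewrite -(hcosh_moebius g) gp hcoshC hcosh_axis sub0r chN.
move: (hdist z p) r0 => r r0; move: (moebius g z) => {}z e.
rewrite addrC chD e chD chN shN.
have c1 : 1 <= cw z ^+ 2 by rewrite cwE lerDl sqr_ge0.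
have c0 := cw_gt0 z; have := ch_gt0 s.
have s1 : 0 <= sh s by rewrite leNgt -[X in _ < X]sh0 sh_lt -leNgt.
have r1 : 0 <= sh r by rewrite leNgt -[X in _ < X]sh0 sh_lt -leNgt.
have := ch_sh r; rewrite e => e2; have := ch_sh (T z) => e3 chs.
have : `|cw z * sh (T z)| <= sh r.
  rewrite -ler_sqr ?nnegrE ?normr_ge0 // real_normK ?num_real //.
  by rewrite exprMn; move: e2; rewrite exprMn e3; nra.
rewrite ler_norml => /andP[h _].
have : - (cw z * sh (T z)) * sh s <= sh r * sh s by rewrite ler_wpM2r //; lra.
move: (ch r) (sh r) (sh (T z)) (ch (T z)) (ch s) (sh s) => *; nra.
Qed.

(** An isometric embedding of the line is determined by its values at 0 and 1,
    which can be moved to the axis. *)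
Lemma geodesicP (l : R -> H2 R) : geodesic l <->
  exists g, forall t, l t = moebius g (axis t).
Proof.
split=> [hl|[g lE] s t]; last first.
  rewrite !lE hdist_moebius; apply: hdist_eq => //.
  by rewrite hcosh_axis cw_axis mul1r T_axis ch_norm.
have [g [g0 g1]] := two_point_chart (l 0) (l 1).
move: g1; rewrite hl distrC subr0 normr1 => g1.
exists g^-1%g => t; rewrite -[LHS](moebiusK g); congr moebius.
have := ch_hdist (l 0) (l t); have := ch_hdist (l 1) (l t).
rewrite -(hcosh_moebius g (l 0)) -(hcosh_moebius g (l 1)) !hl g0 g1 !hcosh_axis !ch_norm.
move: (moebius g (l t)) => z; rewrite !sub0r !chN.
have E r : ch (1 - r) = ch 1 * ch r - sh 1 * sh r by rewrite chD chN shN; ring.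
rewrite !E => + e2; rewrite e2 => e1.
have s1 : 0 < sh 1 :> R by rewrite sh_gt0.
have e4 : cw z * sh (T z) = sh t.
  apply: (mulfI (lt0r_neq0 s1)); move: e1; rewrite mulrDr; nra.
have e5 : cw z ^+ 2 = 1.
  by have := ch_sh t; have := ch_sh (T z); rewrite e2 -e4 !exprMn; nra.
have e6 : cw z = 1 by apply/eqP; rewrite -(eqrXn2 (n := 2)) ?expr1n ?e5 // ltW ?cw_gt0.
apply: chart_inj; rewrite ?T_axis ?W_axis.
  by apply: sh_inj; rewrite -e4 e6 mul1r.
by apply/eqP; rewrite -sqrf_eq0; have := cwE z; rewrite e5; lra.
Qed.

End Moeb.

(** * Velocities, frames and orthogonal geodesics *)

Section Vel.
Context {R : realType}.
Implicit Types (z w y : H2 R) (g u h k : SL2 R) (t s r : R).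

Lemma sh_surj (w : R) : exists s, sh s = w.
Proof.
have r0 : 0 <= Num.sqrt (1 + w ^+ 2) by exact: sqrtr_ge0.
have r2 : Num.sqrt (1 + w ^+ 2) ^+ 2 = 1 + w ^+ 2.
  by rewrite sqr_sqrtr // addr_ge0 ?sqr_ge0.
move: (Num.sqrt _) r0 r2 => r r0 r2.
have p : 0 < w + r by have := sqr_ge0 w; nra.
exists (ln (w + r)); rewrite /sh expRN lnK ?posrE //.
have -> : (w + r)^-1 = r - w.
  by apply: (mulfI (lt0r_neq0 p)); rewrite mulfV ?gt_eqF //; nra.
by field.
Qed.

Lemma dmoebius_axisE g t (v : R[i]) : dmoebius g (axis t) v =
  let e := expR t in let c := g 1 0 in let d := g 1 1 in
  let p := d ^+ 2 - (c * e) ^+ 2 in let q := 2 * c * d * e in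
  let D := (c * e) ^+ 2 + d ^+ 2 in
  ((complex.Re v * p + complex.Im v * q) / D ^+ 2) +i*
  ((complex.Im v * p - complex.Re v * q) / D ^+ 2).
Proof.
have := bot_gt0 g (axis t); rewrite /bot hx_of hy_of => /=.
rewrite mulr0 add0r addrC => D0.
case: v => v1 v2; rewrite /dmoebius /moebius_den /= expr2; simpc.
set c := g 1 0 in D0 *; set d := g 1 1 in D0 *; set e := expR t in D0 *.
have E : (d * d - c * e * (c * e)) ^+ 2 + (d * (c * e) + c * e * d) ^+ 2 =
   ((c * e) ^+ 2 + d ^+ 2) ^+ 2 by ring.
rewrite E; congr (_ +i* _); field; by rewrite gt_eqF.
Qed.

Definition vel g t : R[i] := dmoebius g (axis t) (0 +i* expR t).

Lemma derive_quot (P Q : R -> R) (t p q : R) : is_derive t 1 P p -> is_derive t 1 Q q -> Q t != 0 ->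
  is_derive t 1 (fun s => P s / Q s) ((p * Q t - P t * q) / Q t ^+ 2).
Proof.
move=> dP dQ Q0.
apply: (@is_derive_eq _ _ _ (P * (fun s => (Q s)^-1)) t 1 _ _ (is_deriveM dP (is_deriveV Q0 dQ))).
rewrite /GRing.scale /=.  by field.
Qed.

Lemma derive_exp2 (A B t : R) : is_derive t 1 (fun s => A * expR s ^+ 2 + B) (2 * A * expR t ^+ 2).
Proof.
have dE := is_derive_expR t.
rewrite (_ : (fun s => _) = A \*: (expR * expR) + cst B); last first.
  by apply/funext => s; rewrite expr2.
apply: (is_derive_eq (is_deriveD (is_deriveZ A (is_deriveM dE dE)) (is_derive_cst B t 1))).
rewrite /GRing.scale /=. by rewrite addr0; ring.
Qed.

Lemma velocityE g t : velocity (fun s => moebius g (axis s)) t = vel g t.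
Proof.
have D0 s : 0 < g 1 0 ^+ 2 * expR s ^+ 2 + g 1 1 ^+ 2.
  have := bot_gt0 g (axis s); rewrite /bot hx_of hy_of /= mulr0 add0r.
  by rewrite addrC exprMn.
have dQ := derive_exp2 (g 1 0 ^+ 2) (g 1 1 ^+ 2) t.
have Q0 : g 1 0 ^+ 2 * expR t ^+ 2 + g 1 1 ^+ 2 != 0 by rewrite gt_eqF.
have D := sl_det g.
rewrite /velocity /vel dmoebius_axisE /=; congr (_ +i* _).
- rewrite derive1E.
  have -> : (fun s => complex.Re (moebius g (axis s))) =
     (fun s => (g 0 0 * g 1 0 * expR s ^+ 2 + g 0 1 * g 1 1) /
               (g 1 0 ^+ 2 * expR s ^+ 2 + g 1 1 ^+ 2)).
    apply/funext => s; rewrite -[LHS]/(hx _) hx_moebius hn_axis hx_of /bot.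
    by rewrite hx_of hy_of !(mulr0, addr0, add0r) exprMn [X in _ / X = _]addrC.
  have dP := derive_exp2 (g 0 0 * g 1 0) (g 0 1 * g 1 1) t.
  have dPQ := derive_quot dP dQ Q0.
  rewrite (@derive_val _ _ _ _ _ _ _ dPQ) mul0r add0r exprMn; congr (_ / _).
  transitivity (2 * (g 0 0 * g 1 1 - g 0 1 * g 1 0) * g 1 0 * g 1 1 * expR t ^+ 2).
    by ring.
  by rewrite D; ring.
- rewrite derive1E.
  have -> : (fun s => complex.Im (moebius g (axis s))) =
     (fun s => expR s / (g 1 0 ^+ 2 * expR s ^+ 2 + g 1 1 ^+ 2)).
    apply/funext => s; rewrite -[LHS]/(hy _) hy_moebius hy_of /bot.
    by rewrite hx_of hy_of !(mulr0, addr0, add0r) exprMn [X in _ / X = _]addrC.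
  have dPQ := derive_quot (is_derive_expR t) dQ Q0.
  rewrite (@derive_val _ _ _ _ _ _ _ dPQ) mul0r subr0 exprMn; congr (_ / _).
  by ring.
Qed.

Lemma geodesic_frame (l : R -> H2 R) : geodesic l ->
  exists g, [/\ l = (fun t => moebius g (axis t)) & velocity l = vel g].
Proof.
move=> /geodesicP[g lE]; have e : l = (fun t => moebius g (axis t)) by apply/funext.
by exists g; split=> //; apply/funext => t; rewrite e velocityE.
Qed.

Lemma frame_geodesic g : geodesic (fun t => moebius g (axis t)).
Proof. by apply/geodesicP; exists g. Qed.

Lemma dmoebiusM g h z (v : R[i]) :
  dmoebius (g * h)%g z v = dmoebius g (moebius h z) (dmoebius h z v).
Proof. by rewrite /dmoebius moebius_denM exprMn invfM mulrA mulrAC. Qed.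

Lemma moebius_flow g t : moebius (g * flow t)%g (axis 0) = moebius g (axis t).
Proof. by rewrite moebiusM flow_axis add0r. Qed.

Lemma dmoebius_flow t (v : R[i]) :
  dmoebius (flow t) (axis 0) v = (expR t * complex.Re v) +i* (expR t * complex.Im v).
Proof.
rewrite dmoebius_axisE !sl2C /= expR0 mulr1.
have -> : expR (- (t / 2)) ^+ 2 = (expR t)^-1.
  by rewrite expr2 -expRD -expRN; congr expR; field.
by congr (_ +i* _); field; rewrite gt_eqF ?expR_gt0.
Qed.

Lemma velE g t : vel g t = dmoebius (g * flow t)%g (axis 0) (0 +i* 1).
Proof. by rewrite dmoebiusM dmoebius_flow flow_axis add0r /= mulr0 mulr1. Qed.

(** The unit normal of the frame, to the right of the geodesic. *)
Definition nor g t : R[i] := dmoebius (g * flow t)%g (axis 0) (1 +i* 0).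

Lemma norE g t : nor g t = complex.Im (vel g t) +i* (- complex.Re (vel g t)).
Proof.
rewrite /nor velE !dmoebius_axisE /=; congr (_ +i* _); rewrite !(mul0r, mul1r, add0r, addr0, sub0r, subr0) //.
by rewrite mulNr.
Qed.

Lemma riem_i (u v : R[i]) : riem (axis 0) u v =
  complex.Re u * complex.Re v + complex.Im u * complex.Im v.
Proof. by rewrite /riem -[complex.Im (axis 0)]/(hy (axis 0)) hy_of expR0 expr1n divr1. Qed.

Lemma riem_frame g t (u v : R[i]) :
  riem (moebius g (axis t)) (dmoebius (g * flow t)%g (axis 0) u)
     (dmoebius (g * flow t)%g (axis 0) v) = complex.Re u * complex.Re v + complex.Im u * complex.Im v.
Proof.
by rewrite -moebius_flow dmoebius_riem riem_i.
Qed.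

Lemma dmoebius1 z (v : R[i]) : dmoebius 1%g z v = v.
Proof.
rewrite /dmoebius /moebius_den !mxE /=.
by rewrite rmorph0 rmorph1 mul0r add0r expr1n divr1.
Qed.

Lemma frame_vec k z (v : R[i]) : exists v', v = dmoebius k z v'.
Proof.
exists (dmoebius k^-1%g (moebius k z) v).
have := dmoebiusM k k^-1%g (moebius k z) v.
by rewrite moebiusK mulgV dmoebius1.
Qed.

(** The two conditions say that h is a rotation about i, by a right angle in one
    of the two directions. *)
Lemma perp_at_i h : moebius h (axis 0) = axis 0 ->
  riem (axis 0) (vel h 0) (0 +i* 1) = 0 ->
  exists2 sg : R, sg = 1 \/ sg = -1 &
    vel h 0 = sg +i* 0 /\
    forall s, T (moebius h (axis s)) = 0 /\ W (moebius h (axis s)) = sg * sh s.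
Proof.
move=> hi; have D := sl_det h.
have := congr1 hy hi; rewrite hy_moebius /bot !hx_of !hy_of expR0 mulr0 add0r !mulr1.
have := congr1 hx hi; rewrite hx_moebius /bot !hn_axis !hx_of !hy_of expR0 expr1n !mulr0 add0r !mulr1 addr0.
rewrite mul1r => e1 e2; have e3 : h 1 1 ^+ 2 + h 1 0 ^+ 2 = 1 by rewrite -[LHS]invrK e2 invr1.
move: e1; rewrite e3 divr1 => e1.
have -> : vel h 0 = (2 * h 1 0 * h 1 1) +i* (h 1 1 ^+ 2 - h 1 0 ^+ 2).
  rewrite /vel dmoebius_axisE /= expR0 !mulr1 !mul0r !mul1r add0r.
  by rewrite addrC addrC [_ + h 1 1 ^+ 2]addrC e3 expr1n !divr1 subr0.
rewrite /riem /= expR0 expr1n divr1 mulr0 mulr1 add0r => e4.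
have eb : h 0 1 = - h 1 0.
  have : h 0 1 * (h 1 1 ^+ 2 + h 1 0 ^+ 2) =
     (h 0 0 * h 1 0 + h 0 1 * h 1 1) * h 1 1 - (h 0 0 * h 1 1 - h 0 1 * h 1 0) * h 1 0 by ring.
  by rewrite e3 e1 D mulr1 mul0r sub0r mul1r.
have ea : h 0 0 = h 1 1.
  have : h 0 0 * (h 1 1 ^+ 2 + h 1 0 ^+ 2) =
     (h 0 0 * h 1 0 + h 0 1 * h 1 1) * h 1 0 + (h 0 0 * h 1 1 - h 0 1 * h 1 0) * h 1 1 by ring.
  by rewrite e3 e1 D mulr1 mul0r add0r mul1r.
have ec : h 1 0 ^+ 2 = 1 / 2 by lra.
have ed : h 1 1 ^+ 2 = 1 / 2 by lra.
exists (2 * h 1 0 * h 1 1).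
  have /eqP : (2 * h 1 0 * h 1 1) ^+ 2 = 1 by rewrite !exprMn ec ed; field.
  by rewrite sqrf_eq1 => /orP[] /eqP ->; [left|right].
split=> [|s]; first by rewrite e4.
split.
  apply: T_eq; rewrite expR0 expr1n hn_moebius /top /bot !hx_of !hy_of ea eb !mulr0 !add0r !exprMn sqrrN ec ed.
  by rewrite divff // gt_eqF // addr_gt0 // ?mulr_gt0 ?exprn_gt0 ?expR_gt0.
rewrite W_moebius hn_axis hx_of hy_of ea eb mulr0 addr0 /sh expRN.
by field; rewrite gt_eqF ?expR_gt0.
Qed.

Lemma perp_at_i_exists (sg : R) : sg = 1 \/ sg = -1 -> exists h,
  [/\ moebius h (axis 0) = axis 0, vel h 0 = sg +i* 0 &
    forall s, T (moebius h (axis s)) = 0 /\ W (moebius h (axis s)) = sg * sh s].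
Proof.
move=> sg1; have sg2 : sg ^+ 2 = 1 by case: sg1 => ->; rewrite ?sqrrN expr1n.
have [|p [q [h1 h2 h3]]] := @half_angle R 0 (- sg).
  by rewrite sqrrN sg2 expr0n add0r.
have v : vel (rotation h1) 0 = sg +i* 0.
  rewrite /vel dmoebius_axisE !sl2C /= expR0 !mulr1 !mul0r !mul1r add0r subr0 sqrrN.
  rewrite [_ + p ^+ 2]addrC h1 h2 expr1n !divr1; congr (_ +i* _).
  by rewrite -[RHS]opprK -h3; ring.
have [|sg' _ []] := perp_at_i (rot_axis0 h1).
  by rewrite v /riem /= mulr0 mul0r addr0 mul0r.
rewrite v => -[<-] h; exists (rotation h1); split=> //; exact: rot_axis0.
Qed.

(** The geodesic of frame h starts at the point t of the geodesic of frame g,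
    orthogonally and towards the side sg: in the coordinates of g it runs along
    the line T = t. *)
Definition perp_frame g t h (sg : R) : Prop :=
  [/\ sg = 1 \/ sg = -1, vel h 0 = dmoebius (g * flow t)%g (axis 0) (sg +i* 0) &
   forall s, T (moebius g^-1%g (moebius h (axis s))) = t /\
             W (moebius g^-1%g (moebius h (axis s))) = sg * sh s].

Lemma perp_frame_chart g t h s :
  moebius g^-1%g (moebius h (axis s)) =
  moebius (flow t) (moebius ((g * flow t)^-1 * h)%g (axis s)).
Proof. by rewrite -!moebiusM invgM !mulgA mulgV mul1g. Qed.

(** Moving the point t of the geodesic to i reduces this to [perp_at_i]. *)
Lemma perp_frameP g t h : moebius h (axis 0) = moebius g (axis t) ->
  riem (moebius g (axis t)) (vel h 0) (vel g t) = 0 ->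
  exists sg, perp_frame g t h sg.
Proof.
move=> hi; pose u := ((g * flow t)^-1 * h)%g.
have hu : (h = (g * flow t) * u)%g by rewrite /u mulVKg.
have ui : moebius u (axis 0) = axis 0.
  by rewrite /u moebiusM hi -moebius_flow moebiusK.
have vh : vel h 0 = dmoebius (g * flow t)%g (axis 0) (vel u 0).
  by rewrite /vel {1}hu dmoebiusM ui.
rewrite vh (velE g t) riem_frame => ru.
have [|sg sg1 [v E]] := @perp_at_i u ui.
  by rewrite riem_i.
exists sg; split=> // [|s]; first by rewrite vh v.
by rewrite (perp_frame_chart _ t) T_flow W_flow; case: (E s) => -> ->; rewrite add0r.
Qed.

Lemma perp_frame_exists g t (sg : R) : sg = 1 \/ sg = -1 ->
  exists2 h, moebius h (axis 0) = moebius g (axis t) & perp_frame g t h sg.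
Proof.
move=> sg1; have [u [ui v E]] := perp_at_i_exists sg1.
exists ((g * flow t) * u)%g; first by rewrite moebiusM ui moebius_flow.
split=> // [|s]; first by rewrite -v /vel dmoebiusM ui.
rewrite (perp_frame_chart _ t) mulKg T_flow W_flow.
by case: (E s) => -> ->; rewrite add0r.
Qed.

(** The geodesics orthogonal to the axis are the lines on which [T] is
    constant. *)
Lemma orth_projP g z t :
  orth_proj (fun s => moebius g (axis s)) z t <-> T (moebius g^-1%g z) = t.
Proof.
split.
- move=> [k [/geodesic_frame[h [-> ->]] h0]]; rewrite velocityE => hr [r <-].
  by have [sg [_ _ E]] := perp_frameP h0 hr; case: (E r).
- move=> zt; have [h hi [_ v E]] := @perp_frame_exists g t 1 (or_introl erefl).
  exists (fun s => moebius h (axis s)); split.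
  + exact: frame_geodesic.
  + exact: hi.
  + by rewrite !velocityE v velE riem_frame /= mulr0 mul0r addr0.
  + have [s sE] := sh_surj (W (moebius g^-1%g z)).
    exists s; apply: (can_inj (moebiusK g^-1%g)).
    by case: (E s) => h1 h2; apply: chart_inj; rewrite ?h1 ?h2 ?zt // sE mul1r.
Qed.

End Vel.

(** * The topology of SL(2;R) *)

Section TopSL.
Context {R : realType}.
Implicit Types (z w y : H2 R) (g u v h k : SL2 R) (t s r : R).

Lemma nbhs_sl u (A : set (SL2 R)) : nbhs u A <->
  exists2 e, 0 < e & forall v, (forall i j, `|u i j - v i j| < e) -> A v.
Proof.
have C : {for u, continuous (@sl_mx R : SL2 R -> 'M[R]_2)} by exact: initial_continuous.
split=> [|[e e0 h]].
- rewrite nbhsE => -[U [[V oV <-] uV] UA].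
  have /nbhs_ballP[e /= e0 eV] : nbhs (@sl_mx R u) V by exact: open_nbhs_nbhs.
  by exists e => // v uv; apply/UA/eV; split=> // i j; exact: uv.
- have : nbhs (@sl_mx R u) (ball (@sl_mx R u) e) by exact: nbhsx_ballx.
  move=> /C hu; apply: (@filterS _ (nbhs u) _ _ _ _ hu) => v [_ uv].
  by apply: h => i j; exact: uv.
Qed.

Lemma cvg_sl (X : Type) (F : set_system X) {FF : Filter F} (f : X -> SL2 R) u :
  (forall i j, (fun x => f x i j : R) @ F --> (u i j : R)) -> f @ F --> u.
Proof.
move=> h A /nbhs_sl[e e0 eA].
have {}h i j : \forall x \near F, `|u i j - f x i j| < e.
  by have /cvgrPdist_lt := h i j; exact.
near=> x; apply: eA => i j.
by case: (I2_cases i) => ->; case: (I2_cases j) => ->; near: x; exact: h.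
Unshelve. all: by end_near. Qed.

Lemma continuous_entry i j : continuous (fun u : SL2 R => u i j : R).
Proof.
move=> u; apply: (@continuous_comp _ _ _ (@sl_mx R : SL2 R -> 'M[R]_2) (fun M : 'M[R]_2 => M i j)).
  exact: initial_continuous.
exact: coord_continuous.
Qed.

Lemma cvg_entry (X : Type) (F : set_system X) {FF : Filter F} (f : X -> SL2 R) u i j :
  f @ F --> u -> (fun x => f x i j : R) @ F --> (u i j : R).
Proof.
move=> fu; exact: (@cvg_comp _ _ _ f (fun v : SL2 R => v i j : R) _ _ _ fu (@continuous_entry i j u)).
Qed.

Lemma cvg_slM (X : Type) (F : set_system X) {FF : Filter F} (f g : X -> SL2 R) u v :
  f @ F --> u -> g @ F --> v -> (fun x => f x * g x)%g @ F --> (u * v)%g.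
Proof.
move=> fu gv; apply: cvg_sl => i j; rewrite sl_mulE.
under eq_fun do rewrite sl_mulE.
by apply: cvgD; apply: cvgM; exact: cvg_entry.
Qed.

Lemma cvg_slV (X : Type) (F : set_system X) {FF : Filter F} (f : X -> SL2 R) u :
  f @ F --> u -> (fun x => (f x)^-1)%g @ F --> (u^-1)%g.
Proof.
move=> fu.
apply: cvg_sl => i j; have [h1 h2 h3 h4] := sl_invE u.
have h x := sl_invE (f x).
case: (I2_cases i) => ->; case: (I2_cases j) => ->; rewrite ?h1 ?h2 ?h3 ?h4.
- rewrite (_ : (fun x => _) = (fun x => f x 1 1)); first exact: cvg_entry.
  by apply/funext => x; case: (h x).
- rewrite (_ : (fun x => _) = (fun x => - f x 0 1)); first by apply: cvgN; exact: cvg_entry.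
  by apply/funext => x; case: (h x).
- rewrite (_ : (fun x => _) = (fun x => - f x 1 0)); first by apply: cvgN; exact: cvg_entry.
  by apply/funext => x; case: (h x).
- rewrite (_ : (fun x => _) = (fun x => f x 0 0)); first exact: cvg_entry.
  by apply/funext => x; case: (h x).
Qed.

Lemma cvg_mull g u : (fun v => g * v)%g @ nbhs u --> (g * u)%g.
Proof. by apply: cvg_slM; [exact: cvg_cst|exact: cvg_id]. Qed.

Lemma cvg_mulr g u : (fun v => v * g)%g @ nbhs u --> (u * g)%g.
Proof. by apply: cvg_slM; [exact: cvg_id|exact: cvg_cst]. Qed.

Definition bnd (B : R) : set (SL2 R) := [set u | forall i j, `|u i j| <= B].

(** An ultrafilter converges entry by entry, to a matrix of determinant 1. *)
Lemma compact_bnd B : compact (bnd B).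
Proof.
rewrite compact_ultra => F FU FB.
have PF : ProperFilter F by exact: ultra_proper.
have lim (i j : 'I_2) : exists2 x, `|x| <= B & (fun u : SL2 R => u i j : R) @ F --> x.
  pose f := fun u : SL2 R => u i j : R.
  have [|x [/= xB xc]] := @segment_compact R (- B) B (f @ F) _.
    apply: (@filterS _ F _ (bnd B)) FB => u uB.
    by rewrite /f /= in_itv /= -ler_norml; exact: uB.
  exists x; first by move: xB; rewrite in_itv /= -ler_norml.
  move=> A xA; have [//|nA] := in_ultra_setVsetC (f @^-1` A) FU.
  by have [a [nAa Aa]] := xc (~` A) A nA xA.
have [a aB Fa] := lim 0 0; have [b bB Fb] := lim 0 1.
have [c cB Fc] := lim 1 0; have [d dB Fd] := lim 1 1.
have D : a * d - b * c = 1.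
  have : (fun u : SL2 R => u 0 0 * u 1 1 - u 0 1 * u 1 0) @ F --> a * d - b * c.
    by apply: cvgB; apply: cvgM.
  under eq_fun do rewrite sl_det.
  move=> h; have h1 : (fun _ : SL2 R => 1 : R) @ F --> (1 : R) by exact: cvg_cst.
  by rewrite -(cvg_lim (@Rhausdorff R) h) (cvg_lim (@Rhausdorff R) h1).
exists (sl2 D).
split=> [i j|].
  by case: (I2_cases i) => ->; case: (I2_cases j) => ->; rewrite sl2C.
apply: (@cvg_sl _ F _ id) => i j.
by case: (I2_cases i) => ->; case: (I2_cases j) => ->; rewrite sl2C.
Qed.

Lemma bnd_inv B u : bnd B u -> bnd B u^-1%g.
Proof.
move=> h i j; have [h1 h2 h3 h4] := sl_invE u.
by case: (I2_cases i) => ->; case: (I2_cases j) => ->; rewrite ?h1 ?h2 ?h3 ?h4 ?normrN; exact: h.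
Qed.

Lemma bnd_nbhs u : \forall v \near u, bnd (\sum_i \sum_j `|u i j| + 1) v.
Proof.
apply/nbhs_sl; exists 1 => // v uv i j.
have := uv i j; rewrite distrC => h.
have : `|u i j| <= \sum_i \sum_j `|u i j|.
  rewrite (bigD1 i) //= (bigD1 j) //= -addrA lerDl addr_ge0 // sumr_ge0 // => *.
  by rewrite sumr_ge0.
have := ler_normD (v i j - u i j) (u i j); rewrite subrK; lra.
Qed.

End TopSL.

(** * Discreteness and cocompactness of the lattice *)

Section Lattice.
Context {R : realType}.
Variable Gamma : set (PSL2 R).
Implicit Types (z w y : H2 R) (g u v h k : SL2 R) (t s r : R).

(** The preimage of Gamma in SL(2;R). *)
Definition lat : set (SL2 R) := [set g | Gamma (\pi_(PSL2 R) g)].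

Hypothesis hsub : subgroup Gamma.

Lemma lat1 : lat 1%g. Proof. by case: hsub. Qed.
Lemma latM g h : lat g -> lat h -> lat (g * h)%g.
Proof.
by case: hsub => _ hM _ Gg Gh; rewrite /lat /= -psl_mul_pi; exact: hM.
Qed.
Lemma latV g : lat g -> lat g^-1%g.
Proof.
by case: hsub => _ _ hV Gg; rewrite /lat /= -psl_inv_pi; exact: hV.
Qed.
Lemma latN g : lat g -> lat (sl_opp g).
Proof. by rewrite /lat /= PSL2_piN. Qed.

Lemma orbitP x y : act_orbit (@psl_act R) Gamma x y <-> exists2 g, lat g & y = moebius g x.
Proof.
split=> [[p Gp <-]|[g Gg ->]].
  by exists (repr p) => //; rewrite /lat /= reprK.
by exists (\pi_(PSL2 R) g) => //; rewrite psl_actE.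
Qed.

Hypothesis hdisc : isolated Gamma = Gamma.

Lemma lat_isolated : exists2 V : set (SL2 R), nbhs (1%g : SL2 R) V & forall g, V g -> lat g ->
  forall z, moebius g z = z.
Proof.
have : isolated Gamma 1%g by rewrite hdisc; case: hsub.
case=> _ [V V1 VG].
exists [set g | V (\pi_(PSL2 R) g)].
  move: V1; rewrite nbhsE => -[U [oU U1] UV].
  rewrite nbhsE; exists [set g | U (\pi_(PSL2 R) g)].
    by split=> //; exact: oU.
  by move=> g /= /UV.
move=> g /= Vg Gg z; have : [set 1%g] (\pi_(PSL2 R) g) by rewrite -VG.
by rewrite -psl_actE => ->; rewrite psl_act1.
Qed.

Lemma hcosh_axis0 g z : hcosh (moebius g z) (axis 0) = (top g z + bot g z) / (2 * hy z).
Proof.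
rewrite hcoshE hn_moebius hy_moebius hn_axis hx_of hy_of expR0.
by field; rewrite !gt_eqF ?bot_gt0 ?hy_gt0.
Qed.

(** The hyperbolic cosine of the distance from i to the image of z is a positive
    definite quadratic form in the entries of the matrix. *)
Lemma bnd_of_hcosh z r : exists B, forall g, hcosh (moebius g z) (axis 0) <= r -> bnd B g.
Proof.
pose M := 2 * hy z * r; pose m := M / hy z ^+ 2.
exists (1 + m + 2 * M + 2 * m * hx z ^+ 2) => g.
rewrite hcosh_axis0 ler_pdivrMr ?mulr_gt0 ?hy_gt0 // [r * _]mulrC -/M /top /bot => h.
have y0 := hy_gt0 z.
have M0 : 0 <= M by apply: le_trans h; rewrite !addr_ge0 ?sqr_ge0.
have m0 : 0 <= m by rewrite /m divr_ge0 ?sqr_ge0.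
have mx0 : 0 <= m * hx z ^+ 2 by rewrite mulr_ge0 ?sqr_ge0.
have nrm (p : R) : `|p| <= 1 + p ^+ 2.
  have := normr_ge0 p; have := real_normK (num_real p); move: `|p| => n <- n0.
  by have := sqr_ge0 (n - 1 / 2); nra.
have key (a b : R) : (a * hx z + b) ^+ 2 + (a * hy z) ^+ 2 <= M ->
   `|a| <= 1 + m + 2 * M + 2 * m * hx z ^+ 2 /\
   `|b| <= 1 + m + 2 * M + 2 * m * hx z ^+ 2.
  move=> hab; have ha : a ^+ 2 <= m.
    rewrite /m ler_pdivlMr ?exprn_gt0 // -exprMn.
    by have := sqr_ge0 (a * hx z + b); lra.
  split; apply: (le_trans (nrm _)); first by lra.
  have : a ^+ 2 * hx z ^+ 2 <= m * hx z ^+ 2 by rewrite ler_wpM2r ?sqr_ge0.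
  have := sqr_ge0 (a * hy z); have := sqr_ge0 (2 * (a * hx z) + b).
  rewrite -exprMn; nra.
have [|a0 a1] := @key (g 0 0) (g 0 1).
  by have := sqr_ge0 (g 1 0 * hx z + g 1 1); have := sqr_ge0 (g 1 0 * hy z); lra.
have [|b0 b1] := @key (g 1 0) (g 1 1).
  by have := sqr_ge0 (g 0 0 * hx z + g 0 1); have := sqr_ge0 (g 0 0 * hy z); lra.
by move=> i j; case: (I2_cases i) => ->; case: (I2_cases j) => ->.
Qed.

(** Infinitely many points of the orbit in a ball would make the elements of the
    lattice that produce them accumulate; two of these that are close to each
    other have a quotient close to 1, hence trivial, and produce the same
    point. *)
Lemma orbit_locally_finite x r :
  finite_set [set y | (exists2 g, lat g & y = moebius g x) /\ hcosh y (axis 0) <= r].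
Proof.
set A := [set _ | _]; apply: contrapT => infA.
have [B hB] := bnd_of_hcosh x r.
pose D (S : set (H2 R)) := [set g | [/\ lat g, A (moebius g x) & ~ S (moebius g x)]].
have FF : ProperFilter (filter_from finite_set D).
  apply: filter_from_proper.
    apply: filter_from_filter; first by exists set0.
    move=> S S' fS fS'; exists (S `|` S'); first by rewrite finite_setU.
    by move=> g [Gg Ag nS]; split; split=> // h; apply: nS; [left|right].
  move=> S fS; have : infinite_set (A `\` S) by apply: infinite_setD.
  by move=> /infinite_setN0[y [[[g Gg ->] yr] Sy]]; exists g; split=> //; split=> //; exists g.
have [p [_ pc]] : (bnd B) `&` cluster (filter_from finite_set D) !=set0.
  apply: compact_bnd; exists set0 => // g [_ [_ ?] _]; exact: hB.
have [V V1 VG] := lat_isolated.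
have [[U1 U2] /= [pU1 pU2] UV] : nbhs (p, p) [set uv | V (uv.1^-1 * uv.2)%g].
  have : (fun uv : SL2 R * SL2 R => uv.1^-1 * uv.2)%g @ nbhs (p, p) --> (p^-1 * p)%g.
    by apply: cvg_slM; [apply: cvg_slV; exact: cvg_fst|exact: cvg_snd].
  by rewrite mulVg => /(_ _ V1).
have pU : nbhs p (U1 `&` U2) by exact: filterI.
have FD S : finite_set S -> filter_from finite_set D (D S).
  by move=> fS; exists S.
have [g1 [[G1 _ _] [Ug1 _]]] := pc (D set0) _ (FD _ (finite_set0 _)) pU.
have [g2 [[G2 _ ne] [_ Ug2]]] := pc (D [set moebius g1 x]) _ (FD _ (finite_set1 _)) pU.
apply: ne => /=; rewrite -[g2](mulVKg g1) moebiusM.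
by congr moebius; apply: VG; [exact: (UV (g1, g2))|apply: latM => //; exact: latV].
Qed.

Hypothesis hcpt : compact [set: orbit_space (fun g h : PSL2 R => g * h)%g Gamma].

(** The orbits that contain a matrix with entries less than n form an increasing
    family of open sets that exhausts the compact quotient. *)
Lemma lat_cocompact : exists B, forall u, exists2 g, lat g & bnd B (u * g)%g.
Proof.
pose Q := orbit_space (fun g h : PSL2 R => g * h)%g Gamma.
pose O n : set (SL2 R) := [set u | forall i j, `|u i j| < n%:R].
pose U n : set Q := [set q | exists2 g, O n g & sval q (\pi_(PSL2 R) g)].
have UE n h : (U n (\pi_Q (\pi_(PSL2 R) h))) <-> exists2 g, lat g & O n (g * h)%g.
  rewrite /U /=; split.
  - case=> g Og; rewrite val_pi_orbit => -[p Gp] e.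
    have e2 : psl_mul (\pi_(PSL2 R) (repr p)) (\pi_(PSL2 R) h) = \pi_(PSL2 R) g.
      by rewrite reprK; exact: e.
    move: e2; rewrite psl_mul_pi => /PSL2_pi_eq[e2|e2].
      by exists (repr p); rewrite /lat /= ?reprK // e2.
    exists (repr p); rewrite /lat /= ?reprK // e2 => i j.
    by rewrite mxE normrN; exact: Og.
  - case=> g Gg Og; exists (g * h)%g => //; rewrite val_pi_orbit.
    by exists (\pi_(PSL2 R) g) => //; exact: psl_mul_pi.
have oO n : open (O n).
  rewrite openE => u Ou; apply/nbhs_sl.
  pose e := \big[Order.min/1]_i \big[Order.min/1]_j (n%:R - `|u i j|).
  have ei (i j : 'I_2) : e <= n%:R - `|u i j|.
    rewrite /e; apply: le_trans (bigmin_le_cond _ _ _) _; last exact: (bigmin_le_cond _ _ _); by [].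
  exists e; first by apply/bigmin_gtP; split=> // i _; apply/bigmin_gtP; split=> // j _; rewrite subr_gt0.
  move=> v uv i j; have := uv i j; have := ei i j.
  have := ler_normD (v i j - u i j) (u i j); rewrite subrK [`|v i j - _|]distrC; lra.
have oU n : open (U n).
  suff : open [set h | exists2 g, lat g & O n (g * h)%g].
    move=> h; have -> // : open (U n) = open [set h | exists2 g, lat g & O n (g * h)%g].
    rewrite -[LHS]/(open [set h | U n (\pi_Q (\pi_(PSL2 R) h))]); congr open.
    by apply/seteqP; split=> k /UE.
  rewrite openE => h [g Gg Og].
  have : (fun h => g * h)%g @ nbhs h --> (g * h)%g.
    by apply: cvg_slM; [exact: cvg_cst|exact: cvg_id].
  have : nbhs (g * h)%g (O n) by apply: open_nbhs_nbhs; split.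
  by move=> a b; apply: (@filterS _ (nbhs h) _ _ _ _ (b _ a)) => k /= Ok; exists g.
suff [n Un] : exists n, U n = setT.
  exists n%:R => u; have := Un; move=> /(congr1 (fun A => A (\pi_Q (\pi_(PSL2 R) u^-1%g)))) e.
  have : U n (\pi_Q (\pi_(PSL2 R) u^-1%g)) by rewrite e.
  move=> /UE[g Gg Og]; exists g^-1%g; first exact: latV.
  rewrite -[(u * _)%g]invgK invgM invgK; apply: bnd_inv => i j; exact: ltW.
apply: contrapT => nU.
have FF : ProperFilter (filter_from setT (fun n => ~` U n)).
  apply: filter_from_proper.
    apply: filter_from_filter; first by exists 0%N.
    move=> m n _ _; exists (maxn m n) => // q nq; split=> -[g Og gq]; apply: nq;
      exists g => // i j; apply: (lt_le_trans (Og i j)); rewrite ler_nat;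
      [exact: leq_maxl|exact: leq_maxr].
  move=> n _; apply/set0P; apply: contra_notN nU => /eqP e.
  by exists n; rewrite -[U n]setCK e setC0.
have [q [_ qc]] := hcpt FF (@filterT _ _ _).
have [n Unq] : exists n, U n q.
  rewrite -[q]reprK -[repr q]reprK; set h := repr (repr q).
  have [n hn] : exists n : nat, \sum_i \sum_j `|h i j| < n%:R.
    exists (Num.bound (\sum_i \sum_j `|h i j|)); apply: archi_boundP.
    by rewrite sumr_ge0 // => i _; rewrite sumr_ge0.
  exists n; apply/UE; exists 1%g; first exact: lat1.
  rewrite mul1g => i j; apply: le_lt_trans hn.
  rewrite (bigD1 i) //= (bigD1 j) //= -addrA lerDl addr_ge0 // sumr_ge0 // => *.
  by rewrite sumr_ge0.
have qU : nbhs q (U n) by apply: open_nbhs_nbhs; split.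
have Fn : filter_from setT (fun n => ~` U n) (~` U n) by exists n.
by have [q' []] := qc _ _ Fn qU.
Qed.

End Lattice.

(** * From unit tangent vectors to frames *)

Section Dense.
Context {R : realType}.
Implicit Types (z w y : H2 R) (g u h k : SL2 R) (t s r : R) (v : UT R).

Lemma ut_eq v v' : hx (ut_base v) = hx (ut_base v') -> hy (ut_base v) = hy (ut_base v') ->
  complex.Re (ut_vec v) = complex.Re (ut_vec v') ->
  complex.Im (ut_vec v) = complex.Im (ut_vec v') -> v = v'.
Proof.
move=> h1 h2 h3 h4; apply: (pcan_inj (@ut_pairK R)); rewrite /ut_pair; congr (_, _).
  exact: h2_eq.
by move: h3 h4; case: (ut_vec v) (ut_vec v') => a b [c d] /= -> ->.
Qed.

Lemma ut_base_subproof : riem (axis 0) (0 +i* 1) (0 +i* 1) == 1 :> R.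
Proof. by rewrite riem_i /= mulr0 add0r mulr1. Qed.

Definition ut_i : UT R := MkUT ut_base_subproof.

(** The group acts simply transitively on unit tangent vectors, up to sign: g
    stands for the image of the vertical unit vector at i. *)
Definition frame_ut g : UT R := tmoebius g ut_i.

Lemma frame_utE g : let D := g 1 0 ^+ 2 + g 1 1 ^+ 2 in
  [/\ hx (ut_base (frame_ut g)) = (g 0 0 * g 1 0 + g 0 1 * g 1 1) / D,
      hy (ut_base (frame_ut g)) = D^-1,
      complex.Re (ut_vec (frame_ut g)) = 2 * g 1 0 * g 1 1 / D ^+ 2 &
      complex.Im (ut_vec (frame_ut g)) = (g 1 1 ^+ 2 - g 1 0 ^+ 2) / D ^+ 2].
Proof.
rewrite /frame_ut [ut_base _]/= [ut_vec _]/=.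
rewrite hx_moebius hy_moebius dmoebius_axisE /bot hn_axis hx_of hy_of /= expR0.
rewrite !(mulr1, mulr0, mul0r, mul1r, add0r, addr0, subr0, expr1n).
by split; rewrite 1?[g 1 1 ^+ 2 + g 1 0 ^+ 2]addrC //.
Qed.

(** A matrix that fixes the vertical unit vector at i is 1 or -1. *)
Lemma frame_ut_inj g h : frame_ut g = frame_ut h -> g = h \/ g = sl_opp h.
Proof.
move=> e; have : frame_ut (h^-1 * g)%g = ut_i.
  apply: (pcan_inj (@ut_pairK R)); rewrite /frame_ut tmoebiusM -/(frame_ut g) e.
  by rewrite /frame_ut -tmoebiusM mulVg -[1%g]/(sl_one R) -(psl_tactE (sl_one R)) psl_tact1.
move: (mulVKg h g); move: (h^-1 * g)%g => u gE ui {e}.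
have := frame_utE u; rewrite ui /= => -[].
rewrite /ut_i /= hx_of hy_of expR0; have D := sl_det u.
move=> e1 e2 e3 e4; clear ui.
have e5 : u 1 0 ^+ 2 + u 1 1 ^+ 2 = 1 by rewrite -[LHS]invrK -e2 invr1.
rewrite e5 expr1n !divr1 in e1 e3 e4.
have c0 : u 1 0 = 0 by apply/eqP; rewrite -sqrf_eq0; clear gE; lra.
have d1 : u 1 1 ^+ 2 = 1 by move: e5; rewrite c0 expr0n add0r.
have b0 : u 0 1 = 0.
  by have : u 0 1 * u 1 1 * u 1 1 = 0; [move: e1; rewrite c0 mulr0 add0r => <-; rewrite mul0r|rewrite -mulrA -expr2 d1 mulr1].
have ad : u 0 0 = u 1 1.
  by move: D; rewrite b0 mul0r subr0 => D; rewrite -[LHS]mulr1 -d1 expr2 mulrA D mul1r.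
move/eqP: d1; rewrite sqrf_eq1 => /orP[] /eqP d1; [left|right].
  by rewrite -gE (_ : u = 1%g) ?mulg1 //; apply: sl_eq; rewrite ?ad ?c0 ?b0 ?d1 !mxE.
rewrite -gE (_ : u = sl_opp (sl_one R)); last first.
  by apply: sl_eq; rewrite ?ad ?c0 ?b0 ?d1 !mxE //= ?oppr0.
by apply: val_inj; rewrite /= mulmxN mulmx1.
Qed.

Lemma cvg_ut v : [/\ (fun v' => hx (ut_base v')) @ v --> hx (ut_base v),
  (fun v' => hy (ut_base v')) @ v --> hy (ut_base v),
  (fun v' => complex.Re (ut_vec v')) @ v --> complex.Re (ut_vec v) &
  (fun v' => complex.Im (ut_vec v')) @ v --> complex.Im (ut_vec v)].
Proof.
pose f (u : UT R) : (R * R) * (R * R) := ((hx (ut_base u), hy (ut_base u)),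
  (complex.Re (ut_vec u), complex.Im (ut_vec u))).
have C : f @ v --> f v by exact: (@initial_continuous (UT R) _ f).
split.
- exact: (@cvg_comp _ _ _ f (fun p => p.1.1) _ _ _ C (cvg_comp _ _ (@cvg_fst _ _ _ _ _) (@cvg_fst _ _ _ _ _))).
- exact: (@cvg_comp _ _ _ f (fun p => p.1.2) _ _ _ C (cvg_comp _ _ (@cvg_fst _ _ _ _ _) (@cvg_snd _ _ _ _ _))).
- exact: (@cvg_comp _ _ _ f (fun p => p.2.1) _ _ _ C (cvg_comp _ _ (@cvg_snd _ _ _ _ _) (@cvg_fst _ _ _ _ _))).
- exact: (@cvg_comp _ _ _ f (fun p => p.2.2) _ _ _ C (cvg_comp _ _ (@cvg_snd _ _ _ _ _) (@cvg_snd _ _ _ _ _))).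
Qed.

(** The frame map is open: the frame of a nearby vector is found by
    multiplying (d + i c) with a square root, close to 1, of the quotient of
    the two vectors, since the vector of a frame is i / (d + i c)^2. *)
Lemma frame_ut_open h (V : set (SL2 R)) : nbhs h V ->
  \forall v \near frame_ut h, exists2 k, V k & frame_ut k = v.
Proof.
move=> /nbhs_sl[e e0 eV]; set v0 := frame_ut h.
have [cx cy cp cq] := cvg_ut v0; have [E1 E2 E3 E4] := frame_utE h.
rewrite -/v0 in E1 E2 E3 E4.
pose X v := hx (ut_base v); pose Y v := hy (ut_base v).
pose p v := complex.Re (ut_vec v); pose q v := complex.Im (ut_vec v).
have nv v : p v ^+ 2 + q v ^+ 2 = Y v ^+ 2.
  have /eqP := ut_norm v; rewrite /riem -/(p v) -/(q v) -/(hy _) -/(Y v) -!expr2.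
  have := hy_gt0 (ut_base v); rewrite -/(Y v) => y0 h1.
  by rewrite -[LHS](divfK (lt0r_neq0 (exprn_gt0 2 y0))) h1 mul1r.
have y0 v : 0 < Y v by exact: hy_gt0.
pose rx v := (p v0 * p v + q v0 * q v) / Y v ^+ 2.
pose ry v := (q v0 * p v - p v0 * q v) / Y v ^+ 2.
pose rr v := Y v0 / Y v.
have yi : (fun v => (Y v)^-1) @ v0 --> (Y v0)^-1 by exact: cvgV (lt0r_neq0 (y0 _)) cy.
have yi2 : (fun v => (Y v ^+ 2)^-1) @ v0 --> (Y v0 ^+ 2)^-1.
  have cy2 : (fun v => Y v ^+ 2) @ v0 --> Y v0 ^+ 2.
    by under eq_fun do rewrite expr2; rewrite expr2; exact: (cvgM cy cy).
  exact: cvgV (lt0r_neq0 (exprn_gt0 2 (y0 _))) cy2.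
have crx : rx @ v0 --> (1 : R).
  rewrite (_ : 1 = (p v0 * p v0 + q v0 * q v0) / Y v0 ^+ 2); last first.
    by rewrite -!expr2 nv divff // lt0r_neq0 ?exprn_gt0.
  exact: (cvgM (cvgD (cvgM (cvg_cst _) cp) (cvgM (cvg_cst _) cq)) yi2).
have cry : ry @ v0 --> (0 : R).
  rewrite (_ : 0 = (q v0 * p v0 - p v0 * q v0) / Y v0 ^+ 2); last first.
    by rewrite [p v0 * _]mulrC subrr mul0r.
  exact: (cvgM (cvgB (cvgM (cvg_cst _) cp) (cvgM (cvg_cst _) cq)) yi2).
have crr : rr @ v0 --> (1 : R).
  rewrite (_ : 1 = Y v0 / Y v0); last by rewrite divff // lt0r_neq0.
  exact: (cvgM (cvg_cst _) yi).
pose P v := Num.sqrt ((rr v + rx v) / 2); pose Q v := ry v / (2 * P v).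
have cP : P @ v0 --> (1 : R).
  have -> : (1 : R) = Num.sqrt ((1 + 1) / 2) by rewrite (_ : _ / 2 = 1) ?sqrtr1 //; field.
  have c1 : (fun v => (rr v + rx v) / 2) @ v0 --> ((1 + 1) / 2 : R).
    exact: (cvgM (cvgD crr crx) (cvg_cst _)).
  exact: (cvg_comp _ _ c1 (@sqrt_continuous _ _)).
have cQ : Q @ v0 --> (0 : R).
  rewrite (_ : 0 = 0 / (2 * 1) :> R); last by rewrite mul0r.
  have c2 : (fun v => 2 * P v) @ v0 --> (2 * 1 : R) by exact: (cvgM (cvg_cst _) cP).
  have n2 : 2 * 1 != 0 :> R by rewrite mulr1.
  exact: (cvgM cry (cvgV n2 c2)).
pose d v := h 1 1 * P v - h 1 0 * Q v; pose c v := h 1 0 * P v + h 1 1 * Q v.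
have cd : d @ v0 --> (h 1 1 : R).
  have -> : (h 1 1 : R) = h 1 1 * 1 - h 1 0 * 0 by rewrite mulr0 mulr1 subr0.
  exact: (cvgB (cvgM (cvg_cst _) cP) (cvgM (cvg_cst _) cQ)).
have cc : c @ v0 --> (h 1 0 : R).
  have -> : (h 1 0 : R) = h 1 0 * 1 + h 1 1 * 0 by rewrite mulr0 mulr1 addr0.
  exact: (cvgD (cvgM (cvg_cst _) cP) (cvgM (cvg_cst _) cQ)).
have D0 : 0 < h 1 0 ^+ 2 + h 1 1 ^+ 2 by have := y0 v0; rewrite /Y E2 invr_gt0.
have Dh := sl_det h.
have ca : (fun v => X v * c v + Y v * d v) @ v0 --> (h 0 0 : R).
  have -> : (h 0 0 : R) = X v0 * h 1 0 + Y v0 * h 1 1.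
    rewrite /X /Y E1 E2; apply: (mulfI (lt0r_neq0 D0)).
    rewrite [RHS](_ : _ = h 0 0 * h 1 0 ^+ 2 + h 0 1 * h 1 1 * h 1 0 + 1 * h 1 1); last first.
      by field; rewrite lt0r_neq0.
    rewrite -[in RHS]Dh; ring.
  exact: (cvgD (cvgM cx cc) (cvgM cy cd)).
have cb : (fun v => X v * d v - Y v * c v) @ v0 --> (h 0 1 : R).
  have -> : (h 0 1 : R) = X v0 * h 1 1 - Y v0 * h 1 0.
    rewrite /X /Y E1 E2; apply: (mulfI (lt0r_neq0 D0)).
    rewrite [RHS](_ : _ = h 0 1 * h 1 1 ^+ 2 + h 0 0 * h 1 1 * h 1 0 - 1 * h 1 0); last first.
      by field; rewrite lt0r_neq0.
    rewrite -[in RHS]Dh; ring.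
  exact: (cvgB (cvgM cx cd) (cvgM cy cc)).
have Pn : \forall v \near v0, 0 < P v by apply: (cvgr_gt _ cP); exact: ltr01.
have na : \forall v \near v0, `|h 0 0 - (X v * c v + Y v * d v)| < e.
  by move/cvgrPdist_lt : ca; exact.
have nb : \forall v \near v0, `|h 0 1 - (X v * d v - Y v * c v)| < e.
  by move/cvgrPdist_lt : cb; exact.
have nc : \forall v \near v0, `|h 1 0 - c v| < e by move/cvgrPdist_lt : cc; exact.
have nd : \forall v \near v0, `|h 1 1 - d v| < e by move/cvgrPdist_lt : cd; exact.
near=> v.
have Pv : 0 < P v by near: v.
have nP := lt0r_neq0 Pv; have nY v' := lt0r_neq0 (y0 v'); have nD := lt0r_neq0 D0.
have P2 : P v ^+ 2 = (rr v + rx v) / 2.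
  by rewrite sqr_sqrtr // ltW // -sqrtr_gt0.
have rr2 : rx v ^+ 2 + ry v ^+ 2 = rr v ^+ 2.
  rewrite /rx /ry /rr !expr_div_n -mulrDl.
  rewrite [X in X / _](_ : _ = (p v0 ^+ 2 + q v0 ^+ 2) * (p v ^+ 2 + q v ^+ 2)); last by ring.
  by rewrite !nv; field; exact: (lt0r_neq0 (y0 _)).
have Q2 : Q v ^+ 2 = (rr v - rx v) / 2.
  rewrite /Q expr_div_n [(2 * P v) ^+ 2]exprMn P2.
  have -> : ry v ^+ 2 = (rr v - rx v) * (rr v + rx v) by rewrite -[LHS](addKr (rx v ^+ 2)) rr2; ring.
  have : rr v + rx v != 0 by apply: lt0r_neq0; have := exprn_gt0 2 Pv; rewrite P2; lra.
  by move=> n0; field.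
have PQ : 2 * P v * Q v = ry v by rewrite /Q; field; rewrite ?nY ?nP ?nD.
have dc : c v ^+ 2 + d v ^+ 2 = (Y v)^-1.
  transitivity ((h 1 0 ^+ 2 + h 1 1 ^+ 2) * (P v ^+ 2 + Q v ^+ 2)); first by rewrite /c /d; ring.
  rewrite P2 Q2 (_ : (rr v + rx v) / 2 + (rr v - rx v) / 2 = rr v); last by field.
  by rewrite /rr [Y v0]E2; field; rewrite ?nD ?nY.
have det : (X v * c v + Y v * d v) * d v - (X v * d v - Y v * c v) * c v = 1.
  transitivity (Y v * (c v ^+ 2 + d v ^+ 2)); first by ring.
  by rewrite dc mulfV // nY.
exists (sl2 det).
  apply: eV => i j.
  by case: (I2_cases i) => ->; case: (I2_cases j) => ->; rewrite sl2C; near: v.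
have [F1 F2 F3 F4] := frame_utE (sl2 det).
rewrite !sl2C in F1 F2 F3 F4.
have A0 : h 1 1 ^+ 2 - h 1 0 ^+ 2 = q v0 / Y v0 ^+ 2.
  by rewrite /q /Y E4 E2; field; rewrite ?nY ?nP ?nD.
have B0 : 2 * h 1 0 * h 1 1 = p v0 / Y v0 ^+ 2.
  by rewrite /p /Y E3 E2; field; rewrite ?nY ?nP ?nD.
have PQ2 : P v ^+ 2 - Q v ^+ 2 = rx v by rewrite P2 Q2; field.
apply: ut_eq; rewrite ?F1 ?F2 ?F3 ?F4 dc.
- rewrite invrK [X in X * _](_ : _ = X v * (c v ^+ 2 + d v ^+ 2)); last by ring.
  by rewrite dc mulfVK // nY.
- by rewrite invrK.
- transitivity (((h 1 1 ^+ 2 - h 1 0 ^+ 2) * (2 * P v * Q v) + (2 * h 1 0 * h 1 1) * (P v ^+ 2 - Q v ^+ 2)) * Y v ^+ 2).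
    by rewrite /c /d; field; rewrite ?nY ?nP ?nD.
  rewrite A0 B0 PQ PQ2 /rx /ry -/(p v).
  transitivity (p v * (p v0 ^+ 2 + q v0 ^+ 2) / Y v0 ^+ 2).
    move: (nY v) (nY v0) (p v) (q v) (p v0) (q v0); move: (Y v) (Y v0) => y1 y2 n1 n2 p1 q1 p2 q2.
    by field; rewrite ?n1 ?n2.
  by rewrite nv mulfK // expf_neq0 // nY.
- transitivity (((h 1 1 ^+ 2 - h 1 0 ^+ 2) * (P v ^+ 2 - Q v ^+ 2) - (2 * h 1 0 * h 1 1) * (2 * P v * Q v)) * Y v ^+ 2).
    by rewrite /c /d; field; rewrite ?nY ?nP ?nD.
  rewrite A0 B0 PQ PQ2 /rx /ry -/(q v).
  transitivity (q v * (p v0 ^+ 2 + q v0 ^+ 2) / Y v0 ^+ 2).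
    move: (nY v) (nY v0) (p v) (q v) (p v0) (q v0); move: (Y v) (Y v0) => y1 y2 n1 n2 p1 q1 p2 q2.
    by field; rewrite ?n1 ?n2.
  by rewrite nv mulfK // expf_neq0 // nY.
Unshelve. all: by end_near. Qed.

Lemma frame_ut_flow g t : ut_pair (frame_ut (g * flow t)%g) = (moebius g (axis t), vel g t).
Proof. by rewrite velE -moebius_flow. Qed.

Lemma psl_tact_frame (pp : PSL2 R) g : psl_tact pp (frame_ut g) = frame_ut (repr pp * g)%g.
Proof. by rewrite /psl_tact /frame_ut tmoebiusM. Qed.

(** A neighbourhood of frames descends, by openness, to an open set of unit tangent
    vectors of the surface, which the dense orbit meets. A vector determines its
    frame up to sign, and -1 belongs to the preimage of Gamma. *)
Lemma orbit_dense (Gamma : set (PSL2 R)) (l : R -> H2 R) g0 : subgroup Gamma ->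
  l = (fun t => moebius g0 (axis t)) ->
  dense [set \pi_(surface_UT Gamma) u | u in flow_orbit l] ->
  forall h (V : set (SL2 R)), nbhs h V -> exists s g, lat Gamma g /\ V (g * g0 * flow s)%g.
Proof.
move=> hsub lE hd h V hV.
pose V0 := interior V.
pose O : set (surface_UT Gamma) := [set q | exists2 k, V0 k & sval q (frame_ut k)].
have tE (u : UT R) (k : SL2 R) : sval (\pi_(surface_UT Gamma) u) (frame_ut k) <->
    exists2 g, lat Gamma g & u = frame_ut (g * k)%g.
  have -> : sval (\pi_(surface_UT Gamma) u) = act_orbit (@psl_tact R) Gamma u by exact: val_pi_orbit.
  split=> [[pp Gp e]|[g Gg ->]].
    exists (repr pp^-1%g); first by rewrite /lat /= reprK; case: hsub => _ _; exact.
    rewrite -psl_tact_frame -e -psl_tactM mulVg; exact/esym/psl_tact1.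
  exists (\pi_(PSL2 R) g^-1%g); first by exact: (latV hsub Gg).
  by rewrite psl_tactE /frame_ut -tmoebiusM mulKg.
have oO : open O.
  suff : open [set u | O (\pi_(surface_UT Gamma) u)] by [].
  rewrite openE => u [k V0k /tE[g Gg ->]].
  have : nbhs (g * k)%g [set k' | V0 (g^-1 * k')%g].
    have : (fun k' => g^-1 * k')%g @ nbhs (g * k)%g --> (g^-1 * (g * k))%g.
      by apply: cvg_slM; [exact: cvg_cst|exact: cvg_id].
    rewrite mulKg; apply; apply: open_nbhs_nbhs; split=> //; exact: open_interior.
  move=> /frame_ut_open; apply: filterS => _ [k' Vk' <-].
  by exists (g^-1 * k')%g => //; apply/tE; exists g => //; rewrite mulVKg.
have [q [[k V0k qk] [u [t [ut uv]] uq]]] : O `&` [set \pi_(surface_UT Gamma) u | u in flow_orbit l] !=set0.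
  apply: hd => //; exists (\pi_(surface_UT Gamma) (frame_ut h)); exists h; first exact: nbhs_singleton (nbhs_interior hV).
  by apply/tE; exists 1%g; [exact: lat1|rewrite mul1g].
move: qk; rewrite -uq => /tE[g Gg uE].
have ue : u = frame_ut (g0 * flow t)%g.
  apply: (pcan_inj (@ut_pairK R)); rewrite frame_ut_flow /ut_pair ut uv lE.
  by rewrite velocityE.
exists t; move: ue; rewrite uE => /frame_ut_inj[e|e].
  exists g^-1%g; split; first exact: latV.
  by rewrite -mulgA -e mulKg; exact: interior_subset.
exists (sl_opp g^-1%g); split; first by apply: latN; exact: latV.
have -> : (sl_opp g^-1 * g0 * flow t = k)%g; last exact: interior_subset.
have : (sl_opp g^-1%g * g0 * flow t = g^-1 * sl_opp (g0 * flow t))%g.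
  by apply: val_inj; rewrite /= !mulNmx mulmxN mulmxA.
by move=> ->; rewrite -e mulKg.
Qed.

End Dense.

(** * Charts of geodesics *)

Section Chart.
Lemma cvg_sqr (K : realType) (X : Type) (F : set_system X) {FF : Filter F} (f : X -> K) (a : K) :
  f @ F --> a -> (fun x => f x ^+ 2) @ F --> a ^+ 2.
Proof. by move=> fa; under eq_fun do rewrite expr2; rewrite expr2; exact: (cvgM fa fa). Qed.

Context {R : realType}.
Implicit Types (z w y : H2 R) (g u v h k : SL2 R) (t s r : R).

(** A matrix u is used as the chart of the geodesic u^-1 (i e^t); these are the
    coordinates of y with respect to that geodesic. *)
Definition Wc u y : R := W (moebius u y).
Definition Tc u y : R := T (moebius u y).

Lemma WcM u g y : Wc (u * g)%g y = Wc u (moebius g y).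
Proof. by rewrite /Wc moebiusM. Qed.
Lemma TcM u g y : Tc (u * g)%g y = Tc u (moebius g y).
Proof. by rewrite /Tc moebiusM. Qed.
Lemma Wc_flow s u y : Wc (flow s * u)%g y = Wc u y.
Proof. by rewrite /Wc moebiusM W_flow. Qed.
Lemma Tc_flow s u y : Tc (flow s * u)%g y = Tc u y + s.
Proof. by rewrite /Tc moebiusM T_flow. Qed.

Lemma cvg_Wc (X : Type) (F : set_system X) {FF : Filter F} (f : X -> SL2 R) u y :
  f @ F --> u -> (fun x => Wc (f x) y) @ F --> Wc u y.
Proof.
move=> fu; rewrite /Wc W_moebius; under eq_fun do rewrite W_moebius.
have e i j := @cvg_entry R X F FF f u i j fu.
apply: cvgM; last exact: cvg_cst.
exact: (cvgD (cvgD (cvgM (cvgM (e 0 0) (e 1 0)) (cvg_cst _))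
  (cvgM (cvgD (cvgM (e 0 0) (e 1 1)) (cvgM (e 0 1) (e 1 0))) (cvg_cst _))) (cvgM (e 0 1) (e 1 1))).
Qed.

Lemma cvg_Tc (X : Type) (F : set_system X) {FF : Filter F} (f : X -> SL2 R) u y :
  f @ F --> u -> (fun x => Tc (f x) y) @ F --> Tc u y.
Proof.
move=> fu; rewrite /Tc /T; under eq_fun do rewrite hn_moebius; rewrite hn_moebius.
have e i j := @cvg_entry R X F FF f u i j fu.
have sq (a b : R) (p q : X -> R) : p @ F --> a -> q @ F --> b ->
   (fun x => (p x * hx y + q x) ^+ 2 + (p x * hy y) ^+ 2) @ F --> (a * hx y + b) ^+ 2 + (a * hy y) ^+ 2.
  move=> pa qb.
  have h1 : (fun x => p x * hx y + q x) @ F --> a * hx y + b.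
    exact: (cvgD (cvgM pa (cvg_cst (hx y))) qb).
  have h2 : (fun x => p x * hy y) @ F --> a * hy y by exact: (cvgM pa (cvg_cst (hy y))).
  exact: (cvgD (cvg_sqr h1) (cvg_sqr h2)).
have ct : (fun x => top (f x) y) @ F --> top u y by exact: (sq _ _ _ _ (e 0 0) (e 0 1)).
have cb : (fun x => bot (f x) y) @ F --> bot u y by exact: (sq _ _ _ _ (e 1 0) (e 1 1)).
apply: cvgM; last exact: cvg_cst.
have c : (fun x => top (f x) y / bot (f x) y) @ F --> top u y / bot u y.
  exact: (cvgM ct (cvgV (lt0r_neq0 (bot_gt0 u y)) cb)).
have l := @continuous_ln R _ (divr_gt0 (top_gt0 u y) (bot_gt0 u y)).
exact: (cvg_comp _ _ c l).
Qed.

Arguments cvg_Wc {X F FF f u} y _.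
Arguments cvg_Tc {X F FF f u} y _.

Lemma cvg_normW (X : Type) (F : set_system X) {FF : Filter F} (f : X -> SL2 R) u y :
  f @ F --> u -> (fun x => `|Wc (f x) y| : R) @ F --> (`|Wc u y| : R).
Proof. by move=> fu; exact: (cvg_norm (cvg_Wc y fu)). Qed.

Lemma cvg_normT (X : Type) (F : set_system X) {FF : Filter F} (f : X -> SL2 R) u y :
  f @ F --> u -> (fun x => `|Tc (f x) y| : R) @ F --> (`|Tc u y| : R).
Proof. by move=> fu; exact: (cvg_norm (cvg_Tc y fu)). Qed.

Arguments cvg_normW {X F FF f u} y _.
Arguments cvg_normT {X F FF f u} y _.

Lemma near_Wc_lt u y (r : R) : `|Wc u y| < r -> \forall v \near u, `|Wc v y| < r.
Proof.
move=> h; have cid : (fun v => v) @ nbhs u --> u by exact: cvg_id.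
have cW : (fun v => `|Wc v y| : R) @ u --> (`|Wc u y| : R) by exact: cvg_normW y cid.
by apply: (cvgr_lt _ cW); exact: h.
Qed.

Lemma near_Tc_lt u y (r : R) : `|Tc u y| < r -> \forall v \near u, `|Tc v y| < r.
Proof.
move=> h; have cid : (fun v => v) @ nbhs u --> u by exact: cvg_id.
have cT : (fun v => `|Tc v y| : R) @ u --> (`|Tc u y| : R) by exact: cvg_normT y cid.
by apply: (cvgr_lt _ cT); exact: h.
Qed.

Lemma near_finite (X : Type) (F : set_system X) {FF : Filter F} (S : set (H2 R)) (P : H2 R -> X -> Prop) :
  finite_set S -> (forall y, S y -> \forall x \near F, P y x) ->
  \forall x \near F, forall y, S y -> P y x.
Proof.
move=> /finite_seqP[s ->]; elim: s => [|a s IH] h.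
  by apply: nearW => x y.
have h1 : \forall x \near F, P a x by apply: h; rewrite /= mem_head.
have h2 : \forall x \near F, forall y, [set` s] y -> P y x.
  by apply: IH => y ys; apply: h; rewrite /= inE; apply/orP; right.
apply: filterS2 h1 h2 => x h1 h2 y; rewrite /= inE => /orP[/eqP -> //|ys].
exact: h2.
Qed.

Lemma cw_le_W z r : `|W z| <= r -> cw z <= 1 + r ^+ 2.
Proof.
move=> Wr; have r0 : 0 <= r by apply: le_trans Wr.
have : W z ^+ 2 <= r ^+ 2 by rewrite -(real_normK (num_real (W z))) ler_sqr ?nnegrE.
by have := cwE z; have := cw_gt0 z; have := sqr_ge0 (W z); nra.
Qed.

Variable O : set (H2 R).
Hypothesis LF : forall r, finite_set [set y | O y /\ hcosh y (axis 0) <= r].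

(** Bounded coordinates bound the distance from the image of y to i, and bounded
    entries bound the distance from the image of i to i. *)
Lemma chart_finite (B tau om : R) : exists2 F, finite_set F &
  forall u, bnd B u -> forall y, O y -> `|Tc u y| <= tau -> `|Wc u y| <= om -> F y.
Proof.
pose A1 : R := arcosh (1 + (om ^+ 2 + (1 + om ^+ 2) * (ch tau - 1))).
pose A2 : R := arcosh (1 + 2 * B ^+ 2).
have [e1 p1] : ch A1 = 1 + (om ^+ 2 + (1 + om ^+ 2) * (ch tau - 1)) /\ 0 <= A1.
  apply: arcoshK; rewrite lerDl addr_ge0 ?sqr_ge0 // mulr_ge0 ?subr_ge0 ?ch_ge1 //.
  by rewrite addr_ge0 ?sqr_ge0.
have [e2 p2] : ch A2 = 1 + 2 * B ^+ 2 /\ 0 <= A2.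
  by apply: arcoshK; rewrite lerDl mulr_ge0 ?sqr_ge0.
exists [set y | O y /\ hcosh y (axis 0) <= ch (A1 + A2)]; first exact: LF.
move=> u uB y Oy Ty Wy; split=> //.
rewrite -hdist_le ?addr_ge0 // -(hdist_moebius u).
apply: le_trans (hdist_triangle (axis 0) _ _) _; apply: lerD.
  rewrite hdist_le // hcoshC hcosh_axis sub0r chN e1.
  have c1 := cw_le_W Wy; have c0 := cw_gt0 (moebius u y).
  have t1 : ch (Tc u y) <= ch tau.
    by rewrite leNgt ch_lt_norm -leNgt [X in _ <= X]ger0_norm // (le_trans _ Ty).
  have := ler_wpM2r (ltW (ch_gt0 (Tc u y))) c1.
  have : (1 + om ^+ 2) * ch (Tc u y) <= (1 + om ^+ 2) * ch tau.
    by rewrite ler_wpM2l // addr_ge0 ?sqr_ge0.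
  rewrite /Tc; lra.
rewrite hdist_le // hcoshC hcosh_axis0 e2 /top /bot hx_of hy_of expR0.
have b2 i j : u i j ^+ 2 <= B ^+ 2.
  rewrite -(real_normK (num_real (u i j))) ler_sqr ?nnegrE //.
  by apply: le_trans (uB i j).
have := b2 0 0; have := b2 0 1; have := b2 1 0; have := b2 1 1.
rewrite !mulr0 !add0r !mulr1; lra.
Qed.

(** Only the finitely many points of [chart_finite] matter, so that a property of
    the points in a bounded region may be checked point by point. *)
Lemma near_region (X : Type) (F : set_system X) {FF : Filter F} (f : X -> SL2 R) u tau om
    (P : H2 R -> X -> Prop) : f @ F --> u ->
  (forall y, O y -> \forall x \near F, `|Tc (f x) y| <= tau -> `|Wc (f x) y| <= om -> P y x) ->
  \forall x \near F, forall y, O y -> `|Tc (f x) y| <= tau -> `|Wc (f x) y| <= om -> P y x.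
Proof.
move=> fu h; have [S fS hS] := chart_finite (\sum_i \sum_j `|u i j| + 1) tau om.
have nb : \forall x \near F, bnd (\sum_i \sum_j `|u i j| + 1) (f x) by exact: fu (bnd_nbhs u).
have fSO : finite_set (S `&` O) by apply: sub_finite_set fS => y [].
have := near_finite fSO (fun y Sy => h y Sy.2).
move=> h2; near=> x; move=> y Oy ty wy.
have bx : bnd (\sum_i \sum_j `|u i j| + 1) (f x) by near: x.
have px : forall y, (S `&` O) y -> `|Tc (f x) y| <= tau -> `|Wc (f x) y| <= om -> P y x.
  by near: x; exact: h2.
by apply: px => //; split=> //; exact: hS bx _ Oy ty wy.
Unshelve. all: by end_near. Qed.

(** A closed bounded region of a chart that contains no point of the orbit
    stays so under small changes of the chart. *)
Lemma near_empty (X : Type) (F : set_system X) {FF : Filter F} (f : X -> SL2 R) u tau om :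
  f @ F --> u ->
  (forall y, O y -> ~ (`|Tc u y| <= tau /\ `|Wc u y| <= om)) ->
  \forall x \near F, forall y, O y -> ~ (`|Tc (f x) y| <= tau /\ `|Wc (f x) y| <= om).
Proof.
move=> fu h.
have : \forall x \near F, forall y, O y -> `|Tc (f x) y| <= tau -> `|Wc (f x) y| <= om -> False.
  apply: (near_region fu) => y Oy.
  have cT : (fun x => `|Tc (f x) y| : R) @ F --> (`|Tc u y| : R) by exact: cvg_normT y fu.
  have cW : (fun x => `|Wc (f x) y| : R) @ F --> (`|Wc u y| : R) by exact: cvg_normW y fu.
  have [tu|tu] := leP `|Tc u y| tau.
    have wu : om < `|Wc u y| by rewrite ltNge; apply/negP => wu; exact: h Oy (conj tu wu).
    have : \forall x \near F, om < `|Wc (f x) y| by apply: (cvgr_gt _ cW); exact: wu.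
    by apply: filterS => x o _; rewrite leNgt o.
  have : \forall x \near F, tau < `|Tc (f x) y| by apply: (cvgr_gt _ cT); exact: tu.
  by apply: filterS => x o; rewrite leNgt o.
by apply: filterS => x hx y Oy [a b]; exact: hx Oy a b.
Qed.

End Chart.

(** * Consequences of the Delone property *)

(** All that matters of the lattice G, of the orbit O and of the geodesic, whose
    chart is u0. The lattice acts on charts on the right and the flow acts on the
    left; the charts obtained from u0 describe the same set of projections up to
    translation, and they are dense. *)
Record dense_orbit (R : realType) (O : set (H2 R)) (G : set (SL2 R)) (u0 : SL2 R) : Prop := {
  do_finite : forall r : R, finite_set [set y | O y /\ hcosh y (axis 0) <= r];
  do_act : forall g y, G g -> O y -> O (moebius g y);
  do_mul : forall g h, G g -> G h -> G (g * h)%g;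
  do_inv : forall g, G g -> G g^-1%g;
  do_cocompact : exists B, forall u : SL2 R, exists2 g, G g & bnd B (u * g)%g;
  do_dense : forall (u : SL2 R) (V : set (SL2 R)), nbhs u V ->
    exists s g, G g /\ V (flow s * u0 * g)%g }.

Section Strips.
Context {R : realType} {O : set (H2 R)} {G : set (SL2 R)} {u0 : SL2 R}.
Hypothesis HO : dense_orbit O G u0.
Implicit Types (z w y : H2 R) (g u v h k : SL2 R) (t s r K : R).

(** With K = sinh rho, the projections of the points of the orbit at distance less
    than rho from the geodesic of chart u. *)
Definition strip K u : set R :=
  [set t | exists2 y, O y & `|Wc u y| < K /\ Tc u y = t].

Lemma strip_flow K s u g t : G g -> strip K (flow s * u * g)%g t <-> strip K u (t - s).
Proof.
move=> Gg; split=> -[y Oy [Wy Ty]].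
- exists (moebius g y); first exact: do_act HO _ _ Gg Oy.
  move: Wy Ty; rewrite WcM Wc_flow TcM Tc_flow => Wy <-; split=> //.
  by rewrite addrK.
- exists (moebius g^-1%g y); first exact: do_act HO _ _ (do_inv HO Gg) Oy.
  by rewrite WcM Wc_flow TcM Tc_flow moebiusVK Ty subrK.
Qed.

Lemma strip_delone K s u g e d : G g -> delone e d (strip K u) ->
  delone e d (strip K (flow s * u * g)%g).
Proof.
move=> Gg [e0 d0 he hd]; split=> // [t|t t'].
- have [t' st' tt'] := he (t - s); exists (t' + s); last by rewrite opprD addrA addrAC.
  by apply/strip_flow => //; rewrite addrK.
- move=> /(strip_flow _ _ _ _ Gg) h /(strip_flow _ _ _ _ Gg) h' tt'.
  have -> : t - t' = (t - s) - (t' - s) by ring.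
  by apply: hd => // e1; apply: tt'; apply: (addIr (- s)).
Qed.

Section FromDelone.
Variables (K e d : R).
Hypothesis HS : delone e d (strip K u0).

Lemma delone_flow s g : G g -> delone e d (strip K (flow s * u0 * g)%g).
Proof. by move=> Gg; exact: strip_delone. Qed.

(** Relative density of one dense geodesic passes to the closure. *)
Lemma delone_meets u : exists2 y, O y & `|Tc u y| <= e /\ `|Wc u y| <= K.
Proof.
apply: contrapT => h.
have n : forall y, O y -> ~ (`|Tc u y| <= e /\ `|Wc u y| <= K).
  by move=> y Oy hy; apply: h; exists y.
have hn : \forall v \near u, forall y, O y -> ~ (`|Tc v y| <= e /\ `|Wc v y| <= K).
  exact: (near_empty (do_finite HO) (F := nbhs u) (f := id) cvg_id n).
have [s [g [Gg hv]]] := do_dense HO hn.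
have [_ _ he _] := delone_flow s Gg.
have [_ [y Oy [Wy <-]] ye] := he 0.
by apply: (hv y Oy); split; [move: ye; rewrite sub0r normrN|exact: ltW].
Qed.

Lemma cvg_parab u : (fun b => parab b * u)%g @ (0 : R) --> u.
Proof.
have : (fun b => parab b * u)%g @ (0 : R) --> (parab 0 * u)%g.
  apply: cvg_slM; last exact: cvg_cst.
  apply: cvg_sl => i j; case: (I2_cases i) => ->; case: (I2_cases j) => ->; rewrite sl2C;
    under eq_fun do rewrite sl2C; [exact: cvg_cst|exact: cvg_id|exact: cvg_cst|exact: cvg_cst].
rewrite (_ : parab 0 = 1%g) ?mul1g //.
by apply: sl_eq; rewrite !sl2C !mxE.
Qed.

Lemma Wc_parab b u y : Wc (parab b * u)%g y = Wc u y + b / hy (moebius u y).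
Proof. by rewrite /Wc moebiusM W_parab. Qed.

(** If all the disks met by a geodesic touch it on the same side, it can be
    pushed off all those that it meets within a bounded time. *)
Lemma delone_not_one_sided u : ~ forall y, O y -> `|Wc u y| <= K -> Wc u y = K.
Proof.
move=> h.
have cs : (fun b => parab b * u)%g @ (0 : R)^'+ --> u.
  move=> A uA; have h0 : nbhs (0 : R) [set b | A (parab b * u)%g] by exact: cvg_parab uA.
  exact: (@cvg_within _ (nbhs (0 : R)) _ _ _ h0).
have : \forall b \near (0 : R)^'+, forall y, O y -> `|Tc (parab b * u)%g y| <= e ->
   `|Wc (parab b * u)%g y| <= K -> False.
  apply: (near_region (do_finite HO) cs) => y Oy.
  have [Wy|Wy] := leP `|Wc u y| K.
    have {}Wy := h y Oy Wy.
    near=> b => _; rewrite Wc_parab Wy ler_norml => /andP[_].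
    rewrite gerDl leNgt divr_gt0 ?hy_gt0 //; near: b; exact: nbhs_right_gt.
  have cW : (fun b => `|Wc (parab b * u)%g y| : R) @ (0 : R)^'+ --> (`|Wc u y| : R).
    exact: cvg_normW y cs.
  have : \forall b \near (0 : R)^'+, K < `|Wc (parab b * u)%g y|.
    by apply: (cvgr_gt _ cW); exact: Wy.
  by apply: filterS => b o _; rewrite leNgt o.
move=> hb; near (0 : R)^'+ => b.
have hb' : forall y, O y -> `|Tc (parab b * u)%g y| <= e ->
   `|Wc (parab b * u)%g y| <= K -> False by near: b; exact: hb.
have [y Oy [ty wy]] := delone_meets (parab b * u)%g.
exact: hb' Oy ty wy.
Unshelve. all: by end_near. Qed.

Lemma reverse_subproof : (0 : R) ^+ 2 + 1 ^+ 2 = 1.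
Proof. by rewrite expr0n add0r expr1n. Qed.
(** The half-turn about i reverses the geodesic. *)
Definition reverse : SL2 R := rotation reverse_subproof.

Lemma W_reverse z : W (moebius reverse z) = - W z.
Proof.
by rewrite W_moebius !sl2C /W; field; rewrite gt_eqF ?hy_gt0.
Qed.

Lemma delone_not_one_sidedN u : ~ forall y, O y -> `|Wc u y| <= K -> Wc u y = - K.
Proof.
move=> h; apply: (@delone_not_one_sided (reverse * u)%g) => y Oy.
rewrite /Wc moebiusM W_reverse normrN => /(h y Oy) => e1.
by rewrite -/(Wc u y) e1 opprK.
Qed.

(** Two points at distance at most 2 rho, seen from a geodesic that is almost
    the perpendicular bisector of their segment. *)
Lemma close_pair_chart y z rho (dl : R) : y <> z -> hdist y z <= 2 * rho -> 0 < dl ->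
  exists u, [/\ `|Wc u y| < sh rho, `|Wc u z| < sh rho, Tc u y <> Tc u z &
    `|Tc u y - Tc u z| < dl].
Proof.
move=> yz yzr dl0.
have [g [gy gz]] := two_point_chart y z.
set D := hdist y z in yzr gz *.
have D0 : 0 < D.
  rewrite lt_neqAle hdist_ge0 andbT eq_sym; apply/eqP => D0.
  apply: yz; apply: hcosh_eq1; rewrite -ch_hdist -/D D0; exact: ch0.
pose r := D / 2; have r0 : 0 < r by rewrite divr_gt0.
have rr : r <= rho by rewrite /r; lra.
pose g' := (flow (- r) * g)%g.
have g'y : moebius g' y = axis (- r) by rewrite moebiusM gy flow_axis add0r.
have g'z : moebius g' z = axis r.
  by rewrite moebiusM gz flow_axis; congr axis; rewrite /r; field.
pose c := ch (dl / 2) ^+ 2.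
have c1 : 1 < c.
  have : ch 0 < ch (dl / 2) by rewrite ch_lt // ?divr_gt0 // ltW // divr_gt0.
  rewrite ch0 /c => h; have := ch_ge1 (dl / 2); nra.
pose eta := (c - 1) / (2 * c).
have c0 : 0 < c by lra.
have eta0 : 0 < eta by rewrite divr_gt0 //; lra.
have eta1 : eta < 1 by rewrite /eta ltr_pdivrMr; lra.
have etac : eta * c = (c - 1) / 2 by rewrite /eta; field; rewrite gt_eqF.
have [|p [q [h1 h2 h3]]] := @half_angle R (Num.sqrt eta) (Num.sqrt (1 - eta)).
  by rewrite !sqr_sqrtr; lra.
pose S := Num.sqrt (1 - eta).
have hS : 2 * p * q = S by exact: h3.
have S2 : S ^+ 2 = 1 - eta by rewrite sqr_sqrtr //; lra.
have S0 : 0 <= S by exact: sqrtr_ge0.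
have WE s : W (moebius (rotation h1) (axis s)) = - (S * sh s).
  rewrite W_moebius !sl2C hn_axis hx_of hy_of -hS /sh expRN; field.
  by rewrite gt_eqF ?expR_gt0.
have cwrE s : cw (moebius (rotation h1) (axis s)) ^+ 2 = 1 + (1 - eta) * sh s ^+ 2.
  by rewrite cwE WE sqrrN exprMn S2.
have TE s : ch s = cw (moebius (rotation h1) (axis s)) * ch (T (moebius (rotation h1) (axis s))).
  have := hcosh_moebius (rotation h1) (axis 0) (axis s).
  rewrite rot_axis0 !hcosh_axis T_axis cw_axis !sub0r !chN mul1r => <- //.
have sr0 : 0 < sh r by rewrite sh_gt0.
have srr : sh r <= sh rho by rewrite leNgt sh_lt -leNgt.
have Wlt s : `|sh s| = sh r -> `|W (moebius (rotation h1) (axis s))| < sh rho.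
  move=> es; rewrite WE normrN normrM es (ger0_norm S0).
  apply: lt_le_trans srr; rewrite gtr_pMl //.
  by rewrite -(@ltr_sqr R) ?nnegrE // S2 expr1n; lra.
have Tlt s : `|sh s| = sh r -> `|T (moebius (rotation h1) (axis s))| < dl / 2.
  move=> es; rewrite -[X in _ < X]ger0_norm; last by rewrite ltW // divr_gt0.
  rewrite -ch_lt_norm -(@ltr_sqr R) ?nnegrE ?(ltW (ch_gt0 _)) // -/c.
  have cw2 := cwrE s; have cp : 0 < cw (moebius (rotation h1) (axis s)) ^+ 2 by rewrite exprn_gt0 ?cw_gt0.
  rewrite -(ltr_pM2l cp) -exprMn -TE cw2 ch_sh.
  have := sqr_ge0 (sh s); move: (sh s ^+ 2) => x x0.
  have : eta * c * x = (c - 1) / 2 * x by rewrite etac.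
  nra.
exists (rotation h1 * g')%g; rewrite /Wc /Tc (moebiusM _ g' y) (moebiusM _ g' z) g'y g'z.
have a1 : `|sh (- r)| = sh r by rewrite shN normrN gtr0_norm.
have a2 : `|sh r| = sh r by rewrite gtr0_norm.
split; [exact: Wlt|exact: Wlt| |].
- move=> eT; have := hcosh_moebius (rotation h1) (axis (- r)) (axis r).
  rewrite hcosh_chart eT subrr ch0 mulr1 hcosh_axis cw_axis T_axis mul1r !WE shN.
  have -> : cw (moebius (rotation h1) (axis (- r))) = cw (moebius (rotation h1) (axis r)).
    apply/eqP; rewrite -(eqrXn2 (n := 2)) ?(ltW (cw_gt0 _)) //.
    by rewrite !cwrE shN sqrrN.
  rewrite -expr2 cwrE -opprD chN chD -!expr2 ch_sh.
  have : 0 < sh r ^+ 2 by rewrite exprn_gt0.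
  have : - (S * - sh r) * - (S * sh r) = - (S ^+ 2 * sh r ^+ 2) by ring.
  move=> ->; rewrite S2; move: (sh r ^+ 2) => x x0 ex.
  have : eta * x = 0 by lra.
  by move/eqP; rewrite mulf_eq0 !gt_eqF.
- by have := Tlt _ a1; have := Tlt _ a2; rewrite !ltr_norml => /andP[? ?] /andP[? ?]; apply/andP; split; lra.
Qed.

(** Otherwise the charts given by [close_pair_chart] could be approximated by charts
    of the dense geodesic, on which two distinct projections would be closer than d. *)
Lemma delone_separated rho y z : K = sh rho -> O y -> O z -> y <> z -> 2 * rho < hdist y z.
Proof.
move=> KE Oy Oz yz; rewrite ltNge; apply/negP => yzr.
have [_ d0 _ _] := HS.
have [u [Wy Wz Tyz Td]] := close_pair_chart yz yzr d0.
have cid : (fun v => v) @ nbhs u --> u by exact: cvg_id.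
have nW x : `|Wc u x| < sh rho -> \forall v \near u, `|Wc v x| < sh rho.
  move=> h; have cW : (fun v => `|Wc v x| : R) @ u --> (`|Wc u x| : R).
    exact: cvg_normW x cid.
  by apply: (cvgr_lt _ cW); exact: h.
have cT : (fun v => Tc v y - Tc v z : R) @ u --> (Tc u y - Tc u z : R).
  have cTx x : (fun v => Tc v x : R) @ u --> (Tc u x : R) by exact: cvg_Tc x cid.
  exact: (cvgB (cTx y) (cTx z)).
have cT' : (fun v => `|Tc v y - Tc v z| : R) @ u --> (`|Tc u y - Tc u z| : R).
  exact: (cvg_norm cT).
have n1 : \forall v \near u, `|Tc v y - Tc v z| < d.
  by apply: (cvgr_lt _ cT'); exact: Td.
have n2 : \forall v \near u, 0 < `|Tc v y - Tc v z|.
  apply: (cvgr_gt _ cT'); rewrite normr_gt0 subr_eq0; exact/eqP.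
have hn : \forall v \near u, [/\ `|Wc v y| < K, `|Wc v z| < K, `|Tc v y - Tc v z| < d & 0 < `|Tc v y - Tc v z|].
  by near=> v; split; near: v; rewrite ?KE; [exact: nW|exact: nW|exact: n1|exact: n2].
have [s [g [Gg [h1 h2 h3 h4]]]] := do_dense HO hn.
have [_ _ _ hd] := delone_flow s Gg.
move: h3; rewrite ltNge => /negP; apply; apply: hd; [by exists y|by exists z|].
by move=> e1; move: h4; rewrite e1 subrr normr0 ltxx.
Unshelve. all: by end_near. Qed.

End FromDelone.
End Strips.
Arguments strip {R} O K u _.

(** * Alternating contacts of two geodesics *)

Section ThreePoint.
Context {R : realType}.
Implicit Types (z w y : H2 R) (g u v h k : SL2 R) (t s r K : R).

(** On a line where [W] is constant, the coordinate W with respect to another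
    geodesic is of the form A e^T + B e^-T, up to an additive constant. *)
Lemma W_moebius_chart g z : W (moebius g z) =
  cw z * (g 0 0 * g 1 0 * expR (T z) + g 0 1 * g 1 1 / expR (T z)) +
  (1 + 2 * (g 0 1 * g 1 0)) * W z.
Proof.
have e : g 0 0 * g 1 1 = 1 + g 0 1 * g 1 0 by have := sl_det g; lra.
rewrite W_moebius e -(expT z) /cw /W.
by field; rewrite !gt_eqF ?hy_gt0 ?expR_gt0.
Qed.

Lemma W_moebius_diag g z : g 0 1 = 0 -> g 1 0 = 0 -> W (moebius g z) = W z.
Proof.
by move=> b c; rewrite W_moebius_chart b c !(mulr0, mul0r, addr0, mul1r, add0r).
Qed.

(** If m <= 0, then A and B have opposite signs, so that A E + B / E is monotone
    in E and cannot change from nonnegative to nonpositive and back without being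
    zero. If m > 0, then A and B have the same sign and the inequality of arithmetic
    and geometric means makes |A E + B / E| too large at one of the points. *)
Lemma three_point_real (kap K A B m E1 E2 E3 : R) : 0 < K -> K < kap ->
  0 < E1 -> E1 < E2 -> E2 < E3 -> A * B = m * (1 + m) ->
  0 <= kap * (A * E1 + B / E1) + 2 * m * K ->
  kap * (A * E2 + B / E2) - 2 * m * K <= 0 ->
  0 <= kap * (A * E3 + B / E3) + 2 * m * K -> 0 < 1 + m ->
  A = 0 /\ B = 0.
Proof.
move=> K0 Kk E1p E12 E23 AB h1 h2 h3 m1.
have E2p : 0 < E2 by lra.
have E3p : 0 < E3 by lra.
have k0 : 0 < kap by lra.
have i12 : E2^-1 < E1^-1 by rewrite ltf_pV2.
have i23 : E3^-1 < E2^-1 by rewrite ltf_pV2.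
have amgm E : 0 < E -> 4 * (A * B) <= (A * E + B / E) ^+ 2.
  move=> e0; have -> : (A * E + B / E) ^+ 2 = (A * E - B / E) ^+ 2 + 4 * (A * B).
    by field; rewrite gt_eqF.
  by rewrite lerDr sqr_ge0.
have [m0|m0] := lerP m 0.
  have AB0 : A * B <= 0 by rewrite AB; nra.
  have mK : m * K <= 0 by rewrite mulr_le0_ge0 // ltW.
  have [[A0 B0]|[A0 B0]] : (0 <= A /\ B <= 0) \/ (A <= 0 /\ 0 <= B).
    have [A0|A0] := ltrP A 0; first by right; split; [exact: ltW|nra].
    have [B0|B0] := lerP B 0; first by left.
    by right; split; [nra|exact: ltW].
  - have a1 : A * E1 <= A * E2 by rewrite ler_wpM2l // ltW.
    have b1 : B / E1 <= B / E2 by rewrite ler_wnM2l // ltW.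
    have e : A * E1 + B / E1 = 0 /\ A * E2 + B / E2 = 0 by split; nra.
    have a2 : A * (E2 - E1) = 0 by lra.
    have b2 : B * (E1^-1 - E2^-1) = 0 by lra.
    by split; apply/eqP; [move/eqP : a2|move/eqP : b2]; rewrite mulf_eq0 subr_eq0 ?(gt_eqF E12) ?(gt_eqF i12) orbF.
  - have a1 : A * E3 <= A * E2 by rewrite ler_wnM2l // ltW.
    have b1 : B / E3 <= B / E2 by rewrite ler_wpM2l // ltW.
    have e : A * E3 + B / E3 = 0 /\ A * E2 + B / E2 = 0 by split; nra.
    have a2 : A * (E3 - E2) = 0 by lra.
    have b2 : B * (E2^-1 - E3^-1) = 0 by lra.
    by split; apply/eqP; [move/eqP : a2|move/eqP : b2]; rewrite mulf_eq0 subr_eq0 ?(gt_eqF E23) ?(gt_eqF i23) orbF.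
exfalso; have AB0 : 0 < A * B by rewrite AB mulr_gt0.
have absurd_sq (f : R) : 0 <= f -> kap * f <= 2 * m * K -> 4 * (A * B) <= f ^+ 2 -> False.
  move=> f0 kf f2; have fm : f < 2 * m.
    rewrite -(ltr_pM2l k0); apply: le_lt_trans kf _.
    by rewrite mulrC ltr_pM2r // mulr_gt0.
  have h4 : 0 <= (2 * m - f) * (2 * m + f) by rewrite mulr_ge0 //; lra.
  by move: f2; rewrite AB; lra.
have [A0|A0] := ltrP 0 A.
  have B0 : 0 < B by rewrite -(pmulr_rgt0 _ A0).
  apply: (absurd_sq (A * E2 + B / E2)); last exact: amgm.
    by rewrite addr_ge0 // ?divr_ge0 ?mulr_ge0 // ltW.
  lra.
have B0 : B < 0 by nra.
apply: (absurd_sq (- (A * E1 + B / E1))); last by rewrite sqrrN; exact: amgm.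
  have := mulr_le0_ge0 A0 (ltW E1p).
  have : B / E1 <= 0 by rewrite mulr_le0_ge0 ?invr_ge0 // ltW.
  lra.
lra.
Qed.

(** The axis touches three disks alternately on its two sides, and another geodesic
    passes them on the same sides without entering them. Then the two geodesics are
    the same, as their signed distance changes sign at most once. *)
Lemma three_point (sg K : R) g z1 z2 z3 : 0 < K -> sg = 1 \/ sg = -1 ->
  W z1 = sg * K -> W z2 = - (sg * K) -> W z3 = sg * K -> T z1 < T z2 -> T z2 < T z3 ->
  0 < g 0 0 -> 0 < g 1 1 ->
  K <= sg * W (moebius g z1) -> K <= - (sg * W (moebius g z2)) ->
  K <= sg * W (moebius g z3) -> g 0 1 = 0 /\ g 1 0 = 0.
Proof.
move=> K0 sg1 e1 e2 e3 t12 t23 a0 d0 h1 h2 h3.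
have sg2 : sg * sg = 1 by case: sg1 => ->; ring.
have cwK z : W z ^+ 2 = K ^+ 2 -> cw z = Num.sqrt (1 + K ^+ 2).
  by move=> e; rewrite -e -cwE sqrtr_sqr gtr0_norm ?cw_gt0.
set kap := Num.sqrt (1 + K ^+ 2) in cwK.
have kap2 : kap ^+ 2 = 1 + K ^+ 2 by rewrite sqr_sqrtr // addr_ge0 ?sqr_ge0.
have kap0 : 0 <= kap by exact: sqrtr_ge0.
have Kk : K < kap by rewrite -ltr_sqr ?nnegrE ?(ltW K0) // kap2; lra.
have c1 : cw z1 = kap by apply: cwK; rewrite e1 exprMn expr2 sg2 mul1r.
have c2 : cw z2 = kap by apply: cwK; rewrite e2 sqrrN exprMn expr2 sg2 mul1r.
have c3 : cw z3 = kap by apply: cwK; rewrite e3 exprMn expr2 sg2 mul1r.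
have D := sl_det g.
have [||||||||] := @three_point_real kap K (sg * (g 0 0 * g 1 0)) (sg * (g 0 1 * g 1 1))
   (g 0 1 * g 1 0) (expR (T z1)) (expR (T z2)) (expR (T z3)) K0 Kk; rewrite ?expR_gt0 ?ltr_expR //.
- transitivity ((sg * sg) * ((g 0 1 * g 1 0) * (g 0 0 * g 1 1))); first by ring.
  by rewrite sg2 mul1r; congr (_ * _); lra.
- move: h1; rewrite W_moebius_chart c1 e1.
  move: (expR _) (expR_gt0 (T z1)) => E E0 h1.
  have : sg * (kap * (g 0 0 * g 1 0 * E + g 0 1 * g 1 1 / E) + (1 + 2 * (g 0 1 * g 1 0)) * (sg * K))
    = kap * (sg * (g 0 0 * g 1 0) * E + sg * (g 0 1 * g 1 1) / E) + (1 + 2 * (g 0 1 * g 1 0)) * (sg * sg * K) by ring.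
  rewrite sg2; lra.
- move: h2; rewrite W_moebius_chart c2 e2.
  move: (expR _) (expR_gt0 (T z2)) => E E0 h2.
  have : sg * (kap * (g 0 0 * g 1 0 * E + g 0 1 * g 1 1 / E) + (1 + 2 * (g 0 1 * g 1 0)) * - (sg * K))
    = kap * (sg * (g 0 0 * g 1 0) * E + sg * (g 0 1 * g 1 1) / E) - (1 + 2 * (g 0 1 * g 1 0)) * (sg * sg * K) by ring.
  rewrite sg2; lra.
- move: h3; rewrite W_moebius_chart c3 e3.
  move: (expR _) (expR_gt0 (T z3)) => E E0 h3.
  have : sg * (kap * (g 0 0 * g 1 0 * E + g 0 1 * g 1 1 / E) + (1 + 2 * (g 0 1 * g 1 0)) * (sg * K))
    = kap * (sg * (g 0 0 * g 1 0) * E + sg * (g 0 1 * g 1 1) / E) + (1 + 2 * (g 0 1 * g 1 0)) * (sg * sg * K) by ring.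
  rewrite sg2; lra.
- have -> : 1 + g 0 1 * g 1 0 = g 0 0 * g 1 1 by lra.
  exact: mulr_gt0.
have sn : sg != 0 by case: sg1 => ->; rewrite ?oppr_eq0 oner_eq0.
move=> /eqP; rewrite !mulf_eq0 (negbTE sn) (gt_eqF a0) /= => /eqP ->.
by move=> /eqP; rewrite !mulf_eq0 (negbTE sn) (gt_eqF d0) /= orbF => /eqP ->.
Qed.

End ThreePoint.

(** * Relative density *)

Section RelativeDensity.
Context {R : realType} {O : set (H2 R)} {G : set (SL2 R)} {u0 : SL2 R}.
Hypothesis HO : dense_orbit O G u0.
Implicit Types (z w y : H2 R) (g u v h k : SL2 R) (t s r : R).

Lemma dense_orbit1 : G 1%g.
Proof.
have [B /(_ 1%g)[g Gg _]] := do_cocompact HO.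
by rewrite -(mulVg g); exact: do_mul HO _ _ (do_inv HO Gg) Gg.
Qed.

Section Gap.
Variables (K rho c : R).
Hypotheses (rho0 : 0 < rho) (KE : K = sh rho).
Hypothesis sep : forall y z, O y -> O z -> y <> z -> c <= hdist y z.
Hypothesis rhoc : 2 * rho < c.

Lemma K_gt0 : 0 < K. Proof. by rewrite KE sh_gt0. Qed.

(** If W = sinh a and W' = sinh a', with |a| and |a'| less than rho, then the
    hyperbolic cosine of the distance is ch (a - a') + ch a ch a' (ch (t - t') - 1),
    whose first term is less than ch (2 rho): the rest is bounded below. *)
Lemma strip_separated : exists2 d, 0 < d & forall u t t',
  strip O K u t -> strip O K u t' -> t <> t' -> d <= `|t - t'|.
Proof.
pose kap := (ch c - ch (2 * rho)) / ch rho ^+ 2.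
have r2 : 0 <= 2 * rho by rewrite mulr_ge0 // ltW.
have c0 : 0 <= c by rewrite (le_trans r2) // ltW.
have chr0 : 0 < ch rho ^+ 2 by rewrite exprn_gt0 ?ch_gt0.
have kap0 : 0 < kap by rewrite divr_gt0 // subr_gt0 ch_lt.
have k1 : 1 <= 1 + kap by rewrite lerDl ltW.
have [de d0] := arcoshK k1; set d := arcosh _ in de d0 *.
exists d.
  rewrite lt_neqAle d0 andbT eq_sym; apply/eqP => e0.
  by move: de; rewrite e0 ch0; lra.
move=> u t t' [y Oy [Wy Ty]] [y' Oy' [Wy' Ty']] tt'.
have yy' : y <> y' by move=> e; apply: tt'; rewrite -Ty -Ty' e.
have := sep Oy Oy' yy'; rewrite -(ch_le c0) ?hdist_ge0 // ch_hdist.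
rewrite -(hcosh_moebius u) hcosh_chart -/(Tc u y) -/(Tc u y') Ty Ty'.
rewrite -/(Wc u y) -/(Wc u y').
have [a ea] := sh_surj (Wc u y); have [a' ea'] := sh_surj (Wc u y').
have cwa z b : sh b = Wc u z -> cw (moebius u z) = ch b.
  move=> e; apply/eqP; rewrite -(eqrXn2 (n := 2)) ?(ltW (cw_gt0 _)) ?(ltW (ch_gt0 _)) //.
  by rewrite cwE ch_sh e.
have abs_lt b z : sh b = Wc u z -> `|Wc u z| < K -> `|b| < rho.
  move=> <-; rewrite KE !ltr_norml -shN !sh_lt //.
rewrite (cwa _ _ ea) (cwa _ _ ea') -ea -ea' => h.
have ar := abs_lt _ _ ea Wy; have ar' := abs_lt _ _ ea' Wy'.
have h1 : ch (a - a') = ch a * ch a' - sh a * sh a' by rewrite chD chN shN; ring.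
have h2 : ch (a - a') <= ch (2 * rho).
  rewrite leNgt ch_lt_norm -leNgt [X in _ <= X]ger0_norm //.
  by apply: le_trans (ler_normB _ _) _; lra.
have h3 : ch a * ch a' <= ch rho ^+ 2.
  have l1 : ch a <= ch rho by rewrite leNgt ch_lt_norm -leNgt [X in _ <= X]gtr0_norm // ltW.
  have l2 : ch a' <= ch rho by rewrite leNgt ch_lt_norm -leNgt [X in _ <= X]gtr0_norm // ltW.
  by rewrite expr2; apply: ler_pM => //; exact: ltW (ch_gt0 _).
have : ch d <= ch (t - t').
  rewrite de -lerBrDl /kap ler_pdivrMr //.
  have : ch a * ch a' * (ch (t - t') - 1) <= ch rho ^+ 2 * (ch (t - t') - 1).
    by rewrite ler_wpM2r // subr_ge0 ch_ge1.
  lra.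
by rewrite leNgt ch_lt_norm -leNgt (ger0_norm d0).
Qed.

Hypothesis not_one_sided : forall u (sg : R), sg = 1 \/ sg = -1 ->
  ~ forall y, O y -> `|Wc u y| <= K -> Wc u y = sg * K.
Hypothesis generic : forall y, O y -> `|Wc u0 y| <> K.

Definition gap N v : Prop := forall y, O y -> `|Tc v y| <= N -> K <= `|Wc v y|.

(** Limits of the given geodesic along which the gaps grow to infinity. *)
Definition limit_gap : set (SL2 R) := [set u | forall V : set (SL2 R), nbhs u V -> forall N,
  exists s g, [/\ G g, V (flow s * u0 * g)%g & gap N (flow s * u0 * g)%g]].

Lemma limit_gap_closed u :
  (forall V, nbhs u V -> exists2 v, V v & limit_gap v) -> limit_gap u.
Proof.
move=> h V uV N; have [v Vv Lv] := h _ (nbhs_interior uV).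
have [s [g [Gg hv hg]]] := Lv _ (Vv : nbhs v V) N.
by exists s, g.
Qed.

Lemma gap_act s g v N : G g -> gap (N + `|s|) v -> gap N (flow s * v * g)%g.
Proof.
move=> Gg hv y Oy; rewrite TcM Tc_flow WcM Wc_flow => h.
apply: hv; first exact: do_act HO _ _ Gg Oy.
have := ler_normB (Tc v (moebius g y) + s) s; rewrite addrK; lra.
Qed.

Lemma limit_gap_act s g u : G g -> limit_gap u -> limit_gap (flow s * u * g)%g.
Proof.
move=> Gg Lu V uV N.
have cv : (fun v => flow s * v * g)%g @ nbhs u --> (flow s * u * g)%g.
  apply: cvg_slM; [exact: cvg_mull|exact: cvg_cst].
have [s' [g' [Gg' hV hg]]] := Lu _ (cv _ uV) (N + `|s|).
exists (s + s'), (g' * g)%g.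
have <- : (flow s * (flow s' * u0 * g') * g = flow (s + s') * u0 * (g' * g))%g.
  by rewrite -flowD !mulgA.
by split; [exact: do_mul HO _ _ Gg' Gg|exact: hV|exact: gap_act].
Qed.

Lemma limit_gapP u y : limit_gap u -> O y -> K <= `|Wc u y|.
Proof.
move=> Lu Oy; rewrite leNgt; apply/negP => h.
have h1 := near_Wc_lt h.
have h2 : \forall v \near u, `|Tc v y| < `|Tc u y| + 1 by apply: near_Tc_lt; rewrite ltrDl.
have [s [g [Gg [a b] hg]]] := Lu _ (filterI h1 h2) (`|Tc u y| + 1).
by have := hg y Oy (ltW b); rewrite leNgt a.
Qed.

(** The charts centred in longer and longer gaps can be moved by the lattice to a
    compact set. *)
Lemma limit_gap_nonempty :
  ~ (exists e, 0 < e /\ forall t, exists2 s, strip O K u0 s & `|t - s| <= e) ->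
  limit_gap !=set0.
Proof.
move=> h; have [B hB] := do_cocompact HO.
have gaps N : exists2 v, bnd B v & gap N v /\ exists s g, G g /\ v = (flow s * u0 * g)%g.
  have [t ht] : exists t, forall s, strip O K u0 s -> `|N| + 1 < `|t - s|.
    apply: contrapT => nt; apply: h; exists (`|N| + 1); split; first by rewrite ltr_wpDl.
    move=> t; apply: contrapT => ns; apply: nt; exists t => s hs.
    by rewrite ltNge; apply/negP => le; apply: ns; exists s.
  have [g Gg gB] := hB (flow (- t) * u0)%g.
  exists (flow (- t) * u0 * g)%g => //; split; last by exists (- t), g.
  move=> y Oy; rewrite TcM Tc_flow WcM Wc_flow => hT; rewrite leNgt; apply/negP => hW.
  have := ht (Tc u0 (moebius g y)).
  have st : strip O K u0 (Tc u0 (moebius g y)).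
    by exists (moebius g y) => //; exact: do_act HO _ _ Gg Oy.
  move=> /(_ st); rewrite distrC ltNge (le_trans hT) //.
  by rewrite (le_trans (ler_norm N)) // lerDl.
pose D N := [set v | [/\ bnd B v, gap N v & exists s g, G g /\ v = (flow s * u0 * g)%g]].
have FF : ProperFilter (filter_from [set: R] D).
  apply: filter_from_proper; last first.
    by move=> N _; have [v vB [gv sv]] := gaps N; exists v.
  apply: filter_from_filter; first by exists 0.
  move=> N M _ _; exists (Num.max N M) => // v [vB gv sv].
  by split; split=> // y Oy hT; apply: gv => //; rewrite (le_trans hT) // le_max lexx ?orbT.
have [u [_ uc]] : bnd B `&` cluster (filter_from [set: R] D) !=set0.
  by apply: compact_bnd; exists 0 => // v [].
exists u => V uV N.
have DN : filter_from [set: R] D (D N) by exists N.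
have [v [[vB gv [s [g [Gg ve]]]] Vv]] := uc (D N) V DN uV.
by exists s, g; rewrite -ve.
Qed.

(** A minimal nonempty closed set that is invariant under the lattice and the
    forward flow consists of recurrent points. Zorn's lemma is applied to the
    complement; cocompactness keeps the intersection of a chain nonempty. *)
Lemma recurrent_limit_gap : limit_gap !=set0 -> exists2 h, limit_gap h &
  forall V : set (SL2 R), nbhs h V -> forall N, exists s g, [/\ N <= s, G g & V (flow (- s) * h * g)%g].
Proof.
move=> [u1 Lu1].
pose inv (V : set (SL2 R)) := [/\ open V, forall v g, G g -> V (v * g)%g -> V v
  & forall v s, 0 <= s -> V (flow (- s) * v)%g -> V v].
pose P (V : set (SL2 R)) := inv V /\ exists2 v, limit_gap v & ~ V v.
have [B hB] := do_cocompact HO.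
have chain (F : set (set (SL2 R))) : F `<=` P -> total_on F subset -> P (\bigcup_(X in F) X).
  move=> FP Ft; split.
    split.
    - by apply: bigcup_open => V /FP[[]].
    - by move=> v g Gg [V FV Vv]; exists V => //; have [[_ h _] _] := FP V FV; exact: h Gg Vv.
    - by move=> v s s0 [V FV Vv]; exists V => //; have [[_ _ h] _] := FP V FV; exact: h s0 Vv.
  have [[V0 FV0]|F0] := pselect (F !=set0); last first.
    by exists u1 => // -[V FV _]; apply: F0; exists V.
  pose D V := [set v | [/\ limit_gap v, bnd B v & ~ V v]].
  have FF : ProperFilter (filter_from F D).
    apply: filter_from_proper; last first.
      move=> V FV; have [[_ hg _] [v Lv nV]] := FP V FV; have [g Gg gB] := hB v.
      exists (v * g)%g; split=> // [|Vg]; last exact: nV (hg _ _ Gg Vg).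
      by have := @limit_gap_act 0 _ _ Gg Lv; rewrite flow0 mul1g.
    apply: filter_from_filter; first by exists V0.
    move=> V V' FV FV'; have [VV'|VV'] := Ft V V' FV FV'.
      by exists V' => // v [Lv Bv nV]; split; split=> // /VV'.
    by exists V => // v [Lv Bv nV]; split; split=> // /VV'.
  have FD V : F V -> filter_from F D (D V) by move=> FV; exists V.
  have [p [_ pc]] : bnd B `&` cluster (filter_from F D) !=set0.
    by apply: compact_bnd; exists V0 => // v [].
  exists p.
    apply: limit_gap_closed => V pV; have [v [[Lv _ _] Vv]] := pc _ _ (FD _ FV0) pV.
    by exists v.
  move=> [V FV Vp]; have [[oV _ _] _] := FP V FV.
  by have [v [[_ _ nV] Vv]] := pc _ _ (FD _ FV) (open_nbhs_nbhs (conj oV Vp)).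
have [A [[[oA gA sA] [h Lh nA]] Amax]] := Zorn_bigcup chain.
(* Were h not to return to V, the union of A with the charts that come to the
   interior of V would be larger, and would still miss the forward orbit of h
   from the time N on. *)
exists h => // V hV N; apply: contrapT => nrec.
pose V0 := interior V.
pose U : set (SL2 R) := [set v | exists s g, [/\ 0 <= s, G g & V0 (flow (- s) * v * g)%g]].
have hU : U h.
  exists 0, 1%g; split=> //; first exact: dense_orbit1.
  by rewrite oppr0 flow0 mul1g mulg1; exact: nbhs_singleton (nbhs_interior hV).
have PU : P (A `|` U).
  split; first split.
  - apply: openU => //; rewrite openE => v [s [g [s0 Gg hv]]].
    have cv : (fun v => flow (- s) * v * g)%g @ nbhs v --> (flow (- s) * v * g)%g.
      by apply: cvg_slM; [exact: cvg_mull|exact: cvg_cst].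
    have oV0 : nbhs (flow (- s) * v * g)%g V0 by apply: open_nbhs_nbhs; split=> //; exact: open_interior.
    by apply: (@filterS _ (nbhs v) _ _ _ _ (cv _ oV0)) => v' /= hv'; exists s, g.
  - move=> v g Gg [Av|[s [g' [s0 Gg' hv]]]]; first by left; exact: gA Gg Av.
    by right; exists s, (g * g')%g; split=> //; [exact: do_mul HO _ _ Gg Gg'|rewrite mulgA -(mulgA (flow _) v g)].
  - move=> v s s0 [Av|[s' [g' [s0' Gg' hv]]]]; first by left; exact: sA s0 Av.
    right; exists (s + s'), g'; split=> //; first exact: addr_ge0.
    by move: hv; rewrite mulgA flowD -opprD [s' + s]addrC.
  pose M := Num.max N 0.
  exists (flow (- M) * h)%g.
    by have := @limit_gap_act (- M) _ _ dense_orbit1 Lh; rewrite mulg1.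
  have M0 : 0 <= M by rewrite le_max lexx orbT.
  case=> [Am|[s [g [s0 Gg hv]]]]; first exact: nA (sA _ _ M0 Am).
  apply: nrec; exists (M + s), g; split=> //.
    by rewrite (le_trans _ (_ : M <= _)) ?lerDl // le_max lexx.
  by move: hv; rewrite mulgA flowD -opprD [s + M]addrC; exact: interior_subset.
apply: (Amax (A `|` U)) => //; split; first by move=> v; left.
by move=> /(_ h (or_intror hU)).
Qed.

Definition touch_free (a : R) j v : Prop := forall y, O y -> `|Tc v y| <= j -> Wc v y <> a.

Lemma near_touch_free a j u : touch_free a j u -> \forall v \near u, touch_free a j v.
Proof.
move=> hu; have cid : (fun v => v) @ nbhs u --> u by exact: cvg_id.
have : \forall v \near u, forall y, O y -> `|Tc v y| <= j -> `|Wc v y| <= `|a| -> Wc v y <> a.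
  apply: (near_region (do_finite HO) cid) => y Oy.
  have [ty|ty] := leP `|Tc u y| j.
    have cW : (fun v => Wc v y : R) @ u --> (Wc u y : R) by exact: cvg_Wc y cid.
    have cN : (fun v => `|Wc v y - a| : R) @ u --> (`|Wc u y - a| : R).
      exact: (cvg_norm (cvgB cW (cvg_cst a))).
    have : \forall v \near u, 0 < `|Wc v y - a|.
      by apply: (cvgr_gt _ cN); rewrite normr_gt0 subr_eq0; exact/eqP/(hu y).
    by apply: filterS => v; rewrite normr_gt0 subr_eq0 => /eqP.
  have cT : (fun v => `|Tc v y| : R) @ u --> (`|Tc u y| : R) by exact: cvg_normT y cid.
  have : \forall v \near u, j < `|Tc v y| by apply: (cvgr_gt _ cT); exact: ty.
  by apply: filterS => v o; rewrite leNgt o.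
apply: filterS => v hv y Oy ty e; apply: (hv y Oy ty) => //; by rewrite e.
Qed.

(** Closed balls, so that a limit of points of nested balls stays in all of them. *)
Definition cball u (e : R) : set (SL2 R) := [set v | forall i j, `|u i j - v i j| <= e].

Lemma cball_closed u e v : (forall V, nbhs v V -> exists2 w : SL2 R, V w & cball u e w) -> cball u e v.
Proof.
move=> h i j; rewrite leNgt; apply/negP => lt.
have cw' : (fun w : SL2 R => `|u i j - w i j| : R) @ v --> (`|u i j - v i j| : R).
  have c1 : (fun w : SL2 R => u i j - w i j : R) @ v --> (u i j - v i j : R).
    exact: (cvgB (cvg_cst _) (@continuous_entry R i j v)).
  exact: (cvg_norm c1).
have : nbhs v [set k : SL2 R | e < `|u i j - k i j|] by apply: (cvgr_gt _ cw'); exact: lt.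
by move=> /h[k /= lk /(_ i j)]; rewrite leNgt lk.
Qed.

Lemma cball_shrink u (V : set (SL2 R)) : nbhs u V -> exists2 e, 0 < e & cball u e `<=` V.
Proof.
move=> /nbhs_sl[e e0 h]; exists (e / 2); first by rewrite divr_gt0.
by move=> v uv; apply: h => i j; rewrite (le_lt_trans (uv i j)) // ltr_pdivrMr // ltr_pMr // ltr1n.
Qed.

Lemma cball_nbhs u e : 0 < e -> nbhs u (cball u e).
Proof. by move=> e0; apply/nbhs_sl; exists e => // v uv i j; exact: ltW. Qed.

(** If, on a recurrent geodesic, the contacts on one side stop, then nested
    neighbourhoods of its translates shrink to a limit without any contact on
    that side. *)
Lemma recurrent_touches h (sg b : R) : sg = 1 \/ sg = -1 -> limit_gap h ->
  (forall V : set (SL2 R), nbhs h V -> forall N, exists s g, [/\ N <= s, G g & V (flow (- s) * h * g)%g]) ->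
  exists y, [/\ O y, b < Tc h y & Wc h y = sg * K].
Proof.
move=> sg1 Lh rec; apply: contrapT => nt.
have free y : O y -> b < Tc h y -> Wc h y <> sg * K.
  by move=> Oy by_ e; apply: nt; exists y.
pose good u := exists s g, [/\ 0 <= s, G g & u = (flow (- s) * h * g)%g].
have step u V j : good u -> nbhs u V -> exists u', [/\ good u', V u' & touch_free (sg * K) j u'].
  move=> [s [g [s0 Gg ue]]] uV.
  have cv : (fun v => flow (- s) * v * g)%g @ nbhs h --> (flow (- s) * h * g)%g.
    by apply: cvg_slM; [exact: cvg_mull|exact: cvg_cst].
  rewrite ue in uV.
  have [s' [g' [s'N Gg' hV]]] := rec _ (cv _ uV) (`|b| + `|j| + 1).
  have ue' : (flow (- s) * (flow (- s') * h * g') * g = flow (- (s + s')) * h * (g' * g))%g.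
    by rewrite opprD -flowD !mulgA.
  have s'0 : 0 <= s' by apply: le_trans s'N; rewrite !addr_ge0.
  exists (flow (- (s + s')) * h * (g' * g))%g; split.
  - by exists (s + s'), (g' * g)%g; split; [exact: addr_ge0|exact: do_mul HO _ _ Gg' Gg|].
  - by rewrite -ue'.
  - move=> y Oy; rewrite TcM Tc_flow WcM Wc_flow => ty.
    apply: free; first exact: do_act HO _ _ (do_mul HO Gg' Gg) Oy.
    have := ler_norm b; have := ler_norm j; move: ty; rewrite ler_norml => /andP[]; lra.
pose St := {p : SL2 R * R | good p.1 /\ 0 < p.2}.
have next (st : St) : forall j, exists st' : St, cball (sval st').1 (sval st').2 `<=` cball (sval st).1 (sval st).2 /\
    forall v, cball (sval st').1 (sval st').2 v -> touch_free (sg * K) j v.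
  move=> j; case: st => -[u e] [/= gu e0].
  have [u' [gu' eu' fu']] := step u _ j gu (cball_nbhs u (divr_gt0 e0 (ltr0Sn R 1))).
  have [e' e'0 he'] := cball_shrink (near_touch_free fu').
  have m0 : 0 < Num.min e' (e / 2) by rewrite lt_min e'0 divr_gt0.
  exists (exist _ (u', Num.min e' (e / 2)) (conj gu' m0)) => /=; split.
    move=> v uv i k; have := eu' i k; have := uv i k; rewrite le_min => /andP[_ h1] h2.
    by rewrite -(subrKA (u' i k)) (le_trans (ler_normD _ _)) // [X in _ <= X]splitr lerD.
  move=> v uv; apply: he' => i k; have := uv i k; rewrite le_min => /andP[h1 _] //.
have /choice[f fP] : forall sj : St * nat, exists st' : St,
    cball (sval st').1 (sval st').2 `<=` cball (sval sj.1).1 (sval sj.1).2 /\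
    forall v, cball (sval st').1 (sval st').2 v -> touch_free (sg * K) sj.2%:R v.
  by move=> [st j]; exact: next.
have gh : good h.
  by exists 0, 1%g; split=> //; [exact: dense_orbit1|rewrite oppr0 flow0 mul1g mulg1].
pose st0 : St := exist _ (h, 1) (conj gh ltr01).
pose st := fix st n := if n is m.+1 then f (st m, m) else st0.
pose C n := cball (sval (st n)).1 (sval (st n)).2.
have CS n : C n.+1 `<=` C n by have [] := fP (st n, n).
have Cm n m : C (n + m)%N `<=` C n.
  by elim: m => [|m IH]; rewrite ?addn0 // addnS; exact: subset_trans (CS _) IH.
pose D n := [set v | C n v /\ good v].
have FF : ProperFilter (filter_from [set: nat] D).
  apply: filter_from_proper; last first.
    move=> n _; have [gn en] := svalP (st n); exists (sval (st n)).1; split=> //.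
    by move=> i j; rewrite subrr normr0 ltW.
  apply: filter_from_filter; first by exists 0%N.
  move=> n m _ _; exists (n + m)%N => // v [Cv gv]; split; split=> //; first exact: Cm Cv.
  by apply: (Cm m n); rewrite addnC.
have FD n : filter_from [set: nat] D (D n) by exists n.
have [k [_ kc]] : bnd (\sum_i \sum_j `|h i j| + 1) `&` cluster (filter_from [set: nat] D) !=set0.
  apply: compact_bnd; exists 0%N => // v [Cv _] i j.
  have := Cv i j; rewrite /= distrC => hv.
  have : `|h i j| <= \sum_i \sum_j `|h i j|.
    rewrite (bigD1 i) //= (bigD1 j) //= -addrA lerDl addr_ge0 // sumr_ge0 // => *.
    by rewrite sumr_ge0.
  have := ler_normD (v i j - h i j) (h i j); rewrite subrK; lra.
have Lk : limit_gap k.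
  apply: limit_gap_closed => V kV; have [v [[_ [s [g [s0 Gg ->]]]] Vv]] := kc _ _ (FD 0%N) kV.
  by exists (flow (- s) * h * g)%g => //; exact: limit_gap_act.
have Ck n : C n k.
  apply: cball_closed => V kV; have [v [[Cv _] Vv]] := kc _ _ (FD n) kV.
  by exists v.
have freek y : O y -> Wc k y <> sg * K.
  move=> Oy; pose n := Num.bound `|Tc k y|.
  have [_ /(_ k (Ck n.+1) y Oy)] := fP (st n, n); apply.
  by rewrite ltW // archi_boundP.
have sg1' : - sg = 1 \/ - sg = -1 by case: sg1 => ->; rewrite ?opprK; [right|left].
apply: (not_one_sided sg1') => y Oy Wy.
have e : `|Wc k y| = K by apply/le_anti; rewrite Wy (limit_gapP Lk Oy).
have := freek y Oy; have := e; rewrite mulNr.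
case: (ger0P (Wc k y)) => _ <-; case: sg1 => ->; rewrite ?mul1r ?mulN1r ?opprK // => nn; exfalso; exact: nn.
Qed.

(** On a recurrent limit the contacts alternate, so the dense geodesic, which
    comes close to it while avoiding the disks, would have to coincide with
    it. *)
Lemma no_limit_gap : ~ (limit_gap !=set0).
Proof.
move=> /recurrent_limit_gap[h Lh rec].
have K0 := K_gt0.
have [y1 [Oy1 _ W1]] := recurrent_touches 0 (or_introl erefl) Lh rec.
have [y2 [Oy2 T2 W2]] := recurrent_touches (Tc h y1) (or_intror erefl) Lh rec.
have [y3 [Oy3 T3 W3]] := recurrent_touches (Tc h y2) (or_introl erefl) Lh rec.
rewrite mul1r in W1 W3; rewrite mulN1r in W2.
have cid : (fun v => v) @ nbhs h --> h by exact: cvg_id.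
have cW y : (fun v => Wc v y : R) @ h --> (Wc h y : R) by exact: cvg_Wc y cid.
have n1 : \forall v \near h, 0 < Wc v y1 by apply: (cvgr_gt _ (cW y1)); rewrite W1.
have n2 : \forall v \near h, Wc v y2 < 0 by apply: (cvgr_lt _ (cW y2)); rewrite W2 oppr_lt0.
have n3 : \forall v \near h, 0 < Wc v y3 by apply: (cvgr_gt _ (cW y3)); rewrite W3.
pose N := `|Tc h y1| + `|Tc h y2| + `|Tc h y3| + 1.
have nT y : `|Tc h y| < N -> \forall v \near h, `|Tc v y| < N by exact: near_Tc_lt.
have := normr_ge0 (Tc h y1); have := normr_ge0 (Tc h y2); have := normr_ge0 (Tc h y3).
move=> p3 p2 p1.
have t1 : \forall v \near h, `|Tc v y1| < N by apply: nT; rewrite /N; lra.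
have t2 : \forall v \near h, `|Tc v y2| < N by apply: nT; rewrite /N; lra.
have t3 : \forall v \near h, `|Tc v y3| < N by apply: nT; rewrite /N; lra.
have cg : (fun v => v * h^-1)%g @ nbhs h --> (h * h^-1)%g by exact: cvg_mulr.
rewrite mulgV in cg.
have e i j : (fun v => (v * h^-1)%g i j : R) @ nbhs h --> ((1%g : SL2 R) i j : R) by exact: cvg_entry cg.
have a0 : \forall v \near h, 0 < (v * h^-1)%g 0 0 by apply: (cvgr_gt _ (e 0 0)); rewrite mxE.
have d0 : \forall v \near h, 0 < (v * h^-1)%g 1 1 by apply: (cvgr_gt _ (e 1 1)); rewrite mxE.
have hn : \forall v \near h, [/\ [/\ 0 < Wc v y1, Wc v y2 < 0 & 0 < Wc v y3],
   [/\ `|Tc v y1| < N, `|Tc v y2| < N & `|Tc v y3| < N] &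
   0 < (v * h^-1)%g 0 0 /\ 0 < (v * h^-1)%g 1 1].
  near=> v; split; [split|split|split]; near: v; assumption.
have [s [g [Gg [[q1 q2 q3] [r1 r2 r3] [a1 d1]] hg]]] := Lh _ hn N.
set v := (flow s * u0 * g)%g in q1 q2 q3 r1 r2 r3 a1 d1 hg.
have mv y : moebius (v * h^-1)%g (moebius h y) = moebius v y.
  by rewrite -moebiusM mulgVK.
have [||||||||||b0 c0] := @three_point R 1 K (v * h^-1)%g (moebius h y1) (moebius h y2) (moebius h y3) K0
  (or_introl erefl); rewrite ?mv ?mul1r //.
- by have := hg y1 Oy1 (ltW r1); rewrite gtr0_norm.
- by have := hg y2 Oy2 (ltW r2); rewrite ltr0_norm.
- by have := hg y3 Oy3 (ltW r3); rewrite gtr0_norm.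
apply: (generic (do_act HO Gg Oy1)).
rewrite -(Wc_flow s) -WcM -/v /Wc -(mv y1) W_moebius_diag // -/(Wc h y1) W1.
exact: gtr0_norm.
Unshelve. all: by end_near. Qed.

(** Without relative density the gaps would have a limit. *)
Lemma delone_of_conditions : is_delone (strip O K u0).
Proof.
have [d d0 hd] := strip_separated.
have [e [e0 he]] : exists e, 0 < e /\ forall t, exists2 s, strip O K u0 s & `|t - s| <= e.
  by apply: contrapT => /limit_gap_nonempty; exact: no_limit_gap.
by exists e, d; split=> //; exact: hd.
Qed.

End Gap.
End RelativeDensity.

(** * A closing lemma for matrices *)

Section Closing.
Context {R : realType}.
Implicit Types (g u v h k : SL2 R) (t s r : R).

Lemma small_root (A B C eta : R) : 0 < eta -> eta <= 1 / 100 -> `|A| <= eta -> `|C| <= eta ->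
  1 / 3 <= B -> exists2 p, `|p| <= 6 * eta & A * p ^+ 2 + B * p + C = 0.
Proof.
move=> e0 e1 hA hC hB.
have A1 : `|A * (6 * eta) ^+ 2| <= eta / 2.
  rewrite normrM (ger0_norm (sqr_ge0 _)).
  apply: (@le_trans _ _ (eta * (6 * eta) ^+ 2)); first by rewrite ler_wpM2r ?sqr_ge0.
  by have := mulr_ge0 (ltW e0) (ltW e0); nra.
have Be : 2 * eta <= B * (6 * eta).
  have : 1 / 3 * (6 * eta) <= B * (6 * eta) by rewrite ler_wpM2r // mulr_ge0 // ltW.
  lra.
move: A1 hC; rewrite !ler_norml => /andP[A1 A2] /andP[C1 C2].
pose P : {poly R} := A *: 'X^2 + B *: 'X + C%:P.
have PE x : P.[x] = A * x ^+ 2 + B * x + C by rewrite /P !hornerE.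
have [||p hp /eqP] := @poly_ivt _ P (- (6 * eta)) (6 * eta).
- lra.
- by rewrite !PE sqrrN mulrN; apply/andP; split; lra.
by rewrite PE => pe; exists p => //; rewrite ler_norml.
Qed.

Definition close1 (eta : R) g : Prop :=
  [/\ `|g 0 0 - 1| <= eta, `|g 0 1| <= eta, `|g 1 0| <= eta & `|g 1 1 - 1| <= eta].

Lemma nbhs_close1 (V : set (SL2 R)) : nbhs (1%g : SL2 R) V ->
  exists2 eta, 0 < eta & forall g, close1 eta g -> V g.
Proof.
move=> /nbhs_sl[e e0 h]; exists (e / 2); first by rewrite divr_gt0.
have e2 : e / 2 < e by rewrite ltr_pdivrMr // ltr_pMr // ltr1n.
move=> g [h1 h2 h3 h4]; apply: h => i j; apply: le_lt_trans e2.
by case: (I2_cases i) => ->; case: (I2_cases j) => ->; rewrite mxE /= ?sub0r ?normrN // distrC.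
Qed.

Lemma close1_nbhs (eta : R) : 0 < eta -> nbhs (1%g : SL2 R) (close1 eta).
Proof.
move=> e0; apply/nbhs_sl; exists eta => // g h.
have := h 0 0; have := h 0 1; have := h 1 0; have := h 1 1; rewrite !mxE /=.
by rewrite !sub0r !normrN ![`|1 - _|]distrC => h1 h2 h3 h4; split; exact: ltW.
Qed.

(** The product of a long translation along the axis and of a matrix close to 1 is
    hyperbolic and its axis is close to the given one, onto which c moves it. *)
Lemma closing_matrix (eta0 : R) : 0 < eta0 -> exists2 eta, 0 < eta &
  forall w t, close1 eta w -> 1 <= t ->
  exists c s, [/\ s != 0, close1 eta0 c & (c * (flow (- t) * w) = flow s * c)%g].
Proof.
move=> e0; pose eta := Num.min (1 / 100) (eta0 / 100).
have eta_gt0 : 0 < eta by rewrite lt_min !divr_gt0.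
have eta1 : eta <= 1 / 100 by rewrite ge_min lexx.
have eta2 : eta <= eta0 / 100 by rewrite ge_min lexx orbT.
exists eta => // w t [w1 w2 w3 w4] t1.
pose E := expR (t / 2).
have Ei : expR (- (t / 2)) = E^-1 by rewrite expRN.
have E1 : 3 / 2 <= E.
  have := expR_ge1Dx (t / 2); rewrite -/E; lra.
have E0 : 0 < E by lra.
pose eps := E ^- 2.
have eps0 : 0 < eps by rewrite invr_gt0 exprn_gt0.
have eps1 : eps <= 4 / 9.
  have ee : eps * E ^+ 2 = 1 by rewrite /eps mulVf // expf_neq0 // gt_eqF.
  have E2 : 9 / 4 <= E ^+ 2 by nra.
  have h9 : eps * (9 / 4) <= eps * E ^+ 2 by rewrite ler_wpM2l // ltW.
  lra.
have n1 := ler_norm (w 0 0 - 1); have n1' := ler_norm (- (w 0 0 - 1)).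
have n4 := ler_norm (w 1 1 - 1); have n4' := ler_norm (- (w 1 1 - 1)).
rewrite normrN in n1'; rewrite normrN in n4'.
have B0 : 1 / 3 <= w 1 1 - w 0 0 * eps by nra.
have be : `|w 0 1 * eps| <= eta.
  by rewrite normrM (gtr0_norm eps0); have := normr_ge0 (w 0 1); nra.
(* The homography of c sends -p to 0 and -1/q to infinity; the equations say that
   these are the fixed points of flow (- t) * w. Both equations are small
   perturbations of linear ones, since e^-t is far from 1. *)
have [p p1 pe] : exists2 p, `|p| <= 6 * eta & - w 1 0 * p ^+ 2 + (w 1 1 - w 0 0 * eps) * p + w 0 1 * eps = 0.
  by apply: small_root; rewrite ?normrN.
have [q q1 qe] : exists2 q, `|q| <= 6 * eta & w 0 1 * eps * q ^+ 2 + (w 1 1 - w 0 0 * eps) * q + - w 1 0 = 0.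
  by apply: small_root; rewrite ?normrN.
have pq : `|p * q| <= eta / 2.
  rewrite normrM; apply: (@le_trans _ _ ((6 * eta) * (6 * eta))); first exact: ler_pM.
  nra.
pose D := 1 - p * q.
have [pq1 pq2] : - (eta / 2) <= p * q /\ p * q <= eta / 2 by move: pq; rewrite ler_norml => /andP[].
have D1 : 9 / 10 <= D by rewrite /D; lra.
have D0 : 0 < D by lra.
have detc : D^-1 * 1 - (p / D) * q = 1 by rewrite /D; field; rewrite -/D gt_eqF.
pose lam := w 1 1 * E + q * w 0 1 / E.
have Einv : 0 < E^-1 by rewrite invr_gt0.
have Einv1 : E^-1 <= 1 by rewrite invf_le1 //; lra.
have qw : `|q * w 0 1 / E| <= 1 / 10.
  rewrite normrM normrM (gtr0_norm Einv).
  have h1 : `|q| * `|w 0 1| <= 6 * eta * eta by apply: ler_pM.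
  have h2 : 0 <= `|q| * `|w 0 1| by rewrite mulr_ge0.
  nra.
have lam1 : 1 < lam.
  by move: qw; rewrite ler_norml /lam => /andP[h _]; nra.
have lam0 : 0 < lam by lra.
pose s := - 2 * ln lam.
have es : expR (- (s / 2)) = lam.
  by rewrite (_ : - (s / 2) = ln lam) ?lnK ?posrE // /s; field.
have es' : expR (s / 2) = lam^-1 by rewrite -es expRN invrK.
exists (sl2 detc), s; split.
- rewrite /s mulf_neq0 ?oppr_eq0 // gt_eqF // ln_gt0 //.
- rewrite /close1 !sl2C.
  have Dinv : 0 < D^-1 by rewrite invr_gt0.
  have Dinv2 : D^-1 <= 2 by rewrite -[2]invrK lef_pV2 ?posrE ?invr_gt0 //; lra.
  split.
  + have -> : D^-1 - 1 = p * q / D by rewrite /D; field; rewrite -/D gt_eqF.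
    rewrite normrM (gtr0_norm Dinv).
    have := normr_ge0 (p * q); nra.
  + rewrite normrM (gtr0_norm Dinv).
    have := normr_ge0 p; nra.
  + lra.
  + by rewrite subrr normr0 ltW.
have Dw := sl_det w.
have Emul : w 0 1 * eps = w 0 1 / E ^+ 2 by [].
have nE : E != 0 by rewrite gt_eqF.
have nD : D != 0 by rewrite gt_eqF.
have nl : lam != 0 by rewrite gt_eqF.
pose mu := w 0 0 / E + p * E * w 1 0.
have r1 : w 0 1 / E + p * E * w 1 1 = mu * p.
  have -> : w 0 1 / E + p * E * w 1 1 = mu * p +
     E * (- w 1 0 * p ^+ 2 + (w 1 1 - w 0 0 * eps) * p + w 0 1 * eps).
    by rewrite /mu /eps; field.
  by rewrite pe mulr0 addr0.
have r2 : q * w 0 0 / E + E * w 1 0 = lam * q.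
  have -> : q * w 0 0 / E + E * w 1 0 = lam * q -
     E * (w 0 1 * eps * q ^+ 2 + (w 1 1 - w 0 0 * eps) * q + - w 1 0).
    by rewrite /lam /eps; field.
  by rewrite qe mulr0 subr0.
have r3 : mu = lam^-1.
  have : mu * lam * D = D.
    transitivity (mu * lam - (mu * p) * (lam * q)); first by rewrite /D; ring.
    rewrite -r1 -r2.
    transitivity ((1 - p * q) * (w 0 0 * w 1 1 - w 0 1 * w 1 0)); last by rewrite Dw mulr1.
    by rewrite /mu /lam; field.
  by move=> /(canRL (mulfK nD)); rewrite divff // => /(canRL (mulfK nl)); rewrite mul1r.
apply: sl_eq; rewrite !sl_mulE !sl2C ?mulNr ?opprK -/E ?Ei ?es ?es' -?r3 ?(mul0r, mulr0, add0r, addr0) ?mul1r.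
- by rewrite /mu; field; rewrite nE nD.
- transitivity ((w 0 1 / E + p * E * w 1 1) / D); first by field; rewrite nE nD.
  by rewrite r1 mulrA.
- by rewrite -r2; field.
- by rewrite /lam; field.
Qed.

End Closing.

(** * Half-strips and aperiodicity *)

Section HalfStrip.
Context {R : realType} {O : set (H2 R)} {G : set (SL2 R)} {u0 : SL2 R}.
Hypothesis HO : dense_orbit O G u0.
Variables (K e d : R).
Hypothesis K0 : 0 < K.
Hypothesis HS : delone e d (strip O K u0).
Hypothesis generic : forall y, O y -> `|Wc u0 y| <> K.
Implicit Types (z w y : H2 R) (g u v h k : SL2 R) (t s r : R) (A : set (H2 R)).

(** The second clause starts from the closed strip of u and ends in the open one:
    over the times considered, u has no contacts, so that its strip is stable in
    turn. *)
Definition matched A v u r (eps : R) : Prop := forall y, O y ->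
  (`|Tc v y| <= r -> A y -> `|Wc u y| < K /\ `|Tc u y - Tc v y| < eps) /\
  (`|Tc u y| <= r -> `|Wc u y| <= K -> [/\ A y, `|Wc u y| < K & `|Tc u y - Tc v y| < eps]).

(** Only finitely many points of the orbit have bounded coordinates, so it is enough
    to follow each of them. *)
Lemma near_match (X : Type) (F : set_system X) {FF : Filter F} (f : X -> SL2 R) v A r eps :
  f @ F --> v -> 0 < eps ->
  (forall y, A y -> `|Wc v y| <= K) ->
  (forall y, O y -> A y -> `|Tc v y| <= r + 1 -> \forall x \near F, `|Wc (f x) y| < K) ->
  (forall y, O y -> ~ A y -> `|Tc v y| <= r + 1 -> `|Wc v y| <= K ->
     \forall x \near F, K < `|Wc (f x) y|) ->
  \forall x \near F, matched A v (f x) r eps.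
Proof.
move=> fv eps0 AK hA hnA.
have cW y : (fun x => `|Wc (f x) y| : R) @ F --> (`|Wc v y| : R) by exact: cvg_normW y fv.
have cT y : (fun x => `|Tc (f x) y| : R) @ F --> (`|Tc v y| : R) by exact: cvg_normT y fv.
have cTT y : \forall x \near F, `|Tc (f x) y - Tc v y| < eps.
  have cT' : (fun x => Tc (f x) y : R) @ F --> (Tc v y : R) by exact: cvg_Tc y fv.
  by move/cvgrPdist_lt : cT' => /(_ _ eps0); apply: filterS => x; rewrite distrC.
have r1 : r < r + 1 by rewrite ltrDl.
have [S fS hS] := chart_finite (do_finite HO) (\sum_i \sum_j `|v i j| + 1) r K.
have vB : bnd (\sum_i \sum_j `|v i j| + 1) v by exact: nbhs_singleton (bnd_nbhs v).
have fSO : finite_set [set y | [/\ O y, A y & `|Tc v y| <= r]].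
  by apply: sub_finite_set fS => y [Oy Ay Ty]; exact: hS vB _ Oy Ty (AK _ Ay).
have n1 : \forall x \near F, forall y, [set y | [/\ O y, A y & `|Tc v y| <= r]] y ->
    `|Wc (f x) y| < K /\ `|Tc (f x) y - Tc v y| < eps.
  apply: (near_finite fSO) => y [Oy Ay Ty].
  have h1 : \forall x \near F, `|Wc (f x) y| < K.
    by apply: hA => //; rewrite (le_trans Ty) // ltW.
  by near=> x; split; near: x; [exact: h1|exact: cTT].
have n2 : \forall x \near F, forall y, O y -> `|Tc (f x) y| <= r -> `|Wc (f x) y| <= K ->
    [/\ A y, `|Wc (f x) y| < K & `|Tc (f x) y - Tc v y| < eps].
  apply: (near_region (do_finite HO) fv) => y Oy.
  have [Ty|Ty] := leP `|Tc v y| (r + 1); last first.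
    have : \forall x \near F, r < `|Tc (f x) y| by apply: (cvgr_gt _ (cT y)); exact: lt_trans Ty.
    by apply: filterS => x o; rewrite leNgt o.
  have [Ay|nAy] := pselect (A y).
    have h1 := hA y Oy Ay Ty.
    near=> x => _ _; split=> //; near: x; [exact: h1|exact: cTT].
  have h1 : \forall x \near F, K < `|Wc (f x) y|.
    have [Wy|Wy] := leP `|Wc v y| K; first exact: hnA.
    by apply: (cvgr_gt _ (cW y)); exact: Wy.
  by apply: filterS h1 => x o _; rewrite leNgt o.
near=> x; move=> y Oy; split=> [Ty Ay|Ty Wy].
  have : forall y, [set y | [/\ O y, A y & `|Tc v y| <= r]] y ->
    `|Wc (f x) y| < K /\ `|Tc (f x) y - Tc v y| < eps by near: x; exact: n1.
  by apply.
have : forall y, O y -> `|Tc (f x) y| <= r -> `|Wc (f x) y| <= K ->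
    [/\ A y, `|Wc (f x) y| < K & `|Tc (f x) y - Tc v y| < eps] by near: x; exact: n2.
by apply.
Unshelve. all: by end_near. Qed.

Definition in_strip u : set (H2 R) := [set y | `|Wc u y| < K].
Definition in_half u : set (H2 R) := [set y | - K < Wc u y /\ Wc u y <= K].

(** The strip completed by one of its two boundary lines. A geodesic that touches
    disks has a strip that need not be a limit of strips of the dense geodesic;
    its half-strip always is one. *)
Definition halfstrip u : set R := [set t | exists2 y, O y & in_half u y /\ Tc u y = t].

Lemma near_match_strip v r eps : 0 < eps ->
  (forall y, O y -> `|Tc v y| <= r + 1 -> `|Wc v y| <> K) ->
  \forall u \near v, matched (in_strip v) v u r eps.
Proof.
move=> eps0 gen; have cid : (fun v => v) @ nbhs v --> v by exact: cvg_id.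
apply: (near_match cid eps0) => [y /ltW //|y Oy Wy Ty|y Oy nWy Ty Wy].
  exact: near_Wc_lt.
by exfalso; apply: nWy; rewrite /in_strip /= lt_neqAle Wy andbT; apply/eqP/gen.
Qed.

(** Pushing the geodesic to one side, by [parab b] with b < 0, turns the contacts
    on one side into transverse intersections and undoes those on the other side;
    the resulting geodesic has no contacts over a bounded time, so that its strip
    is stable and is approximated by the dense geodesic. *)
Lemma half_limit h r eps : 0 < eps -> exists s g, G g /\ matched (in_half h) h (flow s * u0 * g)%g r eps.
Proof.
move=> eps0; pose eps' := Num.min (eps / 2) 1.
have e'0 : 0 < eps' by rewrite lt_min divr_gt0 ?ltr01.
have e'1 : eps' <= 1 by rewrite ge_min lexx orbT.
have e'2 : eps' <= eps / 2 by rewrite ge_min lexx.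
have cs : (fun b => parab b * h)%g @ (0 : R)^'- --> h.
  move=> V hV; have h0 : nbhs (0 : R) [set b | V (parab b * h)%g] by exact: cvg_parab hV.
  exact: (@cvg_within _ (nbhs (0 : R)) _ _ _ h0).
have n1 : \forall b \near (0 : R)^'-, matched (in_half h) h (parab b * h)%g (r + 1 + 1) eps'.
  apply: (near_match cs e'0).
  - by move=> y [W1 W2]; rewrite ler_norml (ltW W1) W2.
  - move=> y Oy [W1 W2] _.
    have cW : (fun b => Wc (parab b * h)%g y : R) @ (0 : R)^'- --> (Wc h y : R) by exact: cvg_Wc y cs.
    have h1 : \forall b \near (0 : R)^'-, - K < Wc (parab b * h)%g y by apply: (cvgr_gt _ cW); exact: W1.
    near=> b; rewrite ltr_norml; apply/andP; split; first by near: b; exact: h1.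
    rewrite Wc_parab (lt_le_trans _ W2) // gtrDl ltr_pdivrMr ?hy_gt0 // mul0r.
    by near: b; exact: nbhs_left_lt.
  - move=> y Oy nA _ Wy.
    have Wh : Wc h y = - K.
      apply/le_anti; move: Wy; rewrite ler_norml => /andP[W1 W2]; rewrite W1 andbT leNgt.
      by apply/negP => W3; apply: nA; split.
    near=> b; rewrite Wc_parab Wh.
    have b0 : b / hy (moebius h y) < 0.
      by rewrite ltr_pdivrMr ?hy_gt0 // mul0r; near: b; exact: nbhs_left_lt.
    have KK := K0; have b1 : - K + b / hy (moebius h y) < - K by lra.
    by rewrite ltr0_norm; lra.
near (0 : R)^'- => b; have mb : matched (in_half h) h (parab b * h)%g (r + 1 + 1) eps' by near: b; exact: n1.
move: (parab b * h)%g mb => v mv.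
have gen y : O y -> `|Tc v y| <= r + 1 + 1 -> `|Wc v y| <> K.
  move=> Oy Ty e1; have [_ /(_ Ty)] := mv y Oy.
  by rewrite e1 lexx ltxx => /(_ isT)[].
have [s [g [Gg mu]]] := do_dense HO (near_match_strip e'0 gen).
exists s, g; split=> // y Oy; have [m1 m2] := mv y Oy; have [m3 m4] := mu y Oy.
have tri u : `|Tc v y - Tc h y| < eps' -> `|Tc u y - Tc v y| < eps' -> `|Tc u y - Tc h y| < eps.
  move=> h1 h2; rewrite -(subrKA (Tc v y)) (le_lt_trans (ler_normD _ _)) //; lra.
have bd (a1 a2 x : R) : `|a1| <= x -> `|a2 - a1| < eps' -> `|a2| <= x + 1.
  by move=> h1 h2; rewrite -(subrK a1 a2) (le_trans (ler_normD _ _)) //; lra.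
split.
- move=> Ty Ay.
  have r2 : r <= r + 1 + 1 by lra.
  have [W1 T1] := m1 (le_trans Ty r2) Ay.
  have [W2 T2] := m3 (bd _ _ _ Ty T1) W1.
  by split=> //; exact: tri T1 T2.
- move=> Ty Wy; have [|W1 W2 T2] := m4 _ Wy; first by rewrite (le_trans Ty) // lerDl.
  have [|A1 _ T1] := m2 _ (ltW W1); last by split=> //; exact: tri T1 T2.
  have := bd _ _ _ Ty; rewrite distrC in T2 => /(_ _ T2) h1.
  by rewrite (le_trans h1) // lerDl.
Unshelve. all: by end_near. Qed.

(** The half-strip is a limit of translates of the strip of the dense geodesic, with
    the same constants. *)
Lemma half_delone h : delone e d (halfstrip h).
Proof.
have [e0 d0 _ _] := HS; split=> //.
- move=> t; apply: contrapT => nh.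
  pose r := `|t| + e + 1.
  have [S fS hS] := chart_finite (do_finite HO) (\sum_i \sum_j `|h i j| + 1) r K.
  have hB : bnd (\sum_i \sum_j `|h i j| + 1) h by exact: nbhs_singleton (bnd_nbhs h).
  have fSO : finite_set [set y | [/\ O y, in_half h y & `|Tc h y| <= r]].
    apply: sub_finite_set fS => y [Oy [A1 A2] Ty].
    by apply: hS hB _ Oy Ty _; rewrite ler_norml (ltW A1) A2.
  have n1 : \forall a \near (0 : R)^'+, forall y, [set y | [/\ O y, in_half h y & `|Tc h y| <= r]] y ->
      e + a < `|t - Tc h y|.
    apply: (near_finite fSO) => y [Oy Ay _].
    have lt : e < `|t - Tc h y|.
      by rewrite ltNge; apply/negP => le; apply: nh; exists (Tc h y) => //; exists y.
    near=> a; rewrite addrC -ltrBrDr; near: a; apply: nbhs_right_lt; by rewrite subr_gt0.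
  near (0 : R)^'+ => a.
  have a0 : 0 < a by near: a; exact: nbhs_right_gt.
  have a1 : a < 1 by near: a; exact: nbhs_right_lt.
  have na : forall y, [set y | [/\ O y, in_half h y & `|Tc h y| <= r]] y -> e + a < `|t - Tc h y|.
    by near: a; exact: n1.
  have [s [g [Gg ms]]] := half_limit h (`|t| + e) a0.
  have [_ _ he _] := delone_flow HO HS s Gg.
  have [_ [y Oy [Wy <-]] ty] := he t.
  have [_ mu] := ms y Oy.
  have [|A1 _ T1] := mu _ (ltW Wy).
    by rewrite -(subKr t (Tc _ y)) (le_trans (ler_normB _ _)) // lerD2l.
  have : `|t - Tc h y| < e + a.
    by rewrite -(subrKA (Tc (flow s * u0 * g)%g y)) (le_lt_trans (ler_normD _ _)) // ler_ltD.
  move=> lt; have /na : [/\ O y, in_half h y & `|Tc h y| <= r].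
    split=> //; rewrite -(subKr t (Tc h y)) (le_trans (ler_normB _ _)) // /r; lra.
  by move=> lt2; have := lt_trans lt lt2; rewrite ltxx.
- move=> _ _ [y Oy [Ay <-]] [y' Oy' [Ay' <-]] ne.
  rewrite leNgt; apply/negP => lt.
  pose del := Num.min (`|Tc h y - Tc h y'|) (d - `|Tc h y - Tc h y'|) / 2.
  have del0 : 0 < del by rewrite divr_gt0 // lt_min subr_gt0 lt normr_gt0 subr_eq0 andbT; exact/eqP.
  have del1 : 2 * del <= `|Tc h y - Tc h y'| by rewrite /del mulrC mulfVK // ge_min lexx.
  have del2 : 2 * del <= d - `|Tc h y - Tc h y'| by rewrite /del mulrC mulfVK // ge_min lexx orbT.
  have [s [g [Gg ms]]] := half_limit h (`|Tc h y| + `|Tc h y'|) del0.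
  have t1 : `|Tc h y| <= `|Tc h y| + `|Tc h y'| by rewrite lerDl.
  have t2 : `|Tc h y'| <= `|Tc h y| + `|Tc h y'| by rewrite lerDr.
  have [W1 T1] := (ms y Oy).1 t1 Ay; have [W2 T2] := (ms y' Oy').1 t2 Ay'.
  have [_ _ _ hd] := delone_flow HO HS s Gg.
  set v := (flow s * u0 * g)%g in W1 T1 W2 T2 hd.
  have E : Tc v y - Tc v y' = (Tc v y - Tc h y) - (Tc v y' - Tc h y') + (Tc h y - Tc h y') by ring.
  have T3 : `|(Tc v y - Tc h y) - (Tc v y' - Tc h y')| < 2 * del.
    by rewrite (le_lt_trans (ler_normB _ _)) //; lra.
  have : d <= `|Tc v y - Tc v y'|.
    apply: hd; [by exists y|by exists y'|] => eT.
    move: E; rewrite eT subrr => /eqP; rewrite eq_sym addr_eq0 => /eqP E.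
    by move: T3; rewrite eT E normrN ltNge del1.
  rewrite E => /le_trans/(_ (ler_normD _ _)); lra.
Unshelve. all: by end_near. Qed.

Lemma expR2_inj (v : R) : expR v ^+ 2 = 1 -> v = 0.
Proof.
move=> h; have : expR (v + v) = expR 0 by rewrite expRD -expr2 h expR0.
by move=> /expR_inj h2; lra.
Qed.

(** As distinct projections are separated, a period v would be the difference of
    the projections of the same two points on all nearby geodesics.
    On the geodesics pushed by [parab b], this says that |z' + b|^2 equals
    e^2v |z + b|^2 for all small b, so that v = 0. *)
Lemma strip_aperiodic (v : R) : (forall t, strip O K u0 t -> strip O K u0 (t + v)) -> v = 0.
Proof.
move=> per; have [e0 d0 he hd] := HS.
have [_ [y Oy [Wy _]] _] := he 0.
have [y' Oy' [Wy' Ty']] : strip O K u0 (Tc u0 y + v) by apply: per; exists y.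
have cid u : (fun v => v) @ nbhs u --> u by exact: cvg_id.
have cT u x : (fun v => Tc v x : R) @ u --> (Tc u x : R) by exact: cvg_Tc x (cid u).
pose f (u : SL2 R) : R := Tc u y' - Tc u y - v.
have cf u : f @ u --> (f u : R) by exact: (cvgB (cvgB (cT u y') (cT u y)) (cvg_cst v)).
have cfn u : (fun k => `|f k| : R) @ u --> (`|f u| : R) by exact: (cvg_norm (cf u)).
have f0 : f u0 = 0 by rewrite /f Ty' addrAC addrK subrr.
have nd : \forall u \near u0, `|f u| < d by apply: (cvgr_lt _ (cfn u0)); rewrite f0 normr0.
have n1 := near_Wc_lt Wy; have n2 := near_Wc_lt Wy'.
have hnr : \forall u \near u0, [/\ `|f u| < d, `|Wc u y| < K & `|Wc u y'| < K].
  by near=> u; split; near: u; [exact: nd|exact: n1|exact: n2].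
have hi := nbhs_interior hnr.
have fz : \forall u \near u0, f u = 0.
  apply: filterS hi => u hu; apply/eqP; apply/negPn/negP => fu.
  have nf : \forall k \near u, 0 < `|f k| by apply: (cvgr_gt _ (cfn u)); rewrite normr_gt0.
  have hk : \forall k \near u, [/\ `|f k| < d, `|Wc k y| < K & `|Wc k y'| < K] /\ 0 < `|f k|.
    by near=> k; split; near: k; [exact: hu|exact: nf].
  have [s [g [Gg [[a1 a2 a3] a4]]]] := do_dense HO hk.
  have [_ _ _ hd'] := delone_flow HO HS s Gg.
  set k := (flow s * u0 * g)%g in a1 a2 a3 a4 hd'.
  have s1 : strip O K k (Tc k y + v).
    have [sy _] := @strip_flow R O G u0 HO K s u0 g (Tc k y) Gg.
    have [_ sv] := @strip_flow R O G u0 HO K s u0 g (Tc k y + v) Gg.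
    apply: sv; rewrite addrAC; apply: per; apply: sy.
    by exists y.
  have s2 : strip O K k (Tc k y') by exists y'.
  move: a1; rewrite ltNge => /negP; apply.
  have -> : f k = Tc k y' - (Tc k y + v) by rewrite /f; ring.
  apply: hd' => // e1; move: a4; rewrite /f e1.
  by rewrite [X in `|X|](_ : _ = 0) ?normr0 ?ltxx //; ring.
have nb : \forall b \near (0 : R), f (parab b * u0)%g = 0 by exact: (cvg_parab fz).
have /nbhs_ballP[r /= r0 hr] := nb.
have eq b : `|b| < r -> (hx (moebius u0 y') + b) ^+ 2 + hy (moebius u0 y') ^+ 2 =
    expR v ^+ 2 * ((hx (moebius u0 y) + b) ^+ 2 + hy (moebius u0 y) ^+ 2).
  move=> br; have /hr : ball (0 : R) r b by rewrite /ball /= sub0r normrN.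
  rewrite /f /Tc !moebiusM => /eqP; rewrite subr_eq0 subr_eq => /eqP eT.
  have t1 := expT (moebius (parab b) (moebius u0 y')).
  have t2 := expT (moebius (parab b) (moebius u0 y)).
  rewrite eT expRD exprMn t2 /hn !hx_parab !hy_parab in t1.
  exact: esym t1.
have b0 : `|r / 2| < r by rewrite gtr0_norm ?divr_gt0 // ltr_pdivrMr // ltr_pMr // ltr1n.
have := eq (r / 2) b0; have := eq (- (r / 2)); rewrite normrN => /(_ b0).
have := eq 0; rewrite normr0 => /(_ r0).
set E := expR v ^+ 2 => h1 h2 h3.
apply: expR2_inj; rewrite -/E.
have r2 : (r / 2) ^+ 2 != 0 by rewrite expf_neq0 // gt_eqF // divr_gt0.
apply: (mulIf r2); rewrite mul1r.
have : 2 * (r / 2) ^+ 2 = E * (2 * (r / 2) ^+ 2) by lra.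
lra.
Unshelve. all: by end_near. Qed.

End HalfStrip.
Arguments halfstrip {R} O K u _.
Arguments matched {R} O K A v u r eps.

(** * Periodic orbits in the rubber topology *)

Section Periodic.
Context {R : realType} {O : set (H2 R)} {G : set (SL2 R)} {u0 : SL2 R}.
Hypothesis HO : dense_orbit O G u0.
Variables (K e d : R).
Hypothesis K0 : 0 < K.
Hypothesis HS : delone e d (strip O K u0).
Hypothesis generic : forall y, O y -> `|Wc u0 y| <> K.
Implicit Types (z w y : H2 R) (g u v h k : SL2 R) (t s r : R).

(** Near any frame lies a tangent to a disk, obtained by moving the geodesic
    slightly so as to touch a disk far back; the dense geodesic touches no
    disk, so it can only accumulate there at unbounded times. *)
Lemma long_return u (V : set (SL2 R)) : nbhs u V -> forall N : R,
  exists s g, [/\ G g, N <= `|s| & V (flow s * u0 * g)%g].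
Proof.
move=> hV N; have [s1 [g1 [Gg1 V1]]] := do_dense HO (nbhs_interior hV).
set v1 := (flow s1 * u0 * g1)%g in V1.
have [_ _ he _] := delone_flow HO HS s1 Gg1; rewrite -/v1 in he.
have nb : \forall b \near (0 : R), interior V (parab b * v1)%g.
  by apply: (cvg_parab (u := v1)); exact: nbhs_interior.
have /nbhs_ballP[r /= r0 hr] := nb.
have rK : 0 < r / (4 * K) by rewrite divr_gt0 // mulr_gt0.
have [_ [y Oy [Wy <-]]] := he (ln (r / (4 * K)) - e).
rewrite ler_norml => /andP[h1 h2].
have Te : expR (Tc v1 y) <= r / (4 * K).
  rewrite -[X in _ <= X]lnK ?posrE // ler_expR; lra.
have hyT : hy (moebius v1 y) <= r / (4 * K).
  apply: le_trans Te; have := cwE (moebius v1 y).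
  rewrite /cw /Tc; set E := expR _; set Y := hy _ => cE.
  have Y0 : 0 < Y by exact: hy_gt0.
  have E0 : 0 < E by exact: expR_gt0.
  have c1 : 1 <= (E / Y) ^+ 2 by rewrite cE lerDl sqr_ge0.
  have q0 : 0 < E / Y by exact: divr_gt0.
  have c2 : 1 <= E / Y by nra.
  by move: c2; rewrite ler_pdivlMr // mul1r.
pose b := (K - Wc v1 y) * hy (moebius v1 y).
have Y0 := hy_gt0 (moebius v1 y).
move: (Wy); rewrite ltr_norml => /andP[W1 W2].
have b0 : 0 < b by rewrite mulr_gt0 // subr_gt0.
have br : b < r.
  have : b <= (2 * K) * (r / (4 * K)) by apply: ler_pM => //; [rewrite subr_ge0 ltW|exact: ltW|lra].
  have -> : 2 * K * (r / (4 * K)) = r / 2 by field; rewrite gt_eqF.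
  by move=> /le_lt_trans; apply; rewrite ltr_pdivrMr // ltr_pMr // ltr1n.
set p := (parab b * v1)%g.
have Vp : interior V p by apply: hr; rewrite /ball /= sub0r normrN gtr0_norm.
have Wp : Wc p y = K by rewrite Wc_parab /b mulfK ?gt_eqF // addrC subrK.
apply: contrapT => nret.
have [F fF hF] := chart_finite (do_finite HO) (\sum_i \sum_j `|u0 i j| + 1) (`|Tc p y| + 1 + `|N|) (K + 1).
have uB : bnd (\sum_i \sum_j `|u0 i j| + 1) u0 by exact: nbhs_singleton (bnd_nbhs u0).
have fFO : finite_set (F `&` O) by apply: sub_finite_set fF => z [].
have cid : (fun v => v) @ nbhs p --> p by exact: cvg_id.
have cW : (fun v => `|Wc v y| : R) @ p --> (K : R).
  by rewrite -(gtr0_norm K0) -Wp; exact: cvg_normW y cid.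
have n1 : \forall k \near p, forall z, (F `&` O) z -> 0 < `| `|Wc k y| - `|Wc u0 z| |.
  apply: (near_finite (F := nbhs p) (P := fun z (k : SL2 R) => 0 < `| `|Wc k y| - `|Wc u0 z| |) fFO) => z [_ Oz].
  have c1 : (fun k => `| `|Wc k y| - `|Wc u0 z| | : R) @ p --> (`| K - `|Wc u0 z| | : R).
    exact: (cvg_norm (cvgB cW (cvg_cst _))).
  apply: (cvgr_gt _ c1); rewrite normr_gt0 subr_eq0 eq_sym; exact/eqP/generic.
have n2 : \forall k \near p, `|Wc k y| < K + 1 by apply: (cvgr_lt _ cW); rewrite ltrDl.
have n3 : \forall k \near p, `|Tc k y| < `|Tc p y| + 1 by apply: near_Tc_lt; rewrite ltrDl.
have hnr : \forall k \near p, [/\ forall z, (F `&` O) z -> 0 < `| `|Wc k y| - `|Wc u0 z| |,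
   `|Wc k y| < K + 1, `|Tc k y| < `|Tc p y| + 1 & V k].
  by near=> k; split; near: k; [exact: n1|exact: n2|exact: n3|exact: Vp].
have [s [g [Gg [m1 m2 m3 m4]]]] := do_dense HO hnr.
have sN : `|s| < N.
  by rewrite ltNge; apply/negP => le; apply: nret; exists s, g.
move: m1 m2 m3; rewrite TcM Tc_flow WcM Wc_flow => m1 m2 m3.
have Og : O (moebius g y) by exact: do_act HO _ _ Gg Oy.
have : (F `&` O) (moebius g y).
  split=> //; apply: hF uB _ Og _ (ltW m2).
  have := ler_normB (Tc u0 (moebius g y) + s) s; rewrite addrK.
  have := ler_norm N; lra.
by move=> /m1; rewrite subrr normr0 ltxx.
Unshelve. all: by end_near. Qed.

(** Two visits of the dense geodesic to a small neighbourhood, at times at least 1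
    apart, differ by a long translation and a matrix close to 1; [closing_matrix]
    corrects the chart so that the geodesic closes up. *)
Lemma periodic_near u (V : set (SL2 R)) : nbhs u V ->
  exists h s g, [/\ V h, s != 0, G g & (h * g = flow s * h)%g].
Proof.
move=> hV.
have [[U1 U2] /= [pU1 pU2] UV] : nbhs ((1%g : SL2 R), u) [set cv | V (cv.1 * cv.2)%g].
  have : (fun cv : SL2 R * SL2 R => cv.1 * cv.2)%g @ nbhs ((1%g : SL2 R), u) --> ((1 : SL2 R) * u)%g.
    by apply: cvg_slM; [exact: cvg_fst|exact: cvg_snd].
  by rewrite mul1g => /(_ _ hV).
have [eta0 eta00 hU1] := nbhs_close1 pU1.
have [eta eta_gt0 hcl] := closing_matrix eta00.
have [[U3 U4] /= [pU3 pU4] UV'] : nbhs (u, u) [set vv | close1 eta (vv.2 * vv.1^-1)%g].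
  have : (fun vv : SL2 R * SL2 R => vv.2 * vv.1^-1)%g @ nbhs (u, u) --> (u * u^-1)%g.
    by apply: cvg_slM; [exact: cvg_snd|apply: cvg_slV; exact: cvg_fst].
  by rewrite mulgV => /(_ _ (close1_nbhs eta_gt0)).
have core v v' t g : U2 v -> U3 v -> U4 v' -> G g -> 1 <= t -> v' = (flow t * v * g)%g ->
  exists h s g, [/\ V h, s != 0, G g & (h * g = flow s * h)%g].
  move=> Uv2 Uv3 Uv4 Gg t1 e1.
  have [c [s [s0 cc cE]]] := hcl _ _ (UV' (v, v') (conj Uv3 Uv4)) t1.
  exists (c * v)%g, s, g; split=> //; first exact: (UV (c, v) (conj (hU1 _ cc) Uv2)).
  rewrite [RHS]mulgA -cE /= e1 -!mulgA; congr (c * _)%g.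
  by rewrite (mulgA (flow (- t))) flowD addNr flow0 mul1g mulVg mulg1.
have hU : nbhs u (U2 `&` U3 `&` U4) by apply: filterI => //; exact: filterI.
have [s1 [g1 [Gg1 [[a2 a3] a4]]]] := do_dense HO hU.
have [s2 [g2 [Gg2 s12 [[b2 b3] b4]]]] := long_return hU (`|s1| + 1).
have rel s s' g g' : (flow s' * u0 * g' = flow (s' - s) * (flow s * u0 * g) * (g^-1 * g'))%g.
  by rewrite !mulgA mulgK flowD subrK.
have [t1|t1] := lerP 1 (s2 - s1).
  exact: (core _ _ _ _ a2 a3 b4 (do_mul HO (do_inv HO Gg1) Gg2) t1 (rel s1 s2 g1 g2)).
have t2 : 1 <= s1 - s2.
  by move: s12 t1; have := ler_norm s1; have := ler_norm (- s1); rewrite normrN;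
    case: (ger0P s2); lra.
exact: (core _ _ _ _ b2 b3 a4 (do_mul HO (do_inv HO Gg2) Gg1) t2 (rel s2 s1 g2 g1)).
Qed.

(** A precompact U is contained in a ball, and a neighbourhood of 0 contains one. *)
Lemma nbhs_rubber (T : Del e d) (B : set (Del e d)) : nbhs T B ->
  exists r eps, [/\ 0 < r, 0 < eps & forall T', rubber (ball (0 : R) r) (ball (0 : R) eps) (T, T') -> B T'].
Proof.
move=> /nbhsP[E [[U U'] [/= oU U0 cU oU' U'0] UE] EB].
have /nbhs_ballP[eps /= eps0 rU'] : nbhs (0 : R) U' by exact: open_nbhs_nbhs.
have [M [_ MU]] : bounded_set (closure U).
  by apply: compact_bounded; rewrite -precompactE.
exists (`|M| + 2), eps; split; [by rewrite ltr_wpDl|by []|].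
move=> T' TT'; apply: EB; rewrite /xsection /= inE; apply: UE.
move: TT'; apply: rubberS => // t Ut.
rewrite /ball /= sub0r normrN.
apply: (@le_lt_trans _ _ (`|M| + 1)); last by rewrite ltrD2l ltr1n.
apply: (MU (`|M| + 1)); last exact: subset_closure.
by rewrite (le_lt_trans (ler_norm M))// ltrDl.
Qed.

Lemma Del_eq (S T : Del e d) : sval S = sval T -> S = T.
Proof.
by case: S T => S hS [T hT] /= ST; subst T; congr exist; exact: Prop_irrelevance.
Qed.

Lemma continuous_Del_act (T : Del e d) : continuous (fun a : R => Del_act a T).
Proof.
move=> v B /nbhs_rubber[r [eps [r0 eps0 hB]]].
apply/nbhs_ballP; exists eps => //= v' vv'; apply: hB; split=> t [/= [s Ts <-] _].
- exists (s - v'); first by exists s.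
  exists (v' - v); last by ring.
  by rewrite /ball /= sub0r normrN distrC.
- exists (s - v); first by exists s.
  exists (v - v'); last by ring.
  by rewrite /ball /= sub0r normrN.
Qed.

(** The orbit is the image of a segment of length |p|. *)
Lemma periodic_of_period (T : Del e d) (p : R) : p != 0 -> Del_act p T = T -> Defs.periodic T.
Proof.
move=> p0 Tp.
have actD a b : Del_act (a + b) T = Del_act a (Del_act b T).
  apply: Del_eq; apply/seteqP; split=> /= t.
    by move=> [s Ts <-]; exists (s - b); [exists s|ring].
  by move=> [_ [s Ts <-] <-]; exists s => //; ring.
have actn n a : Del_act (a + p *+ n) T = Del_act a T.
  by elim: n => [|n IH]; rewrite ?mulr0n ?addr0 // mulrSr addrA actD Tp IH.
have acti (m : int) a : Del_act (a + p *~ m) T = Del_act a T.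
  case: m => n; first exact: actn.
  by rewrite -[in RHS](subrK (p *+ n.+1) a) actn NegzE mulrNz.
rewrite /Defs.periodic.
have -> : Del_orbit T = (fun a : R => Del_act a T) @` `[0, `|p|]%classic.
  apply/seteqP; split=> _ [v _ <-]; last by exists v.
  have p1 : 0 < `|p| by rewrite normr_gt0.
  pose m := Num.floor (v / `|p|).
  have hm1 : m%:~R * `|p| <= v by rewrite -ler_pdivlMr // floor_le.
  have hm2 : v < (m + 1)%:~R * `|p| by rewrite -ltr_pdivrMr // floorD1_gt.
  exists (v - m%:~R * `|p|).
    rewrite /= in_itv /= subr_ge0 hm1 /= lerBlDr.
    by move: hm2; rewrite intrD mulrDl mul1r addrC => /ltW.
  have [pp|pp] := ger0P p.
    by rewrite -[RHS](acti (- m)); congr (Del_act _ T); rewrite mulrNz mulrzl.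
  by rewrite -[RHS](acti m); congr (Del_act _ T); rewrite mulrN opprK mulrzl.
apply: continuous_compact; last exact: segment_compact.
by apply: continuous_subspaceT; exact: continuous_Del_act.
Qed.

Definition half_Del h : Del e d := exist _ (halfstrip O K h) (half_delone HO K0 HS h).

Lemma translate_strip s g : G g -> translate s (strip O K u0) = strip O K (flow (- s) * u0 * g)%g.
Proof.
move=> Gg; apply/seteqP; split=> t.
  move=> [t' st <-]; apply/(@strip_flow R O G u0 HO K (- s) u0 g (t' - s) Gg).
  by rewrite opprK subrK.
move=> /(@strip_flow R O G u0 HO K (- s) u0 g t Gg); rewrite opprK => st.
by exists (t + s) => //; rewrite addrK.
Qed.

Lemma halfstrip_flow h s g : G g ->
  halfstrip O K (flow s * h * g)%g = translate (- s) (halfstrip O K h).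
Proof.
move=> Gg; apply/seteqP; split=> t.
  move=> [y Oy [[W1 W2] <-]]; exists (Tc h (moebius g y)).
    exists (moebius g y); first exact: do_act HO _ _ Gg Oy.
    by move: W1 W2; rewrite WcM Wc_flow.
  by rewrite TcM Tc_flow opprK.
move=> [_ [y Oy [[W1 W2] <-]] <-].
exists (moebius g^-1%g y); first exact: do_act HO _ _ (do_inv HO Gg) Oy.
by rewrite /in_half /= WcM Wc_flow TcM Tc_flow moebiusVK opprK.
Qed.

(** Two sets of projections are close for the rubber topology when the points of the
    orbit that produce them are the same over a bounded time. *)
Lemma rubber_matched A v u r eps (P Q : set R) :
  (forall t, P t <-> exists2 y, O y & A y /\ Tc v y = t) ->
  (forall y, O y -> `|Wc u y| < K -> Q (Tc u y)) ->
  (forall t, Q t -> exists2 y, O y & `|Wc u y| <= K /\ Tc u y = t) ->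
  matched O K A v u r eps -> P `&` ball (0 : R) r `<=` Defs.msum Q (ball (0 : R) eps) /\
    Q `&` ball (0 : R) r `<=` Defs.msum P (ball (0 : R) eps).
Proof.
move=> PE T1 T2 m; split=> t.
  move=> [/PE[y Oy [Ay <-]]]; rewrite /ball /= sub0r normrN => /ltW Ty.
  have [W1 t1] := (m y Oy).1 Ty Ay; exists (Tc u y); first exact: T1.
  by exists (Tc v y - Tc u y); [rewrite /ball /= sub0r normrN distrC|rewrite addrC subrK].
move=> [/T2[y Oy [Wy <-]]]; rewrite /ball /= sub0r normrN => /ltW Ty.
have [Ay W1 t1] := (m y Oy).2 Ty Wy; exists (Tc v y); first by apply/PE; exists y.
by exists (Tc u y - Tc v y); [rewrite /ball /= sub0r normrN|rewrite addrC subrK].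
Qed.

Variable S : Del e d.
Hypothesis SE : sval S = strip O K u0.

Lemma translate0 (P : set R) : translate 0 P = P.
Proof.
apply/seteqP; split=> t; first by move=> [s Ps <-]; rewrite subr0.
by move=> Pt; exists t => //; rewrite subr0.
Qed.

Lemma half_Del_closure h : closure (Del_orbit S) (half_Del h).
Proof.
move=> B /nbhs_rubber[r [eps [r0 eps0 hB]]].
have [s [g [Gg ms]]] := half_limit HO K0 h r eps0.
exists (Del_act (- s) S); split; first by exists (- s).
apply: hB; rewrite /rubber /= SE (translate_strip (- s) Gg) opprK.
apply: (@rubber_matched (in_half K h) h (flow s * u0 * g)%g) => //.
- by move=> y Oy Wy; exists y.
- by move=> t [y Oy [Wy <-]]; exists y => //; split=> //; exact: ltW.
Qed.

Lemma Del_act_half h (a : R) : Del_act a (half_Del h) = half_Del (flow (- a) * h)%g.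
Proof.
apply: Del_eq => /=; have := halfstrip_flow h (- a) (dense_orbit1 HO).
by rewrite mulg1 opprK => ->.
Qed.

Lemma half_Del_periodic h s g : G g -> s != 0 -> (h * g = flow s * h)%g ->
  Defs.periodic (half_Del h).
Proof.
move=> Gg s0 hg; apply: (periodic_of_period (p := s)) => //.
rewrite Del_act_half; apply: Del_eq => /=.
have := halfstrip_flow (flow (- s) * h)%g 0 Gg.
rewrite flow0 mul1g -[in LHS]mulgA hg mulgA flowD addNr flow0 mul1g => ->.
by rewrite oppr0 translate0.
Qed.

(** The translates of S are approximated by the half-strips of closed geodesics,
    which have periodic orbits contained in the closure of the orbit of S. *)
Lemma strip_chaotic : chaotic S.
Proof.
split; last first.
  move=> a a0 Sa; case/eqP : a0; apply: (strip_aperiodic HO HS) => t.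
  rewrite -SE -{1}Sa /= => -[t' St' <-]; by rewrite subrK.
rewrite /almost_chaotic [X in _ `<=` X](closure_id _).1; last exact: closed_closure.
apply: closure_subset => _ [a _ <-] B /nbhs_rubber[r [eps [r0 eps0 hB]]].
pose u := (flow (- a) * u0)%g.
have gen y : O y -> `|Tc u y| <= r + 1 -> `|Wc u y| <> K.
  by move=> Oy _; rewrite Wc_flow; exact: generic.
have [h [s [g [mh s0 Gg hg]]]] := periodic_near (near_match_strip HO eps0 gen).
exists (half_Del h); split.
  exists (half_Del h); last by exists 0 => //; apply: Del_eq; rewrite /= translate0.
  split; first exact: half_Del_periodic Gg s0 hg.
  by move=> _ [b _ <-]; rewrite Del_act_half; exact: half_Del_closure.
apply: hB; rewrite /rubber /= SE (translate_strip a (dense_orbit1 HO)) mulg1.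
apply: (@rubber_matched (in_strip K u) u h) => //.
- by move=> y Oy; rewrite ltr_norml => /andP[W1 W2]; exists y => //; split=> //; split=> //; exact: ltW.
- by move=> t [y Oy [[W1 W2] <-]]; exists y => //; split=> //; rewrite ler_norml (ltW W1) W2.
Qed.

End Periodic.

(** * Distances to orbits and to geodesics *)

Lemma finite_min {R : realType} {X : choiceType} (A : set X) (f : X -> R) :
  finite_set A -> A !=set0 -> exists2 a, A a & forall b, A b -> f a <= f b.
Proof.
move=> /finite_seqP[s ->] [a /= sa].
case: (@arg_minP _ _ _ (SeqSub sa) predT (fun i : seq_sub s => f (val i)) isT) => m _ hm.
by exists (val m); [exact: valP|move=> b sb; exact: hm (SeqSub sb) isT].
Qed.

Lemma inf_min {R : realType} (A : set R) m : A m -> (forall a, A a -> m <= a) -> inf A = m.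
Proof.
move=> Am Amin; apply/le_anti/andP; split; first by apply: ge_inf => //; exists m.
by apply: lb_le_inf => //; exists m.
Qed.

Section LocallyFinite.
Context {R : realType} {O : set (H2 R)}.
Implicit Types (y z : H2 R).
Hypothesis fin : forall r, finite_set [set y | O y /\ hcosh y (axis 0) <= r].

Lemma orbit_ball_finite z (r : R) : finite_set [set y | O y /\ hdist y z <= r].
Proof.
apply: sub_finite_set (fin (ch (r + hdist z (axis 0)))) => y [Oy yz]; split=> //.
have r0 : 0 <= r by apply: le_trans yz; exact: hdist_ge0.
rewrite -hdist_le ?addr_ge0 ?hdist_ge0 //.
by apply: le_trans (hdist_triangle z _ _) _; rewrite lerD2r.
Qed.

Lemma nearest_point (B : set (H2 R)) z : B `<=` O -> B !=set0 ->
  exists2 y, B y & forall y', B y' -> hdist y z <= hdist y' z.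
Proof.
move=> BO [b Bb].
have fB : finite_set [set y | B y /\ hdist y z <= hdist b z].
  by apply: sub_finite_set (orbit_ball_finite z (hdist b z)) => y [/BO Oy yz].
have [|y [By yb] ymin] := finite_min (fun y => hdist y z) fB.
  by exists b.
exists y => // y' By'; have [h|h] := leP (hdist y' z) (hdist b z).
  exact: ymin.
by rewrite (le_trans yb) // ltW.
Qed.

End LocallyFinite.

Section Tube.
Context {R : realType}.
Implicit Types (y z : H2 R) (g h : SL2 R) (t r : R).

Lemma hcosh_frame g t y :
  hcosh (moebius g (axis t)) y = cw (moebius g^-1%g y) * ch (t - Tc g^-1%g y).
Proof. by rewrite -(hcosh_moebius g^-1%g) moebiusK hcosh_axis. Qed.

Lemma sh_ge0 r : (0 <= sh r) = (0 <= r).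
Proof. by rewrite !leNgt -{1}sh0 sh_lt. Qed.

Lemma cw_Wc_lt g y r : 0 <= r -> (cw (moebius g y) < ch r) = (`|Wc g y| < sh r).
Proof. by move=> r0; rewrite cw_lt [`|sh r|]ger0_norm ?sh_ge0. Qed.

Lemma cw_Wc_le g y r : 0 <= r -> (cw (moebius g y) <= ch r) = (`|Wc g y| <= sh r).
Proof. by move=> r0; rewrite cw_le [`|sh r|]ger0_norm ?sh_ge0. Qed.

Lemma dist_toE g y : dist_to (fun t => moebius g (axis t)) y =
  hdist (moebius g (axis (Tc g^-1%g y))) y.
Proof.
apply: inf_min; first by exists (Tc g^-1%g y).
have e := hcosh_frame g (Tc g^-1%g y) y; rewrite subrr ch0 mulr1 in e.
move=> _ [t _ <-]; rewrite -(ch_le (hdist_ge0 _ _) (hdist_ge0 _ _)) !ch_hdist e (hcosh_frame g t y).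
by rewrite ler_peMr ?ch_ge1 // ltW // cw_gt0.
Qed.

Lemma dist_to_lt g y r : 0 <= r ->
  (dist_to (fun t => moebius g (axis t)) y < r) = (`|Wc g^-1%g y| < sh r).
Proof. by move=> r0; rewrite dist_toE hdist_lt // hcosh_frame subrr ch0 mulr1 cw_Wc_lt. Qed.

Lemma dist_to_eq g y r : 0 <= r -> `|Wc g^-1%g y| = sh r ->
  dist_to (fun t => moebius g (axis t)) y = r.
Proof.
move=> r0 e; apply/le_anti/andP; split; last by rewrite leNgt dist_to_lt // e ltxx.
by rewrite dist_toE hdist_le // hcosh_frame subrr ch0 mulr1 cw_Wc_le // e.
Qed.

Lemma vel_flow g t : vel (g * flow t)%g 0 = vel g t.
Proof. by rewrite !velE flow0 mulg1. Qed.

Lemma moebius_flowD g s t : moebius (g * flow s)%g (axis t) = moebius g (axis (t + s)).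
Proof. by rewrite moebiusM flow_axis. Qed.

Lemma continuous_vel g : continuous (fun t => complex.Re (vel g t)) /\
  continuous (fun t => complex.Im (vel g t)).
Proof.
have D0 t : (g 1 0 * expR t) ^+ 2 + g 1 1 ^+ 2 != 0.
  have := bot_gt0 g (axis t); rewrite /bot hx_of hy_of /= mulr0 add0r addrC.
  by move=> ?; rewrite gt_eqF.
have cexp t : (fun s : R => expR s : R) @ t --> (expR t : R) by exact: continuous_expR.
have cD t : (fun s => (((g 1 0 * expR s) ^+ 2 + g 1 1 ^+ 2) ^+ 2)^-1 : R) @ t -->
    ((((g 1 0 * expR t) ^+ 2 + g 1 1 ^+ 2) ^+ 2)^-1 : R).
  apply: cvgV; first by rewrite expf_neq0.
  apply: cvg_sqr; apply: cvgD; last exact: cvg_cst.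
  by apply: cvg_sqr; apply: cvgM; [exact: cvg_cst|exact: cexp].
have cq t : (fun s => g 1 1 ^+ 2 - (g 1 0 * expR s) ^+ 2 : R) @ t -->
    (g 1 1 ^+ 2 - (g 1 0 * expR t) ^+ 2 : R).
  by apply: cvgB; [exact: cvg_cst|apply: cvg_sqr; apply: cvgM; [exact: cvg_cst|exact: cexp]].
have cp t : (fun s => 2 * g 1 0 * g 1 1 * expR s : R) @ t --> (2 * g 1 0 * g 1 1 * expR t : R).
  by apply: cvgM; [exact: cvg_cst|exact: cexp].
split=> t.
- rewrite (_ : (fun t => _) = fun s => (0 * (g 1 1 ^+ 2 - (g 1 0 * expR s) ^+ 2) +
    expR s * (2 * g 1 0 * g 1 1 * expR s)) / ((g 1 0 * expR s) ^+ 2 + g 1 1 ^+ 2) ^+ 2); last first.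
    by apply/funext => s; rewrite /vel dmoebius_axisE.
  apply: cvgM (cD t); apply: cvgD; apply: cvgM; first [exact: cvg_cst|exact: cexp|exact: cq|exact: cp].
- rewrite (_ : (fun t => _) = fun s => (expR s * (g 1 1 ^+ 2 - (g 1 0 * expR s) ^+ 2) -
    0 * (2 * g 1 0 * g 1 1 * expR s)) / ((g 1 0 * expR s) ^+ 2 + g 1 1 ^+ 2) ^+ 2); last first.
    by apply/funext => s; rewrite /vel dmoebius_axisE.
  apply: cvgM (cD t); apply: cvgB; apply: cvgM; first [exact: cvg_cst|exact: cexp|exact: cq|exact: cp].
Qed.

(** The component of the field along the unit normal is continuous and vanishes
    nowhere. *)
Lemma normal_field_side g nu : normal_field (fun t => moebius g (axis t)) nu ->
  exists2 sg : R, sg = 1 \/ sg = -1 & forall t,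
    0 < sg * riem (moebius g (axis t)) (nor g t) (nu t).
Proof.
move=> [c1 c2 nu0 nuv]; have [v1 v2] := continuous_vel g.
pose f t := complex.Im (vel g t) * complex.Re (nu t) - complex.Re (vel g t) * complex.Im (nu t).
have fE t : riem (moebius g (axis t)) (nor g t) (nu t) = f t / hy (moebius g (axis t)) ^+ 2.
  by rewrite /riem norE /= mulNr.
have cf : continuous f.
  by move=> t; apply: cvgB; apply: cvgM; [exact: v2|exact: c1|exact: v1|exact: c2].
have f0 t : f t != 0.
  apply/eqP => ft; have := nu0 t; have := nuv t; rewrite velocityE.
  have := fE t; rewrite ft mul0r.
  have [[a b] ->] := frame_vec (g * flow t)%g (axis 0) (nu t).
  rewrite velE !riem_frame /= !(mulr0, mulr1, mul1r, mul0r, add0r, addr0) => -> ->.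
  by rewrite /dmoebius mul0r eqxx.
have fs s t : 0 < f s -> 0 < f t.
  move=> fs; rewrite lt0r f0 leNgt; apply/negP => ft.
  have [st|ts] := leP s t.
  - have [|c _ /eqP] := @IVT _ f s t 0 st (continuous_subspaceT cf).
      by rewrite ge_min le_max (ltW ft) (ltW fs) orbT.
    by rewrite (negbTE (f0 c)).
  - have [|c _ /eqP] := @IVT _ f t s 0 (ltW ts) (continuous_subspaceT cf).
      by rewrite ge_min le_max (ltW ft) (ltW fs) orbT.
    by rewrite (negbTE (f0 c)).
have p t : 0 < (hy (moebius g (axis t)) ^+ 2)^-1 by rewrite invr_gt0 exprn_gt0 // hy_gt0.
have [f00|f00] := ltP 0 (f 0).
  by exists 1; [left|move=> t; rewrite fE mul1r mulr_gt0 // (fs 0)].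
exists (-1); first by right.
move=> t; rewrite fE mulN1r oppr_gt0 pmulr_llt0 // lt_neqAle f0 leNgt.
apply/negP => ft; have := fs _ 0 ft; by rewrite ltNge f00.
Qed.

End Tube.

(** * Distances on the surface *)

Section Surface.
Context {R : realType} {Gamma : set (PSL2 R)} {x : H2 R}.
Hypothesis hsub : subgroup Gamma.
Hypothesis hdisc : isolated Gamma = Gamma.
Implicit Types (y z : H2 R) (g h u : SL2 R) (t r : R).
Local Notation O := (act_orbit (@psl_act R) Gamma x).
Local Notation x0 := (\pi_(surface Gamma) x).

Lemma orbit_self z : act_orbit (@psl_act R) Gamma z z.
Proof. by apply/orbitP; exists 1%g; [exact: lat1|rewrite moebius1]. Qed.

Lemma orbit_act g y : lat Gamma g -> O y -> O (moebius g y).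
Proof.
move=> Gg /orbitP[h Gh ->]; apply/orbitP; exists (g * h)%g; first exact: latM.
by rewrite moebiusM.
Qed.

Lemma orbit_fin r : finite_set [set y | O y /\ hcosh y (axis 0) <= r].
Proof.
by apply: sub_finite_set (orbit_locally_finite hsub hdisc x r) => y [/orbitP Oy yr].
Qed.

Lemma sval_surface z : sval (\pi_(surface Gamma) z) = act_orbit (@psl_act R) Gamma z.
Proof. exact: val_pi_orbit. Qed.

(** The group acts by isometries, so only the point of the orbit of x has to vary,
    and the orbit is locally finite. *)
Lemma sdistP z : exists2 y, O y & sdist x0 (\pi_(surface Gamma) z) = hdist y z /\
  forall y', O y' -> hdist y z <= hdist y' z.
Proof.
have [|y Oy ymin] := nearest_point orbit_fin z (fun y (Oy : O y) => Oy).
  by exists x; exact: orbit_self.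
exists y => //; split=> //; rewrite /sdist !sval_surface; apply: inf_min.
  by exists y => //; exists z => //; exact: orbit_self.
move=> _ [y' Oy' [_ /orbitP[g Gg ->] <-]].
rewrite -(hdist_moebius g^-1%g y') moebiusK; apply: ymin.
by apply: orbit_act => //; exact: latV.
Qed.

Lemma closed_diskP z r : closed_disk x0 r (\pi_(surface Gamma) z) <->
  exists2 y, O y & hdist y z <= r.
Proof.
have [y Oy [e ymin]] := sdistP z; rewrite /closed_disk /= e; split=> [yr|[y' Oy' y'r]].
  by exists y.
exact: le_trans (ymin _ Oy') y'r.
Qed.

(** Two points of the orbit cannot both be within r of z. *)
Lemma sdist_near z y r : (forall y' z', O y' -> O z' -> y' <> z' -> 2 * r < hdist y' z') ->
  O y -> hdist y z = r -> sdist x0 (\pi_(surface Gamma) z) = r.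
Proof.
move=> sep Oy yr; have [y' Oy' [-> ymin]] := sdistP z.
have [<- //|y'y] := EM (y = y').
have := sep _ _ Oy Oy' y'y; have := hdist_triangle z y y'; have := ymin _ Oy.
by rewrite yr [hdist z _]hdistC; lra.
Qed.

Lemma inj_radius_sep y z : O y -> O z -> y <> z -> 2 * inj_radius x0 <= hdist y z.
Proof.
move=> Oy Oz yz; rewrite /inj_radius mulrC divfK ?pnatr_eq0 //; apply: ge_inf.
  by exists 0 => _ [a [b [_ _ _ ->]]]; exact: hdist_ge0.
by exists y, z; rewrite !sval_surface.
Qed.

(** The infimum is attained: one of the two points can be moved to x. *)
Lemma inj_radius_gt r : (exists y z, [/\ O y, O z & y <> z]) ->
  (forall y z, O y -> O z -> y <> z -> 2 * r < hdist y z) -> r < inj_radius x0.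
Proof.
move=> [y [z [/orbitP[g Gg ->] Oz yz]]] sep.
have [||w [Ow wx] wmin] := @nearest_point R O orbit_fin [set w | O w /\ w <> x] x.
- by move=> w [].
- exists (moebius g^-1%g z); split; first by apply: orbit_act => //; exact: latV.
  by move=> e; apply: yz; rewrite -e moebiusVK.
have e : inf [set r | exists y z, [/\ sval x0 y, sval x0 z, y <> z & r = hdist y z]] = hdist w x.
  apply: inf_min; first by exists w, x; rewrite !sval_surface; split=> //; exact: orbit_self.
  move=> _ [a [b [Oa Ob ab ->]]]; rewrite !sval_surface in Oa Ob.
  have [h Gh bE] := (orbitP _ _ _).1 Ob.
  have -> : hdist a b = hdist (moebius h^-1%g a) x.
    by rewrite bE -(hdist_moebius h^-1%g a) moebiusK.
  apply: wmin; split; first by apply: orbit_act => //; exact: latV.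
  by move=> e; apply: ab; rewrite bE -e moebiusVK.
rewrite /inj_radius e; have := sep w x Ow (orbit_self x) wx; lra.
Qed.

End Surface.

(** * One-sided tangency *)

Section Tangency.
Context {R : realType} {Gamma : set (PSL2 R)} {x : H2 R}.
Hypothesis hsub : subgroup Gamma.
Hypothesis hdisc : isolated Gamma = Gamma.
Implicit Types (y z : H2 R) (g h u : SL2 R) (t r : R).
Local Notation O := (act_orbit (@psl_act R) Gamma x).
Local Notation x0 := (\pi_(surface Gamma) x).
Variable rho : R.
Hypothesis rho0 : 0 < rho.
Local Notation K := (sh rho).

Lemma hdist_frame_le g t y : hdist y (moebius g (axis t)) <= rho -> `|Wc g^-1%g y| <= K.
Proof.
rewrite hdistC hdist_le ?(ltW rho0) // hcosh_frame => h.
rewrite -cw_Wc_le ?(ltW rho0) //; apply: le_trans h.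
by rewrite ler_peMr ?ch_ge1 // ltW // cw_gt0.
Qed.

Lemma disk_meets g y : O y -> `|Wc g^-1%g y| <= K ->
  closed_disk x0 rho (\pi_(surface Gamma) (moebius g (axis (Tc g^-1%g y)))).
Proof.
move=> Oy yK; apply/(closed_diskP hsub hdisc); exists y => //.
by rewrite hdistC hdist_le ?(ltW rho0) // hcosh_frame subrr ch0 mulr1 cw_Wc_le // ltW.
Qed.

(** The radius that ends orthogonally at a point of a geodesic starts at the
    point of the orbit that projects there, at signed distance rho. *)
Lemma outward_normal_chart g t n : outward_normal x0 rho (moebius g (axis t)) n ->
  riem (moebius g (axis t)) n (velocity (fun s => moebius g (axis s)) t) = 0 ->
  exists y sg, [/\ O y, hdist y (moebius g (axis t)) = rho,
    sg = 1 \/ sg = -1, Tc g^-1%g y = t /\ Wc g^-1%g y = - sg * K &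
    n = dmoebius (g * flow t)%g (axis 0) (sg +i* 0)].
Proof.
move=> [k [hk]]; rewrite sval_surface => Ok kr ->; rewrite velocityE.
have dk : hdist (k 0) (moebius g (axis t)) = rho.
  by rewrite -kr hk sub0r normrN gtr0_norm.
have [h [kE vE]] := geodesic_frame hk.
rewrite vE -(vel_flow h rho) => rv.
have [|sg [sg1 v E]] := perp_frameP _ rv.
  by rewrite moebius_flow -kr kE.
exists (k 0), sg; split; [exact: Ok|exact: dk|exact: sg1| |exact: v].
have k0 : moebius (h * flow rho)%g (axis (- rho)) = k 0.
  by rewrite moebius_flowD addNr kE.
by have := E (- rho); rewrite k0 shN mulrN -mulNr.
Qed.

(** A disk that meets the geodesic has a boundary point on it, and the radius that
    ends there is orthogonal to the geodesic. So the geodesic touches the disk, and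
    the outward normal, which tells the side of the disk, is on the same side as
    the given normal field. *)
Lemma no_one_sided_tangency (sigma : R -> surface Gamma) :
  (forall y z, O y -> O z -> y <> z -> 2 * rho < hdist y z) ->
  (forall u sg, sg = 1 \/ sg = -1 -> ~ forall y, O y -> `|Wc u y| <= K -> Wc u y = sg * K) ->
  ~ one_sided_tangency x0 rho sigma.
Proof.
move=> sep nos [s [nu [[hs ->] hnu H]]].
have [g [sE vE]] := geodesic_frame hs; rewrite sE in hnu H.
have [sg0 sg01 sg0P] := normal_field_side hnu.
apply: (nos g^-1%g (- sg0)).
  by case: sg01 => ->; rewrite ?opprK; [right|left].
move=> y Oy yK.
have c0 := cw_gt0 (moebius g^-1%g y).
have q1 : 1 <= ch rho / cw (moebius g^-1%g y).
  by rewrite ler_pdivlMr // mul1r cw_Wc_le // ltW.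
have [aE a0] := arcoshK q1; set a := arcosh _ in aE a0.
pose t := Tc g^-1%g y + a.
have yt : hdist y (moebius g (axis t)) = rho.
  rewrite hdistC; apply: hdist_eq; first exact: ltW.
  by rewrite hcosh_frame /t addrC addKr aE mulrC divfK // gt_eqF.
have [n [no rv rn]] := H t (sdist_near hsub hdisc sep Oy yt).
have [y' [sg [Oy' y't sg1 [_ WE] nE]]] := outward_normal_chart no rv.
have yy' : y = y'.
  apply: contrapT => /(sep _ _ Oy Oy').
  have := hdist_triangle (moebius g (axis t)) y y'; rewrite yt (hdistC (moebius g (axis t))) y't; lra.
rewrite yy' WE; congr (- _ * K).
have := sg0P t; move: rn; rewrite nE /nor.
have [[p q] ->] := frame_vec (g * flow t)%g (axis 0) (nu t).
rewrite !riem_frame /= !mul0r !addr0 mul1r.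
by case: sg01 sg1 => -> [] -> //; lra.
Qed.

(** Conversely, if all the points in the closed strip lie on one side of it, the
    geodesic is tangent to the disk, with the normal pointing away from them. *)
Lemma one_sided_tangency_of u sg : sg = 1 \/ sg = -1 ->
  (forall y, O y -> `|Wc u y| <= K -> Wc u y = sg * K) ->
  exists sigma : R -> surface Gamma,
    surface_geodesic sigma /\ one_sided_tangency x0 rho sigma.
Proof.
move=> sg1 H; pose g := u^-1%g; have uE : u = g^-1%g by rewrite invgK.
rewrite {}uE in H.
pose s t := moebius g (axis t).
have hs : lifts s (\pi_(surface Gamma) \o s) by split=> //; exact: frame_geodesic.
exists (\pi_(surface Gamma) \o s); split; first by exists s.
pose nu t := dmoebius (g * flow t)%g (axis 0) ((- sg) +i* 0).
have sgsg : (- sg) * (- sg) = 1 by case: sg1 => ->; rewrite ?opprK ?mulrNN mulr1.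
have nuE t : nu t = (- sg * complex.Im (vel g t)) +i* (sg * complex.Re (vel g t)).
  have : nor g t = complex.Im (vel g t) +i* (- complex.Re (vel g t)) by exact: norE.
  rewrite /nor /nu !dmoebius_axisE /= => -[<- /(congr1 -%R)]; rewrite opprK => <-.
  by congr (_ +i* _); rewrite !(mul0r, mul1r); ring.
have nuv t : riem (s t) (nu t) (velocity s t) = 0.
  by rewrite /s velocityE velE riem_frame /= mulr0 mul0r addr0.
have nunu t : riem (s t) (nu t) (nu t) = 1.
  by rewrite riem_frame /= mul0r addr0.
have [v1 v2] := continuous_vel g.
exists s, nu; split=> //.
  split=> // [t|t|t].
  - rewrite (_ : (fun t => _) = fun t => - sg * complex.Im (vel g t)).
      by apply: cvgM; [exact: cvg_cst|exact: v2].
    by apply/funext => ?; rewrite nuE.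
  - rewrite (_ : (fun t => _) = fun t => sg * complex.Re (vel g t)).
      by apply: cvgM; [exact: cvg_cst|exact: v1].
    by apply/funext => ?; rewrite nuE.
  - apply/eqP => n0; have := nunu t; rewrite n0 /riem /= mul0r addr0 mul0r => /eqP.
    by rewrite eq_sym oner_eq0.
move=> t; rewrite /disk_boundary /=; have [y Oy [-> _]] := @sdistP R Gamma x hsub hdisc (s t) => yt.
have WE : Wc g^-1%g y = sg * K by apply: (H _ Oy); apply: (@hdist_frame_le g t y); rewrite -/(s t) yt.
have TE : Tc g^-1%g y = t.
  have cE : cw (moebius g^-1%g y) = ch rho.
    have WK : `|Wc g^-1%g y| = K.
      rewrite WE normrM (_ : `|sg| = 1) ?mul1r; last first.
        by case: sg1 => ->; rewrite ?normrN normr1.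
      by rewrite ger0_norm // sh_ge0 ltW.
    apply/le_anti/andP; split; first by rewrite cw_Wc_le ?WK // ltW.
    by rewrite leNgt cw_Wc_lt ?WK ?ltxx // ltW.
  have := hcosh_frame g t y; rewrite -ch_hdist hdistC yt cE => e.
  have : ch (t - Tc g^-1%g y) = 1.
    by apply: (mulfI (lt0r_neq0 (ch_gt0 rho))); rewrite -e mulr1.
  rewrite -ch0 -ch_norm => /(ch_inj (normr_ge0 _) (lexx 0)) /eqP.
  by rewrite normr_eq0 subr_eq0 => /eqP.
have [|h hE [_ vh E]] := @perp_frame_exists R g t (- sg).
  by case: sg1 => ->; rewrite ?opprK; [right|left].
exists (nu t); split=> //; last by rewrite nunu.
exists (fun r => moebius (h * flow (- rho))%g (axis r)); split.
- exact: frame_geodesic.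
- rewrite sval_surface moebius_flowD add0r (_ : moebius h _ = y) //.
  apply: (can_inj (moebiusK g^-1%g)).
  have [E1 E2] := E (- rho); apply: chart_inj; first by rewrite E1 -TE.
  by rewrite E2 shN mulrNN -WE.
- by rewrite moebius_flowD addrN.
- by rewrite velocityE -(vel_flow _ rho) -mulgA flowD addNr flow0 mulg1 vh.
Qed.

End Tangency.

(** * Delone sets of a dense geodesic *)

Section Assembly.
Context {R : realType} {Gamma : set (PSL2 R)} {x : H2 R} {g0 : SL2 R}.
Implicit Types (y z : H2 R) (g h u : SL2 R) (t r : R).
Local Notation O := (act_orbit (@psl_act R) Gamma x).
Local Notation l := (fun t => moebius g0 (axis t)).

Lemma dense_orbit_geodesic : uniform_lattice Gamma ->
  dense [set \pi_(surface_UT Gamma) u | u in flow_orbit l] ->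
  dense_orbit O (lat Gamma) g0^-1%g.
Proof.
move=> [hsub hdisc hcpt] hd; split.
- exact: orbit_fin.
- by move=> g y; exact: orbit_act.
- by move=> g h; exact: latM.
- by move=> g; exact: latV.
- exact: lat_cocompact.
- move=> u V uV.
  have uV' : nbhs u^-1%g [set v | V v^-1%g].
    have : (fun v : SL2 R => v^-1)%g @ nbhs u^-1%g --> u^-1^-1%g by exact: cvg_slV.
    by rewrite invgK => /(_ _ uV).
  have [s [g [Gg]]] := orbit_dense hsub erefl hd uV'.
  rewrite /= !invgM (_ : (flow s)^-1%g = flow (- s)) => [Vg|]; last first.
    by apply: (mulgI (flow s)); rewrite mulgV flowD addrN flow0.
  exists (- s), g^-1%g.
  by split; [exact: latV|rewrite -mulgA].
Qed.

Lemma proj_set_strip (rho : R) : 0 < rho -> proj_set Gamma rho x l = strip O (sh rho) g0^-1%g.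
Proof.
move=> rho0; apply/seteqP; split=> t.
  move=> [y [yE Oy] /orth_projP yt]; exists y => //; split=> //.
  by rewrite -dist_to_lt // ltW.
move=> [y Oy [yE yt]]; exists y; last exact/orth_projP.
by split=> //; rewrite /tube /= dist_to_lt // ltW.
Qed.

End Assembly.

Lemma delone_two_points {R : realType} {e d : R} {P : set R} : delone e d P ->
  exists s t, [/\ P s, P t & s <> t].
Proof.
move=> [e0 _ he _]; have [s Ps s1] := he 0; have [t Pt t1] := he (2 * e + 1).
exists s, t; split=> // st; rewrite -st in t1.
by have := ler_normD (2 * e + 1 - s) s; rewrite subrK ger0_norm; move: s1; rewrite sub0r normrN; lra.
Qed.

Theorem theorem1p4 (R : realType) (Gamma : set (PSL2 R)) (rho : R) (x : H2 R)
    (l : R -> H2 R) (hGamma : uniform_lattice Gamma)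
    (hfree : torsion_free Gamma) (hrho : 0 < rho) (hl : geodesic l)
    (hdense : dense [set \pi_(surface_UT Gamma) u | u in flow_orbit l])
    (hgen : forall y, act_orbit (@psl_act R) Gamma x y -> dist_to l y <> rho) :
  let x0 := \pi_(surface Gamma) x in
  let S_l := proj_set Gamma rho x l in
  (is_delone S_l <->
     rho < inj_radius x0 /\
     ((forall sigma : R -> surface Gamma, surface_geodesic sigma ->
         exists t, closed_disk x0 rho (sigma t)) /\
      ~ exists sigma : R -> surface Gamma,
          surface_geodesic sigma /\ one_sided_tangency x0 rho sigma)) /\
  (forall (e d : R) (S : Del e d), sval S = S_l -> chaotic S).
Proof.
move=> x0 S_l.
have [g0 [lE _]] := geodesic_frame hl; rewrite {}/S_l {l hl}lE in hdense hgen *.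
have [hsub hdisc _] := hGamma; have HO := @dense_orbit_geodesic _ _ x _ hGamma hdense.
rewrite (proj_set_strip hrho).
have K0 : 0 < sh rho by rewrite sh_gt0.
have generic y : act_orbit (@psl_act R) Gamma x y -> `|Wc g0^-1%g y| <> sh rho.
  by move=> /hgen yr yK; apply: yr; apply: dist_to_eq; rewrite ?ltW.
split; first split.
- move=> [e [d HS]].
  have sep y z := @delone_separated _ _ _ _ HO _ _ _ HS rho y z erefl.
  split.
    apply: (inj_radius_gt hsub hdisc) => //.
    have [_ [_ [[y Oy [_ <-]] [z Oz [_ <-]] yz]]] := delone_two_points HS.
    by exists y, z; split=> // e'; apply: yz; rewrite e'.
  split.
    move=> _ [s [/geodesic_frame[g [-> _]] ->]].
    have [y Oy [_ yK]] := delone_meets HO HS g^-1%g.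
    by exists (Tc g^-1%g y); exact: disk_meets.
  move=> [sigma [_]]; apply: (no_one_sided_tangency hsub hdisc hrho sep).
  move=> u sg [->|->] H.
    by apply: (delone_not_one_sided HO HS (u := u)) => y Oy yK; rewrite H ?mul1r.
  by apply: (delone_not_one_sidedN HO HS (u := u)) => y Oy yK; rewrite H ?mulN1r.
- move=> [inj [_ nt]].
  apply: (@delone_of_conditions _ _ _ _ HO _ rho (2 * inj_radius x0)) => //.
  + by move=> y z; exact: inj_radius_sep.
  + by rewrite ltr_pM2l.
  + by move=> u sg sg1 H; apply: nt; exact: one_sided_tangency_of sg1 H.
- move=> e d S SE; apply: (strip_chaotic HO K0 _ generic SE).
  by rewrite -SE; exact: (svalP S).
Qed.
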